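(* Let $n\ge 2$ and let $T$ be a Calder\'on--Zygmund operator on $\mathbb{R}^n$. Then the following are equivalent: (i) there exists a constant $C>0$ such that for every $f\in C_c^1(\mathbb{R}^n)$, $$|Tf(x)|\le C\, I_1(|\nabla f|)(x)\quad\text{for almost every }x\in\mathbb{R}^n;$$ (ii) $T(1)\in L^\infty$.
   Context: **Riesz potential.** $I_1$ is the Riesz potential operator of order $1$: $I_1g(x)=\int_{\mathbb{R}^n}\frac{g(y)}{|x-y|^{n-1}}\,dy$ for nonnegative measurable $g$ (the normalization constant is immaterial). **Calder\'on--Zygmund operator.** This means a linear operator $T$ of weak type $(1,1)$ (i.e. bounded from $L^1(\mathbb{R}^n)$ to $L^{1,\infty}(\mathbb{R}^n)$) which is represented by $$Tf(x)=\int_{\mathbb{R}^n}K(x,y)f(y)\,dy\quad\text{for all }x\notin\operatorname{supp}f$$ for compactly supported $f\in L^1(\mathbb{R}^n)$, with a kernel $K$ satisfying the smoothness condition $$|K(x,y)-K(x',y)|\le\omega\left(\frac{|x-x'|}{|x-y|}\right)\frac{1}{|x-y|^n}\quad\text{for }|x-x'|\le|x-y|/2,$$ where $\omega$ is a modulus of continuity (nondecreasing, subadditive, $\omega(0)=0$) satisfying the Dini condition $\int_0^1\omega(t)\frac{dt}{t}<\infty$. **The distribution $T(1)$.** Let $\mathscr{D}_0(\mathbb{R}^n)$ be the space of smooth compactly supported functions on $\mathbb{R}^n$ with integral zero. For $\varphi\in\mathscr{D}_0(\mathbb{R}^n)$ choose $\eta\in C_c^\infty(\mathbb{R}^n)$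 with $\eta=1$ on a neighborhood of $\operatorname{supp}\varphi$ and set $$\langle T(1),\varphi\rangle:=\langle T(\eta),\varphi\rangle+\int_{\mathbb{R}^n}\left(\int_{\mathbb{R}^n}K(x,y)\varphi(x)\,dx\right)(1-\eta(y))\,dy,$$ where $\langle T(\eta),\varphi\rangle=\int_{\mathbb{R}^n}T(\eta)(x)\varphi(x)\,dx$. This is independent of the choice of $\eta$. The condition $T(1)\in L^\infty$ means that there exists $b\in L^\infty(\mathbb{R}^n)$ such that $\langle T(1),\varphi\rangle=\int_{\mathbb{R}^n}b(x)\varphi(x)\,dx$ for all $\varphi\in\mathscr{D}_0(\mathbb{R}^n)$. *)

(* Defs.v *)
From HB Require Import structures.
From mathcomp Require Import all_boot all_order all_algebra.
From mathcomp Require Import all_classical all_reals all_analysis.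

Set Implicit Arguments.
Unset Strict Implicit.
Unset Printing Implicit Defensive.

Import Order.TTheory GRing.Theory Num.Theory.
Import numFieldNormedType.Exports.

Local Open Scope classical_set_scope.
Local Open Scope ring_scope.

(* R^n is 'rV[R]_n. Its sigma-algebra is the one generated by the coordinate
   maps (as for n.-tuple R in the library), i.e. the Borel sigma-algebra. *)

Fact rV_display : measure_display.
Proof. exact: default_measure_display. Qed.

Section measurable_rV.
Variables (R : realType) (n : nat).

Definition rV_coord (i : 'I_n) (x : 'rV[R]_n) : R := x ord0 i.

Let rV_set0 : g_sigma_preimage rV_coord set0.
Proof. exact: sigma_algebra0. Qed.

Let rV_setC A : g_sigma_preimage rV_coord A -> g_sigma_preimage rV_coord (~` A).
Proof. exact: sigma_algebraC. Qed.

Let rV_bigcup (F : (set 'rV[R]_n)^nat) :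
  (forall i, g_sigma_preimage rV_coord (F i)) ->
  g_sigma_preimage rV_coord (\bigcup_i (F i)).
Proof. exact: sigma_algebra_bigcup. Qed.

HB.instance Definition _ := @isMeasurable.Build rV_display 'rV[R]_n
  (g_sigma_preimage rV_coord) rV_set0 rV_setC rV_bigcup.

End measurable_rV.

Section lebesgue_rV.
Variable R : realType.

Lemma measurable_rV_coord n (i : 'I_n) :
  measurable_fun [set: 'rV[R]_n] (@rV_coord R n i).
Proof.
move=> _ Y mY; rewrite setTI; apply: sub_sigma_algebra => /=.
rewrite -bigcup_seq/=; exists i => /=; first by rewrite mem_index_enum.
by exists Y => //; rewrite setTI.
Qed.

Lemma measurable_fun_rV d (T : measurableType d) n (f : T -> 'rV[R]_n) :
  (forall i, measurable_fun [set: T] (fun t => f t ord0 i)) ->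
  measurable_fun [set: T] f.
Proof.
move=> mf; have sub : g_sigma_preimage (fun i => @rV_coord R n i \o f) `<=`
    (measurable : set (set T)).
  apply: smallest_sub; first exact: sigma_algebra_measurable.
  move=> A; rewrite -bigcup_seq/= => -[i _ [B mB <-]].
  exact: mf.
move=> _ A mA; apply: sub; rewrite g_sigma_preimage_comp; exists A => //.
Qed.

Definition rV_cons n (p : R * 'rV[R]_n) : 'rV[R]_n.+1 :=
  row_mx (p.1)%:M p.2 : 'rV[R]_(1 + n).

Lemma rV_cons0 n (p : R * 'rV[R]_n) : rV_cons p ord0 ord0 = p.1.
Proof.
rewrite (_ : rV_cons p ord0 ord0 = row_mx (p.1)%:M p.2 ord0 (lshift n ord0)).
  by rewrite row_mxEl mxE.
by congr (fun_of_matrix _ _ _); exact/val_inj.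
Qed.

Lemma rV_consS n (p : R * 'rV[R]_n) (j : 'I_n) :
  rV_cons p ord0 (lift ord0 j) = p.2 ord0 j.
Proof.
rewrite -(row_mxEr (p.1)%:M p.2).
by congr (fun_of_matrix _ _ _); exact/val_inj.
Qed.

Lemma measurable_rV_cons n : measurable_fun setT (@rV_cons n).
Proof.
apply: measurable_fun_rV => i.
have [j ->|->] := unliftP ord0 i.
  under eq_fun do rewrite rV_consS.
  exact: measurableT_comp (measurable_rV_coord j) measurable_snd.
under eq_fun do rewrite rV_cons0.
exact: measurable_fst.
Qed.

Definition rV_uncons n (x : 'rV[R]_n.+1) : R * 'rV[R]_n :=
  (x ord0 ord0, \row_j x ord0 (lift ord0 j)).

Lemma rV_consK n : cancel (@rV_cons n) (@rV_uncons n).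
Proof.
move=> [a v]; rewrite /rV_uncons rV_cons0; congr pair.
by apply/rowP => j; rewrite mxE rV_consS.
Qed.

Lemma measurable_rV_uncons n : measurable_fun setT (@rV_uncons n).
Proof.
apply: measurable_fun_pair; first exact: (measurable_rV_coord ord0).
apply: measurable_fun_rV => j; under eq_fun do rewrite mxE.
exact: (measurable_rV_coord (lift ord0 j)).
Qed.

Section step.
Variables (n : nat) (m : {sigma_finite_measure set 'rV[R]_n -> \bar R}).

Definition lebesgue_rV_step : set 'rV[R]_n.+1 -> \bar R :=
  pushforward (@lebesgue_measure R \x m)%E (@rV_cons n).

Let step_measure : {measure set 'rV[R]_n.+1 -> \bar R} :=
  measure_function_pushforward__canonical__measure_function_Measure
   (@lebesgue_measure R \x m)%E (@measurable_rV_cons n).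

HB.instance Definition _ := Measure.copy lebesgue_rV_step step_measure.

Let step_sigma_finite : sigma_finite setT lebesgue_rV_step.
Proof.
have /sigma_finiteP[F [TF ndF Foo]] := sigma_finiteT (@lebesgue_measure R).
have /sigma_finiteP[G [TG ndG Goo]] := sigma_finiteT m.
exists (fun k => @rV_uncons n @^-1` (F k `*` G k)).
  rewrite -preimage_bigcup (_ : \bigcup_k _ = setT) ?preimage_setT//.
  rewrite -subTset => -[x y] _.
  have [i _ Fx] : (\bigcup_i F i) x by rewrite -TF.
  have [j _ Gy] : (\bigcup_i G i) y by rewrite -TG.
  exists (maxn i j) => //; split => /=.
    by move: x Fx; exact/subsetPset/ndF/leq_maxl.
  by move: y Gy; exact/subsetPset/ndG/leq_maxr.
move=> k; have [mF Fk] := Foo k; have [mG Gk] := Goo k; split.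
  rewrite -[X in measurable X]setTI; apply: measurable_rV_uncons => //.
  exact: measurableX.
rewrite /lebesgue_rV_step /pushforward -comp_preimage.
rewrite (_ : _ \o _ = id); last by apply/funext => p /=; rewrite rV_consK.
by rewrite /= product_measure1E// lte_mul_pinfty// ge0_fin_numE.
Qed.

HB.instance Definition _ := Measure_isSigmaFinite.Build _ _ _
  lebesgue_rV_step step_sigma_finite.

End step.

(* Lebesgue measure on R^n, as the n-fold product of the one on R; see
   lebesgue_rV_box for its value on boxes. *)
Fixpoint lebesgue_rV n : {sigma_finite_measure set 'rV[R]_n -> \bar R} :=
  if n is n'.+1 then lebesgue_rV_step (lebesgue_rV n') else \d_(0 : 'rV[R]_0).

Lemma lebesgue_rV_box n (A : 'I_n -> set R) : (forall i, measurable (A i)) ->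
  lebesgue_rV n [set x | forall i, A i (x ord0 i)] =
  (\prod_(i < n) @lebesgue_measure R (A i))%E.
Proof.
elim: n A => [|n IHn] A mA.
  rewrite big_ord0 /= diracE mem_set//=; by case.
rewrite big_ord_recl -IHn //= /lebesgue_rV_step /pushforward.
have mB : measurable [set v : 'rV[R]_n | forall i, A (lift ord0 i) (v ord0 i)].
  rewrite [X in measurable X](_ : _ = \big[setI/setT]_(i < n)
      (@rV_coord R n i @^-1` A (lift ord0 i))).
    apply: bigsetI_measurable => i _; rewrite -[X in measurable X]setTI.
    exact: measurable_rV_coord.
  rewrite -bigcap_seq; apply/seteqP; split => x /= Ax i; last first.
    by apply: (Ax i); rewrite /= mem_index_enum.
  by move=> _; exact: Ax.
rewrite -product_measure1E//=; last exact: mA.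
congr product_measure1; apply/seteqP; split => -[a v] /=.
  move=> Av; split=> [|i]; first by have := Av ord0; rewrite rV_cons0.
  by have := Av (lift ord0 i); rewrite rV_consS.
move=> [Aa Av] i; have [j ->|->] := unliftP ord0 i.
  by rewrite rV_consS.
by rewrite rV_cons0.
Qed.

End lebesgue_rV.

Section euclidean_calculus.
Variables (R : realType) (n : nat).
Implicit Types (f g : 'rV[R]_n -> R) (x y : 'rV[R]_n).

(* The library norm `|x| on 'rV[R]_n is the sup norm. *)
Definition enorm x : R := Num.sqrt (\sum_(i < n) x ord0 i ^+ 2).

Definition partial (i : 'I_n) f x : R := 'D_(delta_mx ord0 i) f x.

Definition gradient f x : 'rV[R]_n := \row_(i < n) partial i f x.

Fixpoint is_Ck (k : nat) f : Prop :=
  continuous f /\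
  if k is k'.+1 then
    forall i : 'I_n,
      (forall x, derivable f x (delta_mx ord0 i)) /\ is_Ck k' (partial i f)
  else True.

Definition is_smooth f : Prop := forall k, is_Ck k f.

Definition supp f : set 'rV[R]_n := closure [set x | f x != 0].

Definition compactly_supported f : Prop := compact (supp f).

End euclidean_calculus.

Section calderon_zygmund.
Variables (R : realType) (n : nat).
Local Notation Rn := 'rV[R]_n.
Local Notation mu := (lebesgue_rV R n).
Implicit Types (T : (Rn -> R) -> (Rn -> R)) (K : Rn -> Rn -> R).
Implicit Types (f g phi eta : Rn -> R) (w : R -> R).

Definition riesz_potential1 g (x : Rn) : \bar R :=
  (\int[mu]_y (g y / enorm (x - y) ^+ n.-1)%:E)%E.

Definition modulus_of_continuity w : Prop :=
  [/\ w 0 = 0,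
      forall s t, 0 <= s -> s <= t -> w s <= w t &
      forall s t, 0 <= s -> 0 <= t -> w (s + t) <= w s + w t].

Definition dini w : Prop :=
  (\int[@lebesgue_measure R]_(t in `]0%R, 1%R]) (w t / t)%:E < +oo)%E.

Definition kernel_smoothness K w : Prop :=
  forall x x' y, x != y -> enorm (x - x') <= enorm (x - y) / 2 ->
  `|K x y - K x' y| <=
    w (enorm (x - x') / enorm (x - y)) * (enorm (x - y) ^+ n)^-1.

(* An operator on L^1 is a map on functions, applied to integrable ones only.
   Elements of L^1 and L^{1,oo} are classes modulo almost everywhere equality,
   hence the identity below only holds almost everywhere. *)
Definition linear_on_L1 T : Prop :=
  forall (a b : R) f g, f \in Lfun mu 1 -> g \in Lfun mu 1 ->
  {ae mu, forall x, T (fun z => a * f z + b * g z) x = a * T f x + b * T g x}.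

Definition weak_type11 T : Prop :=
  exists A : R, forall f, f \in Lfun mu 1 ->
    measurable_fun setT (T f) /\
    forall l : R, 0 < l ->
      (l%:E * mu [set x | (l < `|T f x|)%R] <= A%:E * 'N[mu]_1%E[EFin \o f])%E.

(* Integrability of y |-> K x y * f y is part of the representation: it is what
   gives the integral a meaning, and it carries the measurability of K x. *)
Definition represented_by T K : Prop :=
  forall f, f \in Lfun mu 1 -> compactly_supported f ->
  forall x, ~ supp f x ->
    mu.-integrable setT (fun y => (K x y * f y)%:E) /\
    T f x = \int[mu]_y (K x y * f y).

Definition CZ_operator T K : Prop :=
  [/\ linear_on_L1 T, weak_type11 T, represented_by T K &
      exists w, [/\ modulus_of_continuity w, dini w & kernel_smoothness K w]].

Definition D0 phi : Prop :=
  [/\ is_smooth phi, compactly_supported phi & \int[mu]_x phi x = 0].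

Definition cutoff phi eta : Prop :=
  [/\ is_smooth eta, compactly_supported eta &
      set_nbhs (supp phi) [set x | eta x = 1]].

(* The value of <T(1), phi> computed with the cutoff eta. *)
Definition T1_pairing T K eta phi : R :=
  \int[mu]_x (T eta x * phi x) +
  \int[mu]_y ((\int[mu]_x (K x y * phi x)) * (1 - eta y)).

(* The pairing does not depend on the choice of the cutoff, so that choosing
   one for each phi or quantifying over all of them is the same. *)
Definition T1_in_Linfty T K : Prop :=
  exists2 b : Rn -> R, b \in Lfun mu +oo%E &
    forall phi, D0 phi -> forall eta, cutoff phi eta ->
      T1_pairing T K eta phi = \int[mu]_x (b x * phi x).

Definition riesz_domination T : Prop :=
  exists2 C : R, 0 < C &
    forall f, is_Ck 1 f -> compactly_supported f ->
      {ae mu, forall x, (`|T f x|%:E <=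
        C%:E * riesz_potential1 (fun y => enorm (gradient f y)) x)%E}.

End calderon_zygmund.

(* Main.v *)
(** For a cutoff eta equal to 1 on a large cube, the Dini condition makes T eta
    oscillate by a bounded amount on smaller cubes.

    (ii) => (i).  Subtracting multiplication by b reduces to T(1) = 0.  Then, by
    the du Bois-Reymond lemma, T eta is constant on a cube Q up to a bounded
    function when eta = 1 on a dilate of Q; a John-Stromberg argument, which only
    uses the weak type, makes T eta integrable on Q, so that the pairing can be
    tested.  Together with the weak type this yields |T 1_(LQ)| <= C on Q, where
    LQ is a fixed dilate of Q.  For dyadic cubes Q containing x let
    g_Q = (f - c_Q) 1_(LQ), with c_Q a value of f close to its mean on LQ.
    Passing from Q to its dyadic child changes T g_Q by at most a constant times
    l(Q)^(1-n) times the integral of |grad f| on LQ (Poincare), and the sum of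
    these quantities over all scales is comparable to I_1 |grad f| (x).  At small
    scales T g_Q tends to 0 in measure, and at large scales T f - T g_Q tends to 0.

    (i) => (ii).  For the dilated cutoffs eta_k, I_1 |grad eta_k| is bounded on
    the ball of radius 2^k, hence so is T eta_k.  Up to constants, which D_0 does
    not see and which turn out to be bounded, the functions T eta_k converge
    almost everywhere, and their bounded limit represents T(1). *)

Require Import Defs.
From mathcomp Require Import all_boot all_order all_algebra.
From mathcomp Require Import all_classical all_reals all_analysis.
From mathcomp Require Import measurable_realfun ess_sup_inf.
From mathcomp Require Import ring lra zify.

Set Implicit Arguments.
Unset Strict Implicit.
Unset Printing Implicit Defensive.

Import Order.TTheory GRing.Theory Num.Theory.
Import numFieldNormedType.Exports.

Local Open Scope classical_set_scope.
Local Open Scope ring_scope.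

(** * Balls, boxes and grid cells *)

(** The obstacle is that T is known only through the weak type and almost everywhere identities. A
    function of weak type need not be locally integrable, and the real integral of a non-integrable
    function is 0 by convention, so the pairing says nothing about [T eta] until integrability is
    proved. Size bounds and measurability of K off the diagonal have to be derived too: the weak
    type bounds T f at one point of a cube, the smoothness of K carries the bound to the whole cube,
    and a choice of signs in f turns it into a bound for the integral of |K x y f y|. The null sets
    are attached to dyadic cells, of which there are countably many, so for almost every x the whole
    chain of cubes shrinking to x can be followed. The constant c_Q is a value of f because the
    proof of Poincare by slices produces a point. The assumption n >= 2 makes l(Q)^(1-n) at least
    double from a cube to its child, so that at a given y the sum over scales is governed by the
    smallest dilated cube containing y, which yields the Riesz kernel. *)

Section norm_rV.
Variables (R : realType) (n : nat).
Implicit Types (x y a : 'rV[R]_n).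

Lemma coord_le_norm x i : `|x ord0 i| <= `|x|.
Proof.
rewrite [leRHS]/Num.norm /= mx_normrE; apply/bigmax_geP; right => /=.
by exists (ord0, i).
Qed.

Lemma norm_rV_le x r : 0 <= r -> (`|x| <= r) <-> (forall i, `|x ord0 i| <= r).
Proof.
move=> r0; split=> [xr i|xr]; first exact: le_trans (coord_le_norm _ _) xr.
rewrite [leLHS]/Num.norm /= mx_normrE; apply/bigmax_leP; split => // -[i j] _ /=.
by rewrite ord1.
Qed.

Lemma norm_rV_lt x r : 0 < r -> (`|x| < r) <-> (forall i, `|x ord0 i| < r).
Proof.
move=> r0; split=> [xr i|xr]; first exact: le_lt_trans (coord_le_norm _ _) xr.
rewrite [ltLHS]/Num.norm /= mx_normrE; apply/bigmax_ltP; split => // -[i j] _ /=.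
by rewrite ord1.
Qed.

Lemma ball_rVE a r : ball a r = [set y | `|a - y| < r].
Proof. by rewrite -ball_normE. Qed.

Lemma ball_box a r : 0 < r ->
  ball a r = [set y | forall i, y ord0 i \in `]a ord0 i - r, a ord0 i + r[].
Proof.
move=> r0; rewrite ball_rVE; apply/seteqP; split => y /=.
  move/norm_rV_lt => /(_ r0) + i => /(_ i); rewrite !mxE in_itv/= ltr_norml.
  by move=> /andP[? ?]; apply/andP; split; lra.
move=> h; apply/norm_rV_lt => // i; have := h i; rewrite !mxE in_itv/= ltr_norml.
by move=> /andP[? ?]; apply/andP; split; lra.
Qed.

Lemma le_norm_enorm x : `|x| <= enorm x.
Proof.
apply/norm_rV_le => [|i]; first exact: sqrtr_ge0.
rewrite -sqrtr_sqr ler_wsqrtr// (bigD1 i)//= lerDl sumr_ge0// => j _.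
exact: sqr_ge0.
Qed.

Lemma enorm_le_norm x : enorm x <= n%:R * `|x|.
Proof.
have [n0|n0] := posnP n.
  rewrite /enorm big1 ?sqrtr0 ?mulr_ge0//; case=> i i0; exfalso; move: i0.
  by rewrite n0.
rewrite -[leRHS]ger0_norm ?mulr_ge0// -sqrtr_sqr ler_wsqrtr//.
apply: (@le_trans _ _ (\sum_(i < n) `|x| ^+ 2)).
  apply: ler_sum => i _; rewrite -real_normK ?num_real// ler_pXn2r ?nnegrE//.
  exact: coord_le_norm.
rewrite sumr_const card_ord exprMn -[leLHS]mulr_natl ler_wpM2r ?sqr_ge0//.
by rewrite expr2 ler_peMl// ler1n.
Qed.

Lemma enorm_ge0 x : 0 <= enorm x.
Proof. exact: sqrtr_ge0. Qed.

End norm_rV.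

Section boxes.
Variables (R : realType) (n : nat).
Local Notation Rn := 'rV[R]_n.
Local Notation mu := (lebesgue_rV R n).
Implicit Types (x y a : Rn) (r s : R).

Lemma measurable_box (A : 'I_n -> set R) : (forall i, measurable (A i)) ->
  measurable [set x : Rn | forall i, A i (x ord0 i)].
Proof.
move=> mA; rewrite [X in measurable X](_ : _ =
    \big[setI/setT]_(i < n) (@rV_coord R n i @^-1` A i)).
  apply: bigsetI_measurable => i _; rewrite -[X in measurable X]setTI.
  exact: measurable_rV_coord.
rewrite -bigcap_seq; apply/seteqP; split => x /= Ax i; last first.
  by apply: (Ax i); rewrite /= mem_index_enum.
by move=> _; exact: Ax.
Qed.

Lemma measurable_ball_rV a r : measurable (ball a r).
Proof.
have [r0|r0] := ltP 0 r; last first.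
  rewrite ball_rVE (_ : [set _ | _] = set0)// -subset0 => y /=.
  by rewrite ltNge (le_trans r0).
rewrite ball_box//.
exact: (@measurable_box (fun i => `]a ord0 i - r, a ord0 i + r[%classic)).
Qed.

Lemma lebesgue_ball a r : 0 < r -> mu (ball a r) = ((2 * r) ^+ n)%:E.
Proof.
move=> r0; rewrite ball_box//.
rewrite (@lebesgue_rV_box _ _ (fun i => `]a ord0 i - r, a ord0 i + r[%classic))//.
under eq_bigr => i _.
  rewrite lebesgue_measure_itv/= lte_fin ifT; last by lra.
  rewrite (_ : (_ + _)%E = (2 * r)%:E); last by rewrite -EFinB; congr EFin; ring.
  over.
by rewrite prodEFin prodr_const card_ord.
Qed.

Lemma hyperplane_null i c : mu [set x | x ord0 i = c] = 0%E.
Proof.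
pose A j := if j == i then [set c] else setT.
rewrite (_ : [set x | _] = [set x | forall j, A j (x ord0 j)]).
  rewrite lebesgue_rV_box; last by move=> j; rewrite /A; case: ifP.
  by rewrite (bigD1 i)//= /A eqxx lebesgue_measure_set1 mul0e.
apply/seteqP; split => x /=; first by move=> xi j; rewrite /A; case: eqP => // ->.
by move/(_ i); rewrite /A eqxx.
Qed.

Lemma measurable_hyperplane (i : 'I_n) c : measurable [set x : Rn | x ord0 i = c].
Proof.
rewrite (_ : [set x | _] = @rV_coord R n i @^-1` [set c])//.
rewrite -[X in measurable X]setTI.
exact: measurable_rV_coord (measurable_set1 c).
Qed.

Lemma point_null x : (0 < n)%N -> mu.-negligible [set x].
Proof.
move=> n0; pose i := Ordinal n0.
exists [set y : Rn | y ord0 i = x ord0 i].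
by split=> [||y ->//]; [exact: measurable_hyperplane|exact: hyperplane_null].
Qed.

(** Half-open cells as fibres of a floor map: they partition R^n exactly, the cell of x is computed,
    and the integer indices make the cells countable. *)
Definition cell_index (s : R) (x : Rn) : 'rV[int]_n := \row_i Num.floor (x ord0 i / s).
Definition cell s (m : 'rV[int]_n) : set Rn := cell_index s @^-1` [set m].
Definition corner s (m : 'rV[int]_n) : Rn := \row_i (s * (m ord0 i)%:~R).

Lemma cell_box s m : 0 < s -> cell s m = [set x | forall i,
   `[(s * (m ord0 i)%:~R), (s * (m ord0 i)%:~R + s)[%classic (x ord0 i)].
Proof.
move=> s0; apply/seteqP; split => x /=.
  rewrite /cell/= => <- i; rewrite mxE in_itv/=.
  have /andP[h1 h2] := floor_itv (x ord0 i / s).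
  by move: h1 h2; rewrite ler_pdivlMr// ltr_pdivrMr// intrD => h1 h2; apply/andP; split; lra.
move=> h; apply/rowP => i; rewrite mxE; apply: floor_def.
have := h i; rewrite /= in_itv/= => /andP[h1 h2].
by rewrite ler_pdivlMr// mulrC h1/= ltr_pdivrMr// mulrC intrD mulrDr mulr1.
Qed.

Lemma measurable_cell s m : 0 < s -> measurable (cell s m).
Proof.
move=> s0; rewrite cell_box//.
exact: (@measurable_box (fun i => `[(s * (m ord0 i)%:~R), (s * (m ord0 i)%:~R + s)[%classic)).
Qed.

Lemma lebesgue_cell s m : 0 < s -> mu (cell s m) = (s ^+ n)%:E.
Proof.
move=> s0; rewrite cell_box//.
rewrite (@lebesgue_rV_box _ _ (fun i => `[(s * (m ord0 i)%:~R), (s * (m ord0 i)%:~R + s)[%classic))//.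
under eq_bigr => i _.
  rewrite lebesgue_measure_itv/= lte_fin ifT; last by lra.
  rewrite (_ : (_ + _)%E = s%:E); last by rewrite -EFinB; congr EFin; ring.
  over.
by rewrite prodEFin prodr_const card_ord.
Qed.

Lemma cell_sub_ball s m : 0 < s -> cell s m `<=` ball (corner s m) s.
Proof.
move=> s0 x; rewrite cell_box// ball_box//= => h i; have := h i.
by rewrite !mxE/= !in_itv/= => /andP[? ?]; apply/andP; split; lra.
Qed.

Lemma dist_corner s x : 0 < s -> `|corner s (cell_index s x) - x| < s.
Proof. by move=> s0; have := @cell_sub_ball s _ s0 x erefl; rewrite ball_rVE. Qed.

(** [g] is arbitrary, since every preimage is a countable union of cells. *)
Lemma measurable_cell_index_comp d (T : measurableType d) s (g : 'rV[int]_n -> T) :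
  0 < s -> measurable_fun setT (g \o cell_index s).
Proof.
move=> s0 _ A mA; rewrite setTI.
rewrite (_ : _ @^-1` A = \bigcup_m (if `[< A (g m) >] then cell s m else set0)).
  apply: countable_bigcupT_measurable => // m; case: ifP => // _.
  exact: measurable_cell.
apply/seteqP; split => [x /= Agx|x [m _]].
  by exists (cell_index s x) => //; rewrite ifT//; exact/asboolP.
by case: ifPn => // /asboolP Agm; rewrite /cell/= => ->.
Qed.

End boxes.

(** * Countable decomposition into cells *)

Section cells_integral.
Variables (R : realType) (n : nat).
Local Notation Rn := 'rV[R]_n.
Local Notation mu := (lebesgue_rV R n).

(** Cells enumerated by the codes of their indices; a number that codes no index gives the empty
    set, which keeps the sequence disjoint. *)
Let F (s : R) (k : nat) : set Rn :=
  if pickle_inv k is Some m then cell s m else set0.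

Let mF s k : 0 < s -> measurable (F s k).
Proof. by move=> s0; rewrite /F; case: pickle_inv => // m; exact: measurable_cell. Qed.

Let tF s : trivIset setT (F s).
Proof.
apply/trivIsetP => i j _ _ ij; rewrite -subset0 /F => x [].
have := pickle_invK (T := 'rV[int]_n) i; have := pickle_invK (T := 'rV[int]_n) j.
case: pickle_inv => //= mj mjE; case: pickle_inv => //= mi miE; rewrite /cell/=.
move=> -> mij; by move: ij; rewrite -miE -mjE mij eqxx.
Qed.

Let FT s : \bigcup_k F s k = setT.
Proof.
rewrite -subTset => x _; exists (pickle (cell_index s x)) => //.
by rewrite /F pickleK_inv.
Qed.

Lemma integral_cells_le (s : R) (f g : Rn -> \bar R) : 0 < s ->
  measurable_fun setT f -> (forall x, 0 <= f x)%E ->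
  measurable_fun setT g -> (forall x, 0 <= g x)%E ->
  (forall m, \int[mu]_(x in cell s m) f x <= \int[mu]_(x in cell s m) g x)%E ->
  (\int[mu]_x f x <= \int[mu]_x g x)%E.
Proof.
move=> s0 mf f0 mg g0 fg; rewrite -(FT s).
rewrite !ge0_integral_bigcup//; [|by move=> k; exact: mF|by rewrite FT|by move=> k; exact: mF|by rewrite FT].
apply: lee_nneseries => k; first by move=> _ _; exact: integral_ge0.
by move=> _; rewrite /F; case: pickle_inv => [m|]; rewrite ?fg// !integral_set0.
Qed.

(** The null sets are collected so that a single point satisfies the estimates for all cells and
    scales at once. *)
Lemma ae_countable (I : countType) d (T : measurableType d)
  (nu : {measure set T -> \bar R}) (P : I -> T -> Prop) :
  (forall i, {ae nu, forall x, P i x}) -> {ae nu, forall x, forall i, P i x}.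
Proof.
move=> aP.
have : {ae nu, forall x, forall k : nat, if pickle_inv k is Some i then P i x else True}.
  apply: ae_foralln => k; case: pickle_inv => // *; exact: aeW.
apply: filterS => x h i; have := h (pickle i); by rewrite pickleK_inv.
Qed.

End cells_integral.

(** * Measurability in one and in two variables *)

Section measurability.
Variables (R : realType) (n : nat).
Local Notation Rn := 'rV[R]_n.
Local Notation mu := (lebesgue_rV R n).
Implicit Types (x y a : Rn) (r s : R).

Lemma cvg_half (e : R) : 0 < e -> exists N, forall k, (N <= k)%N -> 2^-1 ^+ k < e.
Proof.
move=> e0; have : `|2^-1 : R| < 1 by rewrite ger0_norm ?invf_lt1// ltr1n.
move/(@cvg_expr R)/(@cvgr0_norm_lt _ _ _ _ _ _)/(_ _ e0) => [N _ h].
exists N => k Nk; have := h k Nk; by rewrite ger0_norm// exprn_ge0.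
Qed.

Definition half_pow (k : nat) : R := 2^-1 ^+ k.

Lemma half_pow_gt0 k : 0 < half_pow k.
Proof. by rewrite exprn_gt0. Qed.

Lemma corner_cvg x : corner (half_pow k) (cell_index (half_pow k) x) @[k --> \oo] --> x.
Proof.
apply/cvgrPdist_lt => e e0; have [N h] := cvg_half e0.
exists N => // k /h; apply: lt_trans; rewrite distrC.
exact: (dist_corner x (half_pow_gt0 k)).
Qed.

(** The sigma-algebra is generated by the coordinates rather than by the open sets, so [f] is
    exhibited as the limit of [f] frozen at the corners of ever finer cells. *)
Lemma continuous_measurable_rV (f : Rn -> R) : continuous f -> measurable_fun setT f.
Proof.
move=> cf; apply: (@measurable_fun_cvg _ _ _ _
    (fun k => (f \o corner (half_pow k)) \o cell_index (half_pow k))).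
  by move=> k; apply: measurable_cell_index_comp; exact: half_pow_gt0.
by move=> x _; apply: continuous_cvg; [exact: cf|exact: corner_cvg].
Qed.

Lemma measurable_norm_rV : measurable_fun setT (fun x : Rn => `|x|).
Proof. apply: continuous_measurable_rV; exact: norm_continuous. Qed.

Lemma measurable_rV_sub d (T : measurableType d) (f g : T -> Rn) :
  measurable_fun setT f -> measurable_fun setT g ->
  measurable_fun setT (fun t => f t - g t).
Proof.
move=> mf mg; apply: measurable_fun_rV => i; under eq_fun do rewrite !mxE.
apply: measurable_funB.
  exact: measurableT_comp (measurable_rV_coord i) mf.
exact: measurableT_comp (measurable_rV_coord i) mg.
Qed.

Lemma measurable_dist d (T : measurableType d) (f g : T -> Rn) :
  measurable_fun setT f -> measurable_fun setT g ->
  measurable_fun setT (fun t => `|f t - g t|).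
Proof.
move=> mf mg.
exact: measurableT_comp measurable_norm_rV (measurable_rV_sub mf mg).
Qed.

Lemma measurable_cell_index_comp2 d (T : measurableType d) s
    (G : 'rV[int]_n -> Rn -> T) : 0 < s ->
  (forall m, measurable_fun setT (G m)) ->
  measurable_fun [set: Rn * Rn] (fun p => G (cell_index s p.1) p.2).
Proof.
move=> s0 mG _ A mA; rewrite setTI.
rewrite (_ : _ @^-1` A = \bigcup_m (cell s m `*` (G m @^-1` A))).
  apply: countable_bigcupT_measurable => // m; apply: measurableX.
    exact: measurable_cell.
  by rewrite -[X in measurable X]setTI; exact: mG.
apply/seteqP; split => [[x y] /= Axy|[x y] [m _ [/= <-]]]//.
by exists (cell_index s x).
Qed.

(* K is the limit of the kernels obtained by moving x to the corner of its grid
   cell, which are piecewise constant in x. *)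
Lemma offdiag_measurable (K : Rn -> Rn -> R) (rho : R) : 0 < rho ->
  (forall x r, 0 < r -> measurable_fun setT (fun y => if r < `|x - y| then K x y else 0)) ->
  (forall x y, x != y -> {for x, continuous (K^~ y)}) ->
  measurable_fun [set: Rn * Rn] (fun p => if rho < `|p.1 - p.2| then K p.1 p.2 else 0).
Proof.
move=> rho0 mK cK.
have mrho : measurable_fun [set: Rn * Rn] (fun p => rho < `|p.1 - p.2|).
  apply: measurable_fun_ltr => //.
  by apply: measurable_dist; [exact: measurable_fst|exact: measurable_snd].
pose c k x : Rn := corner (half_pow k) (cell_index (half_pow k) x).
(* The inner truncation at [rho / 2] makes the sections measurable by hypothesis. It is inactive for
   large k, when the corner is within [rho / 2] of x. *)
pose h k (p : Rn * Rn) := if rho < `|p.1 - p.2| then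
  (if rho / 2 < `|c k p.1 - p.2| then K (c k p.1) p.2 else 0) else 0.
apply: (@measurable_fun_cvg _ _ _ _ h).
  move=> k; apply: measurable_fun_ifT => //.
  apply: (@measurable_cell_index_comp2 _ _ (half_pow k) (fun m y =>
     if rho / 2 < `|corner (half_pow k) m - y| then K (corner (half_pow k) m) y else 0)).
    exact: half_pow_gt0.
  by move=> m; apply: mK; lra.
move=> [x y] _ /=; rewrite /h/=; case: ifPn => [rxy|_]; last exact: cvg_cst.
have xy : x != y.
  by apply: contraTneq rxy => ->; rewrite subrr normr0 -leNgt ltW.
have cc : c k x @[k --> \oo] --> x by exact: corner_cvg.
have kc : K (c k x) y @[k --> \oo] --> K x y.
  by apply: (@cvg_comp _ _ _ (c^~ x) (K^~ y) _ _ _ cc); exact: cK.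
apply: cvg_trans kc; apply: near_eq_cvg.
have /cvgrPdist_lt /(_ (rho / 2)) := cc; rewrite divr_gt0// => /(_ isT).
apply: filterS => k kx; rewrite ifT//.
have := ler_distD (c k x) x y; lra.
Qed.

End measurability.

(** * Generation of the measurable sets by half-spaces and boxes *)

Section sigma_algebra_rV.
Variables (R : realType) (n : nat).
Local Notation Rn := 'rV[R]_n.
Local Notation mu := (lebesgue_rV R n).

Lemma rV_sigma_algebra_ind (C : set (set Rn)) : sigma_algebra setT C ->
  (forall i c, C [set x : Rn | c < x ord0 i]) -> forall A, measurable A -> C A.
Proof.
move=> [C0 CC CU] Cr; apply: smallest_sub; first by split.
move=> A; rewrite -bigcup_seq/= => -[i _ [B mB <-]]; rewrite setTI.
suff : (measurable : set (set (measurableTypeR R))) `<=` [set B | C (@rV_coord R n i @^-1` B)].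
  by apply.
rewrite RGenOInfty.measurableE; apply: smallest_sub.
  split => /=.
  - by rewrite preimage_set0.
  - by move=> D CD; rewrite setTD preimage_setC -setTD; exact: CC.
  - by move=> F CF; rewrite preimage_bigcup; exact: CU.
move=> D [c ->] /=.
rewrite (_ : @rV_coord R n i @^-1` _ = [set x | c < x ord0 i]); first exact: Cr.
by apply/seteqP; split => x /=; rewrite in_itv/= andbT.
Qed.

Definition open_box (a b : Rn) : set Rn :=
  [set x | forall i, a ord0 i < x ord0 i < b ord0 i].

Lemma measurable_open_box a b : measurable (open_box a b).
Proof.
have := @measurable_box R n (fun i => `]a ord0 i, b ord0 i[%classic).
rewrite (_ : [set x | _] = open_box a b); first by apply.
by apply/seteqP; split => x /= h i; have := h i; rewrite /= in_itv.
Qed.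

Lemma open_box_setI : setI_closed [set A | exists a b, A = open_box a b].
Proof.
move=> _ _ [a [b ->]] [c [d ->]].
exists (\row_i Num.max (a ord0 i) (c ord0 i)), (\row_i Num.min (b ord0 i) (d ord0 i)).
apply/seteqP; split => x /=.
  by move=> [h1 h2] i; rewrite !mxE gt_max lt_min; have /andP[-> ->] := h1 i; have /andP[-> ->] := h2 i.
move=> h; split=> i; have := h i; rewrite !mxE gt_max lt_min => /andP[/andP[h1 h2] /andP[h3 h4]].
  by rewrite h1.
by rewrite h2.
Qed.

(** Boxes are the generating pi-system for [ae_eq0_of_boxes]: they are stable under intersection,
    and smooth bumps converge to their indicators. *)
Lemma measurable_rV_open_box :
  (measurable : set (set Rn)) = <<s [set A | exists a b, A = open_box a b] >>.
Proof.
apply/seteqP; split; last first.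
  apply: smallest_sub; first exact: sigma_algebra_measurable.
  by move=> _ [a [b ->]]; exact: measurable_open_box.
apply: rV_sigma_algebra_ind; first exact: smallest_sigma_algebra.
move=> i c.
rewrite (_ : [set x | _] = \bigcup_k open_box
   (\row_j (if j == i then c else - k%:R)) (\row_j k%:R)).
  have [_ _ U] := smallest_sigma_algebra [set: Rn] [set A | exists a b, A = open_box a b].
  apply: U => k; apply: sub_sigma_algebra; by do 2 eexists.
apply/seteqP; split => x /=.
  move=> cx; exists (Num.truncn `|x|).+1 => //= j; rewrite !mxE.
  have xk : `|x ord0 j| < (Num.truncn `|x|).+1%:R.
    by apply: le_lt_trans (coord_le_norm x j) _; rewrite truncnS_gt.
  move: xk; rewrite ltr_norml => /andP[h1 ->]; rewrite andbT.
  by case: eqP => [->|//].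
by move=> [k _] /(_ i); rewrite !mxE eqxx => /andP[].
Qed.

End sigma_algebra_rV.

(** * Approximation of measurable sets by dyadic cells *)

Section density.
Variables (R : realType) (n : nat).
Local Notation Rn := 'rV[R]_n.
Local Notation mu := (lebesgue_rV R n).
Implicit Types s : R.

(** [%/] rounds down for negative indices too, in agreement with the floor. *)
Definition parent_cell (m : 'rV[int]_n) : 'rV[int]_n := \row_i (m ord0 i %/ 2)%Z.

Lemma cell_index_half s (x : Rn) : 0 < s ->
  cell_index s x = parent_cell (cell_index (s / 2) x).
Proof.
move=> s0; apply/rowP => i; rewrite !mxE; apply: floor_def.
set t := x ord0 i / s; have -> : x ord0 i / (s / 2) = 2 * t.
  by rewrite /t invf_div mulrCA mulrA.
set q := Num.floor (2 * t).
have /andP[h1 h2] := floor_itv (2 * t).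
have e := divz_eq q 2; have r0 := modz_ge0 q (isT : 2 != 0 :> int).
have r1 := ltz_pmod q (isT : 0 < 2 :> int).
have E : q%:~R = (q %/ 2)%Z%:~R * 2 + (q %% 2)%Z%:~R :> R.
  by rewrite {1}e intrD intrM.
have R0 : 0 <= (q %% 2)%Z%:~R :> R by rewrite ler0z.
have R1 : (q %% 2)%Z%:~R <= 1 :> R.
  by rewrite -(mulr1z 1) ler_int -ltzD1.
move: h1 h2; rewrite -/q !intrD E => h1 h2; apply/andP; split; lra.
Qed.

Definition dyadic (s : R) (k : nat) : R := s / 2 ^+ k.

Lemma dyadic_gt0 s k : 0 < s -> 0 < dyadic s k.
Proof. by move=> s0; rewrite divr_gt0// exprn_gt0. Qed.

Lemma dyadicS s k : dyadic s k.+1 = dyadic s k / 2.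
Proof. by rewrite /dyadic exprS invfM mulrA mulrAC. Qed.

Lemma cell_index_iter s k j (x : Rn) : 0 < s ->
  cell_index (dyadic s k) x = iter j parent_cell (cell_index (dyadic s (k + j)) x).
Proof.
move=> s0; elim: j => [|j IH]; first by rewrite addn0.
rewrite addnS iterSr dyadicS -cell_index_half//; exact: dyadic_gt0.
Qed.

Lemma measure_cells_le s (A B : set Rn) : 0 < s -> measurable A -> measurable B ->
  (forall m, mu (A `&` cell s m) <= mu (B `&` cell s m))%E -> (mu A <= mu B)%E.
Proof.
move=> s0 mA mB AB.
have := @integral_cells_le R n s (fun x => (\1_A x)%:E) (fun x => (\1_B x)%:E) s0.
rewrite !integral_indic// !setIT; apply => //.
- by apply/measurable_EFinP; exact: measurable_indic.
- by apply/measurable_EFinP; exact: measurable_indic.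
by move=> m; have mc := measurable_cell m s0; rewrite !integral_indic//; exact: AB.
Qed.

Lemma le_mu d (T : measurableType d) (nu : {measure set T -> \bar R}) (A B : set T) :
  measurable A -> measurable B -> A `<=` B -> (nu A <= nu B)%E.
Proof. by move=> mA mB AB; apply: le_measure; rewrite ?inE. Qed.

Lemma measurable_cell_union s (J : set 'rV[int]_n) : 0 < s ->
  measurable (cell_index s @^-1` J : set Rn).
Proof.
move=> s0; have := @measurable_cell_index_comp R n _ bool s (fun m => `[< J m >]) s0.
move=> /(_ measurableT [set true]); rewrite setTI.
rewrite (_ : _ @^-1` [set true] = cell_index s @^-1` J); first exact.
by apply/seteqP; split => x /= => [/asboolP|Jx]//; exact/asboolP.
Qed.

Section approx.
Variables (s : R) (s0 : 0 < s) (P : set Rn) (mP : measurable P) (Pfin : (mu P < +oo)%E).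

Let D k J : set Rn := cell_index (dyadic s k) @^-1` J.
Let mD k J : measurable (D k J).
Proof. by apply: measurable_cell_union; exact: dyadic_gt0. Qed.

Let symd (A B : set Rn) := (A `\` B) `|` (B `\` A).

(** Approximation is asked at all fine scales, not at one, so that two sets can be approximated at a
    common scale in a union. The window [P] of finite measure gives the continuity from above behind
    countable unions. *)
Let good (A : set Rn) := measurable A /\ forall e : R, 0 < e ->
  exists k0, forall k, (k0 <= k)%N -> exists J, (mu (P `&` symd A (D k J)) <= e%:E)%E.

Let msymd A B : measurable A -> measurable B -> measurable (P `&` symd A B).
Proof. by move=> mA mB; apply: measurableI => //; apply: measurableU; exact: measurableD. Qed.

Let goodU A B : good A -> good B -> good (A `|` B).
Proof.
move=> [mA gA] [mB gB]; split; first exact: measurableU.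
move=> e e0; have e20 : 0 < e / 2 by lra.
have [k1 h1] := gA _ e20; have [k2 h2] := gB _ e20.
exists (maxn k1 k2) => k; rewrite geq_max => /andP[/h1[J1 hJ1] /h2[J2 hJ2]].
exists (J1 `|` J2).
apply: (@le_trans _ _ (mu ((P `&` symd A (D k J1)) `|` (P `&` symd B (D k J2))))).
  apply: le_mu; [by apply: msymd; [exact: measurableU|exact: mD]|by apply: measurableU; exact: msymd|].
  move=> x [Px [[[Ax|Bx] nD]|[[Dx|Dx] nAB]]].
  - by left; split => //; left; split => // Dx; apply: nD; left.
  - by right; split => //; left; split => // Dx; apply: nD; right.
  - by left; split => //; right; split => // Ax; apply: nAB; left.
  - by right; split => //; right; split => // Ax; apply: nAB; right.
apply: le_trans; first by apply: measureU2; exact: msymd.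
by rewrite [leRHS](_ : _ = (e / 2)%:E + (e / 2)%:E)%E ?leeD// -EFinD -splitr.
Qed.

Let good0 : good set0.
Proof.
split => // e e0; exists 0%N => k _; exists set0.
by rewrite /symd /D preimage_set0 set0D setU0 setI0 measure0 lee_fin ltW.
Qed.

Let goodC A : good A -> good (setT `\` A).
Proof.
move=> [mA gA]; split; first exact: measurableD.
move=> e /gA[k0 h]; exists k0 => k /h[J hJ]; exists (~` J).
rewrite (_ : symd _ _ = symd A (D k J))//.
rewrite /D preimage_setC /symd -/(D k J); apply/seteqP; split => x /=.
  move=> [[[_ nA] nnD]|[nD nnA]]; [right|left]; split=> //.
    exact: contrapT.
  by apply: contrapT => nA; apply: nnA.
move=> [[Ax nD]|[Dx nA]]; [right|left]; split => //.
by case.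
Qed.

Let good_lim (E : (set Rn)^nat) (e : R) : 0 < e ->
  (forall k, measurable (E k)) -> (forall k, E k `<=` P) -> \bigcap_k E k = set0 ->
  (forall k j, (k <= j)%N -> E j `<=` E k) ->
  exists N, forall k, (N <= k)%N -> (mu (E k) <= e%:E)%E.
Proof.
move=> e0 mE EP Ecap Ed.
have : mu \o E @ \oo --> mu (\bigcap_N E N).
  apply: nonincreasing_cvg_mu => //.
  - by apply: le_lt_trans Pfin; apply: le_mu.
  - by rewrite Ecap.
  - by move=> k j kj; apply/subsetPset; exact: Ed.
rewrite Ecap measure0 => /fine_cvgP[_ /cvgrPdist_le/(_ _ e0)[N _ hN]].
exists N => k /hN; rewrite /= sub0r normrN ger0_norm ?fine_ge0// => hk.
rewrite -(@fineK _ (mu (E k))) ?lee_fin//.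
by rewrite ge0_fin_numE//; apply: le_lt_trans Pfin; apply: le_mu.
Qed.

Let goodUn (F : (set Rn)^nat) : (forall i, good (F i)) -> good (\bigcup_i F i).
Proof.
move=> gF; have mF i : measurable (F i) by case: (gF i).
have mU : measurable (\bigcup_i F i) by exact: bigcupT_measurable.
split=> // e e0; have e20 : 0 < e / 2 by lra.
pose B N := \big[setU/set0]_(i < N) F i.
have mB N : measurable (B N) by apply: bigsetU_measurable.
have gB N : good (B N).
  by rewrite /B; elim/big_ind : _ => //; exact: goodU.
pose E N := P `&` (\bigcup_i F i `\` B N).
have mE N : measurable (E N) by apply: measurableI => //; exact: measurableD.
have [||||N /(_ N (leqnn N)) EN] := @good_lim E _ e20 => //.
- by move=> k x [].
- rewrite -subset0 => x Ex; have [_ [[i _ Fi] _]] := Ex 0%N Logic.I.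
  have [_ [_]] := Ex i.+1 Logic.I; apply; rewrite /B big_ord_recr/=; by right.
- move=> N M NM x [Px [Ux nB]]; split => //; split => // BN.
  apply: nB; move: BN; rewrite /B -!bigcup_mkord => -[j /= jN Fj].
  by exists j => //=; exact: leq_trans NM.
have [_ /(_ _ e20)[k0 hk]] := gB N; exists k0 => k /hk[J hJ]; exists J.
apply: (@le_trans _ _ (mu (E N `|` (P `&` symd (B N) (D k J))))).
  apply: le_mu; [by apply: msymd => //; exact: mD|by apply: measurableU => //; exact: msymd|].
  move=> x [Px [[Ux nD]|[Dx nU]]].
    have [BN|nB] := pselect (B N x); last by left; split.
    by right; split => //; left.
  right; split => //; right; split => // BN; apply: nU.
  by move: BN; rewrite /B -bigcup_mkord => -[j _ Fj]; exists j.
apply: le_trans; first by apply: measureU2 => //; exact: msymd.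
by rewrite [leRHS](_ : _ = (e / 2)%:E + (e / 2)%:E)%E ?leeD// -EFinD -splitr.
Qed.

(** The cells whose corner lies in the half-space are contained in it, and what they miss lies in a
    slab as wide as a cell, whose trace on [P] decreases to the empty set. *)
Let good_half i c : good [set x : Rn | c < x ord0 i].
Proof.
have mH r : measurable [set x : Rn | r < x ord0 i].
  rewrite -[X in measurable X]setTI; apply: measurable_fun_ltr => //.
  exact: measurable_rV_coord.
split => // e e0.
pose E k := P `&` [set x : Rn | c < x ord0 i <= c + dyadic s k].
have mE k : measurable (E k).
  apply: measurableI => //.
  rewrite (_ : [set x | _] = [set x : Rn | c < x ord0 i] `\` [set x : Rn | c + dyadic s k < x ord0 i]).
    exact: measurableD.
  apply/seteqP; split => x /=; first by move=> /andP[-> h]; split => //; apply/negP; rewrite -leNgt.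
  by move=> [-> /negP]; rewrite -leNgt.
have levd k j : (k <= j)%N -> dyadic s j <= dyadic s k.
  move=> kj; rewrite ler_pM2l// lef_pV2 ?posrE ?exprn_gt0// ler_weXn2l// ler1n//.
have [||||N hN] := @good_lim E _ e0 => //.
- by move=> k x [].
- rewrite -subset0 => x Ex; have [_ /= /andP[cx _]] := Ex 0%N Logic.I.
  have d0 : 0 < (x ord0 i - c) / s by rewrite divr_gt0 ?subr_gt0.
  have [N /(_ N (leqnn N))] := cvg_half d0.
  rewrite ltr_pdivlMr// exprVn mulrC => h.
  have [_ /= /andP[_]] := Ex N Logic.I; rewrite /dyadic; lra.
- move=> N M NM x [Px /= /andP[h1 h2]]; split => //=.
  by rewrite h1 (le_trans h2)// lerD2l; exact: levd.
exists N => k /hN hk.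
exists [set m | c < corner (dyadic s k) m ord0 i :> R].
apply: le_trans hk.
apply: le_mu => //; first by apply: msymd => //; exact: mD.
move=> x [Px h]; split => //=.
have := @dist_corner _ _ (dyadic s k) x (dyadic_gt0 k s0).
set q := corner _ _ => qx.
have : x ord0 i - q ord0 i < dyadic s k.
  have := le_lt_trans (coord_le_norm (q - x) i) qx; rewrite !mxE ltr_norml => /andP[? ?].
  by lra.
have qle : q ord0 i <= x ord0 i.
  have := @cell_box R n (dyadic s k) (cell_index (dyadic s k) x) (dyadic_gt0 k s0).
  move=> /seteqP[/(_ x erefl)/(_ i) + _]; rewrite /= in_itv/= => /andP[+ _].
  by rewrite [q ord0 i]mxE.
case: h => [[/= cx /negP]|[/= cq /negP]]; rewrite -leNgt => h1 h2.
  by rewrite cx/=; lra.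
move: cq; rewrite /D/= -/q; lra.
Qed.

Lemma cells_approx (A : set Rn) (e : R) : measurable A -> 0 < e ->
  exists k J, (mu (P `&` ((A `\` cell_index (dyadic s k) @^-1` J) `|`
    (cell_index (dyadic s k) @^-1` J `\` A))) <= e%:E)%E.
Proof.
move=> mA e0; have [|_ /(_ e e0)[k0 /(_ k0 (leqnn _))[J hJ]]] := @rV_sigma_algebra_ind R n good _ good_half A mA.
  by split; [exact: good0|exact: goodC|exact: goodUn].
by exists k0, J.
Qed.

End approx.

Lemma dyadic0 s : dyadic s 0 = s.
Proof. by rewrite /dyadic expr0 divr1. Qed.

Lemma cells_nested s k m0 m (x y : Rn) : 0 < s -> cell s m0 x -> cell (dyadic s k) m x ->
  cell (dyadic s k) m y -> cell s m0 y.
Proof.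
rewrite /cell/= => s0 xm0 xm ym; rewrite -xm0 -[in LHS](dyadic0 s) -[in RHS](dyadic0 s).
by rewrite !(@cell_index_iter s 0 k)// !add0n xm ym.
Qed.

(* All but a small part of E lies in grid cells that E fills up to more than a half. *)
Lemma cells_density s (m0 : 'rV[int]_n) (E : set Rn) (e : R) : 0 < s -> measurable E ->
  E `<=` cell s m0 -> 0 < e ->
  exists k, (mu (E `&` [set z | 2%:E * mu (E `&` cell (dyadic s k) (cell_index (dyadic s k) z))
     <= (dyadic s k ^+ n)%:E]) <= e%:E)%E.
Proof.
move=> s0 mE EP e0.
have mP : measurable (cell s m0 : set Rn) by exact: measurable_cell.
have Pfin : (mu (cell s m0) < +oo)%E by rewrite lebesgue_cell// ltry.
have [k [J hJ]] := cells_approx s0 mP Pfin mE e0.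
exists k; apply: le_trans hJ.
set t := dyadic s k; have t0 : 0 < t by exact: dyadic_gt0.
pose J0 := [set m | 2%:E * mu (E `&` cell t m) <= (t ^+ n)%:E]%E.
have -> : [set z | 2%:E * mu (E `&` cell t (cell_index t z)) <= (t ^+ n)%:E]%E =
  cell_index t @^-1` J0 by [].
set D := _ @^-1` J.
have mD : measurable (D : set Rn) by exact: measurable_cell_union.
have mJ0 : measurable (cell_index t @^-1` J0 : set Rn) by exact: measurable_cell_union.
have mR : measurable (cell s m0 `&` ((E `\` D) `|` (D `\` E))).
  by apply: measurableI => //; apply: measurableU; exact: measurableD.
apply: (@measure_cells_le t) => //; first exact: measurableI.
move=> m; have mc : measurable (cell t m : set Rn) by exact: measurable_cell.
have [Jm|nJm] := pselect (J0 m); last first.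
  rewrite (_ : _ `&` _ = set0) ?measure0// -subset0 => x [[_ /=] + xm].
  by rewrite xm.
have [E0|/set0P[x [Ex xm]]] := eqVneq (E `&` cell t m) set0.
  by rewrite setIAC E0 set0I measure0.
have cP : cell t m `<=` cell s m0.
  by move=> y; apply: (cells_nested s0 (EP _ Ex)) xm.
apply: (@le_trans _ _ (mu (E `&` cell t m))).
  apply: le_mu; [|exact: measurableI|by move=> y [[]]].
  by apply: measurableI => //; exact: measurableI.
(* The approximation error dominates either way. If J omits the sparse cell, all of E inside it is
   error; if J keeps it, the error is the cell minus E, at least as large as E there. *)
have [JJ|nJ] := pselect (J m); last first.
  apply: le_mu; [exact: measurableI|exact: measurableI|].
  move=> y [Ey ym]; split => //; split; first exact: cP.
  by left; split => //; rewrite /D/= ym.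
apply: (@le_trans _ _ (mu (cell t m `\` E))); last first.
  apply: le_mu; [exact: measurableD|exact: measurableI|].
  move=> y [ym nE]; split => //; split; first exact: cP.
  by right; split => //; rewrite /D/= ym.
have := Jm; rewrite /J0/= -(@lebesgue_cell R n t m t0) (measureDI _ mc mE).
have fm A : measurable A -> A `<=` cell t m -> mu A \is a fin_num.
  move=> mA Am; rewrite ge0_fin_numE//; apply: (@le_lt_trans _ _ (mu (cell t m))).
    exact: le_mu.
  by rewrite lebesgue_cell// ltry.
rewrite [E `&` _]setIC; set c := mu (cell t m `&` E); set d := mu (cell t m `\` E).
change (2%:E * c <= d + c -> c <= d)%E.
have /fineK <- : c \is a fin_num by apply: fm => //; exact: measurableI.
have /fineK <- : d \is a fin_num by apply: fm => //; exact: measurableD.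
by rewrite -EFinM -EFinD !lee_fin; lra.
Qed.

End density.

(** * Smooth cutoffs *)

Section smooth1.
Variable R : realType.
Implicit Types u v : R -> R.

(** The derivative is an existential witness, so each closure property is an induction that names
    the derivative. *)
Fixpoint smooth1 (k : nat) u : Prop :=
  if k is k'.+1 then
    exists2 u' : R -> R, (forall x : R, is_derive x (1 : R) u (u' x)) & smooth1 k' u'
  else continuous u.

Lemma is_derive_congr (u : R -> R) (x d d' : R) :
  is_derive x (1 : R) u d -> d = d' -> is_derive x (1 : R) u d'.
Proof. by move=> h <-. Qed.

Lemma is_derive_continuous u u' : (forall x, is_derive x (1 : R) u (u' x)) -> continuous u.
Proof.
move=> h x; apply: differentiable_continuous; apply/derivable1_diffP.
exact: (@ex_derive _ _ _ _ _ _ _ (h x)).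
Qed.

Lemma smooth1_continuous k u : smooth1 k u -> continuous u.
Proof. by case: k => [//|k] [u' /is_derive_continuous]. Qed.

Lemma smooth1W k u : smooth1 k.+1 u -> smooth1 k u.
Proof.
elim: k u => [u|k IH u [u' hu hu']]; first exact: smooth1_continuous.
by exists u' => //; exact: IH.
Qed.

Lemma smooth1_cst k (c : R) : smooth1 k (cst c).
Proof.
elim: k c => [c|k IH c]; first exact: cst_continuous.
exists (cst 0); last exact: IH.
by move=> x; exact: is_derive_cst.
Qed.

Lemma smooth1D k u v : smooth1 k u -> smooth1 k v -> smooth1 k (fun x => u x + v x).
Proof.
elim: k u v => [u v cu cv x|k IH u v [u' hu hu'] [v' hv hv']].
  by apply: cvgD; [exact: cu|exact: cv].
exists (fun x => u' x + v' x); last exact: IH.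
by move=> x; apply: is_deriveD.
Qed.

Lemma smooth1M k u v : smooth1 k u -> smooth1 k v -> smooth1 k (fun x => u x * v x).
Proof.
elim: k u v => [u v cu cv x|k IH u v [u' hu hu'] [v' hv hv']].
  by apply: cvgM; [exact: cu|exact: cv].
exists (fun x => u x * v' x + v x * u' x).
  by move=> x; exact: is_deriveM.
apply: smooth1D; apply: IH => //; apply: smooth1W.
  by exists u'.
by exists v'.
Qed.

Lemma smooth1_affine k u (c d : R) : smooth1 k u -> smooth1 k (fun x => u (c * x + d)).
Proof.
elim: k u => [u cu x|k IH u [u' hu hu']].
  apply: (@cvg_comp _ _ _ (fun x => c * x + d) u); last exact: cu.
  by apply: cvgD; [apply: cvgM; [exact: cvg_cst|exact: cvg_id]|exact: cvg_cst].
exists (fun x => c * u' (c * x + d)).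
  move=> x; rewrite mulrC; apply: (@is_derive1_comp _ u (fun x => c * x + d)).
  apply: is_derive_eq; rewrite /= ?addr0.
  by rewrite [_%:A]mulr1.
apply: smooth1M; [exact: smooth1_cst|exact: IH].
Qed.

Lemma smooth1V k u : (forall x, u x != 0) -> smooth1 k u -> smooth1 k (fun x => (u x)^-1).
Proof.
move=> u0; elim: k => [cu x|k IH [u' hu hu']].
  by apply: cvgV => //; exact: cu.
have hv : smooth1 k (fun x => (u x)^-1) by apply: IH; apply: smooth1W; exists u'.
exists (fun x => (-1) * (((u x)^-1 * (u x)^-1) * u' x)).
  move=> x; have := hu x => hux.
  apply: (is_derive_congr (@is_deriveV R u x (u' x) 1 (u0 x) hux)).
  by rewrite /GRing.scale /= mulN1r mulNr -exprVn expr2.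
apply: smooth1M; first exact: smooth1_cst.
by apply: smooth1M => //; exact: smooth1M.
Qed.

(** The functions t^-m exp(-1/t) extended by 0. Derivatives are linear combinations of members of
    the family, so smoothness at 0 is an induction over all m at once. *)
Definition flat m (t : R) : R := if 0 < t then t^-1 ^+ m * expR (- t^-1) else 0.

Lemma flat_pos m t : 0 < t -> flat m t = t^-1 ^+ m * expR (- t^-1).
Proof. by rewrite /flat => ->. Qed.

Lemma flat_npos m t : t <= 0 -> flat m t = 0.
Proof. by rewrite /flat ltNge => ->. Qed.

Lemma flat_ge0 m t : 0 <= flat m t.
Proof.
rewrite /flat; case: ifP => // t0.
by rewrite mulr_ge0 ?expR_ge0// exprn_ge0// invr_ge0 ltW.
Qed.

Lemma exp_bound (x : R) m : 0 <= x -> x ^+ m * expR (- x) <= m`!%:R.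
Proof.
move=> x0; rewrite expRN ler_pdivrMr ?expR_gt0//.
case: m => [|m]; first by rewrite expr0 fact0 mul1r; apply: le_trans (expR_ge1Dx x); rewrite lerDl.
have := expR_ge1Dxn m x0 => h.
have f0 : 0 < m.+1`!%:R :> R by rewrite ltr0n fact_gt0.
rewrite -ler_pdivrMl//; apply: le_trans h.
by rewrite mulrC lerDr.
Qed.

(** This is x^(m+2) exp(-x) <= (m+2)! at x = 1/t; the two powers to spare give derivative 0 at the
    origin. *)
Lemma flat_quadratic m t : `|flat m t| <= m.+2`!%:R * t ^+ 2.
Proof.
rewrite ger0_norm ?flat_ge0//; have [t0|t0] := ltP 0 t; last first.
  by rewrite flat_npos// mulr_ge0// sqr_ge0.
rewrite flat_pos//.
have h := @exp_bound t^-1 m.+2 (ltW (etrans (invr_gt0 t) t0)).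
have -> : t^-1 ^+ m * expR (- t^-1) = (t^-1 ^+ m.+2 * expR (- t^-1)) * t ^+ 2.
  have tn0 : t != 0 by rewrite gt_eqF.
  rewrite -addn2 exprD; set w := _ ^+ m; set E := expR _; by field.
by rewrite ler_wpM2r// sqr_ge0.
Qed.

Lemma quadratic_is_derive u (C : R) : (forall t, `|u t| <= C * t ^+ 2) ->
  is_derive (0 : R) (1 : R) u 0.
Proof.
move=> hu; have u0 : u 0 = 0.
  by apply/eqP; rewrite -normr_le0 (le_trans (hu 0))// expr0n/= mulr0.
have C0 : 0 <= C by apply: le_trans (le_trans (normr_ge0 _) (hu 1)) _; rewrite expr1n mulr1.
have c : (fun h : R => h^-1 *: ((u \o shift 0) (h *: 1) - u 0)) @ 0^' --> (0 : R).
  apply/cvgr0Pnorm_lt => e e0.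
  near=> h; rewrite /= u0 subr0 addr0 [_ *: 1]mulr1 normrZ normfV.
  have h0 : h != 0 by near: h; exact: nbhs_dnbhs_neq.
  rewrite ltr_pdivrMl ?normr_gt0//; apply: le_lt_trans (hu h) _.
  rewrite -[h ^+ 2]real_normK ?num_real// expr2 mulrA mulrC ltr_pM2l ?normr_gt0//.
  have hd : `|h| < e / (C + 1).
    near: h; apply: dnbhs0_lt; rewrite divr_gt0//; lra.
  move: hd; rewrite ltr_pdivlMr; last by lra.
  have := normr_ge0 h; lra.
split; first by apply/cvg_ex; exists 0.
exact/cvg_lim.
Unshelve. all: by end_near. Qed.

Lemma flat_is_derive m (t : R) :
  is_derive t (1 : R) (flat m) (- m%:R * flat m.+1 t + flat m.+2 t).
Proof.
have [->|tn0] := eqVneq t 0.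
  rewrite !flat_npos// mulr0 addr0; apply: quadratic_is_derive; exact: flat_quadratic.
have [t0|t0] := ltP 0 t.
  apply: (@near_eq_is_derive R R R (fun t : R => t^-1 ^+ m * expR (- t^-1))).
    near=> x; rewrite flat_pos//; near: x; exact: lt_nbhsr.
  have dV : is_derive t 1 (fun t : R => t^-1) (- (t^-1 ^+ 2)).
    apply: (is_derive_congr (@is_deriveV R id t 1 1 tn0 (is_derive_id _ _))).
    by rewrite -exprVn [_%:A]mulr1.
  have dE : is_derive t 1 (fun t : R => expR (- t^-1)) (expR (- t^-1) * (- - (t^-1 ^+ 2))).
    by apply: (@is_derive1_comp _ expR (fun t => - t^-1)); exact: is_deriveN.
  have dX := @is_deriveX _ _ _ m _ _ _ dV.
  rewrite (_ : (fun _ => _) = ((fun t : R => t^-1) ^+ m * (fun t : R => expR (- t^-1)))); last first.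
    by apply/funext => y; rewrite /= !fctE.
  apply: (is_derive_congr (@is_deriveM _ _ _ _ _ _ _ _ dX dE)).
  rewrite !flat_pos// /GRing.scale/= opprK !fctE.
  case: m {dX} => [|m]; first by rewrite !expr0 mulr0n !mul0r mulr0 oppr0 mul0r add0r addr0 mul1r mulrC.
  rewrite /= !exprS !expr0; set E := expR _; set w := t^-1 ^+ m; set i := t^-1.
  by ring.
have {}t0 : t < 0 by rewrite lt_neqAle tn0.
apply: (@near_eq_is_derive R R R (cst 0)).
  near=> x; rewrite flat_npos//; apply/ltW; near: x; exact: lt_nbhsl.
rewrite !flat_npos ?(ltW t0)// mulr0 addr0; exact: is_derive_cst.
Unshelve. all: by end_near. Qed.

Lemma smooth1_flat k m : smooth1 k (flat m).
Proof.
elim: k m => [|k IH] m; first by apply: is_derive_continuous => x; exact: flat_is_derive.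
exists (fun t => (- m%:R) * flat m.+1 t + flat m.+2 t).
  exact: flat_is_derive.
by apply: smooth1D => //; apply: smooth1M => //; exact: smooth1_cst.
Qed.

(** The usual smooth transition, 1 up to t = 1 and 0 from t = 2; the two terms of the denominator
    never vanish together. *)
Definition step (t : R) : R := flat 0 (2 - t) * (flat 0 (2 - t) + flat 0 (t - 1))^-1.

Lemma flat_gt0 m t : 0 < t -> 0 < flat m t.
Proof. by move=> t0; rewrite flat_pos// mulr_gt0 ?expR_gt0// exprn_gt0// invr_gt0. Qed.

Let den_gt0 t : 0 < flat 0 (2 - t) + flat 0 (t - 1).
Proof.
have [t2|t2] := ltP t 2; first by apply: ltr_pwDl; rewrite ?flat_ge0// flat_gt0// subr_gt0.
by apply: ltr_wpDl; rewrite ?flat_ge0// flat_gt0//; lra.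
Qed.

Lemma smooth1_step k : smooth1 k step.
Proof.
have h1 : smooth1 k (fun t => flat 0 (2 - t)).
  have := smooth1_affine (-1) 2 (smooth1_flat k 0).
  by under eq_fun do rewrite mulN1r addrC.
have h2 : smooth1 k (fun t => flat 0 (t - 1)).
  have := smooth1_affine 1 (-1) (smooth1_flat k 0).
  by under eq_fun do rewrite mul1r.
apply: smooth1M => //; apply: smooth1V; last exact: smooth1D.
by move=> x; rewrite gt_eqF.
Qed.

Lemma step_ge0 t : 0 <= step t.
Proof. by rewrite mulr_ge0 ?flat_ge0// invr_ge0 ltW. Qed.

Lemma step_le1 t : step t <= 1.
Proof. by rewrite ler_pdivrMr// mul1r lerDl flat_ge0. Qed.

Lemma step1 t : t <= 1 -> step t = 1.
Proof.
move=> t1; rewrite /step [flat 0 (t - 1)]flat_npos; last by lra.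
by rewrite addr0 divff// gt_eqF// flat_gt0//; lra.
Qed.

Lemma step0 t : 2 <= t -> step t = 0.
Proof. by move=> t1; rewrite /step flat_npos ?mul0r//; lra. Qed.

Definition plateau (t : R) : R := step t * step (- t).

Lemma smooth1_plateau k : smooth1 k plateau.
Proof.
apply: smooth1M; first exact: smooth1_step.
have := smooth1_affine (-1) 0 (smooth1_step k).
by under eq_fun do rewrite mulN1r addr0.
Qed.

Lemma plateau_ge0 t : 0 <= plateau t.
Proof. by rewrite mulr_ge0// step_ge0. Qed.

Lemma plateau_le1 t : plateau t <= 1.
Proof. by rewrite mulr_ile1// ?step_ge0 ?step_le1. Qed.

Lemma plateau1 t : `|t| <= 1 -> plateau t = 1.
Proof. by rewrite ler_norml => /andP[h1 h2]; rewrite /plateau !step1 ?mulr1//; lra. Qed.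

Lemma plateau0 t : 2 <= `|t| -> plateau t = 0.
Proof.
rewrite ler_normr => /orP[h|h]; rewrite /plateau.
  by rewrite step0// mul0r.
by rewrite [step (- t)]step0// mulr0.
Qed.

End smooth1.

Section product_functions.
Variables (R : realType) (n : nat).
Local Notation Rn := 'rV[R]_n.

(** Written as a displacement along the basis vector, so that f and its one-variable slice have the
    same difference quotients ([slice_quotient]). *)
Definition set_coord (x : Rn) (i : 'I_n) (s : R) : Rn := x + (s - x ord0 i) *: delta_mx ord0 i.

Lemma set_coordE x i s j : set_coord x i s ord0 j = if j == i then s else x ord0 j.
Proof.
rewrite !mxE eqxx/=; case: eqP => [->|_]; last by rewrite mulr0 addr0.
by rewrite mulr1 addrC subrK.
Qed.

Lemma set_coord_id x i : set_coord x i (x ord0 i) = x.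
Proof. by rewrite /set_coord subrr scale0r addr0. Qed.

Lemma slice_quotient (f : Rn -> R) (x : Rn) (i : 'I_n) (s : R) :
  (fun h : R => h^-1 *: ((f \o shift (set_coord x i s)) (h *: delta_mx ord0 i) - f (set_coord x i s))) =
  (fun h : R => h^-1 *: (((fun s : R => f (set_coord x i s)) \o shift s) (h *: 1) - f (set_coord x i s))).
Proof.
apply/funext => h /=; congr (_ *: (f _ - f _)).
rewrite /set_coord [_%:A]mulr1 addrC -addrA -scalerDl; congr (_ + _ *: _); ring.
Qed.

Lemma slice_is_derive (f : Rn -> R) (x : Rn) (i : 'I_n) (s : R) :
  derivable f (set_coord x i s) (delta_mx ord0 i) ->
  is_derive s (1 : R) (fun s => f (set_coord x i s)) (partial i f (set_coord x i s)).
Proof.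
move=> df; split; first by rewrite /derivable -slice_quotient.
by rewrite /partial /derive -slice_quotient.
Qed.

Lemma derivable_slice (f : Rn -> R) (x : Rn) (i : 'I_n) (d : R) :
  is_derive (x ord0 i) (1 : R) (fun s => f (set_coord x i s)) d ->
  derivable f x (delta_mx ord0 i) /\ partial i f x = d.
Proof.
rewrite -{3 4}(set_coord_id x i) /derivable /partial /derive slice_quotient.
by move=> [].
Qed.

Definition prodf (u : 'I_n -> R -> R) (x : Rn) : R := \prod_i u i (x ord0 i).

Lemma continuous_prodf u : (forall i, continuous (u i)) -> continuous (prodf u).
Proof.
move=> cu x; rewrite /prodf.
elim: (index_enum _) => [|i r IH].
  rewrite (_ : (fun x0 => _) = cst 1); first exact: cst_continuous.
  by apply/funext => y; rewrite big_nil.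
under eq_fun do rewrite big_cons.
have h : {for x, continuous (u i \o (fun y : Rn => y ord0 i))}.
  by apply: continuous_comp; [exact: coord_continuous|exact: cu].
exact: (cvgM h IH).
Qed.

(** Differentiation in coordinate i replaces the i-th factor by its derivative; the result is again
    a product, so the induction on k closes. *)
Lemma is_Ck_prodf k u : (forall i, smooth1 k (u i)) -> is_Ck k (prodf u).
Proof.
elim: k u => [|k IH] u su; split=> //; try by apply: continuous_prodf => i; apply: smooth1_continuous (su i).
move=> i; have [u' hu' su'] := su i.
pose u2 j := if j == i then u' else u j.
have key x : derivable (prodf u) x (delta_mx ord0 i) /\ partial i (prodf u) x = prodf u2 x.
  apply: derivable_slice.
  pose c := \prod_(j | j != i) u j (x ord0 j).
  have -> : (fun s => prodf u (set_coord x i s)) = (fun s => u i s * c).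
    apply/funext => s; rewrite /prodf (bigD1 i)//= set_coordE eqxx; congr (_ * _).
    by apply: eq_bigr => j ji; rewrite set_coordE (negbTE ji).
  have -> : prodf u2 x = u' (x ord0 i) * c.
    rewrite /prodf (bigD1 i)//= /u2 eqxx; congr (_ * _).
    by apply: eq_bigr => j ji; rewrite (negbTE ji).
  have h := hu' (x ord0 i).
  apply: (is_derive_congr (@is_deriveM _ _ (u i) (cst c) _ _ _ _ h (is_derive_cst c _ _))).
  by rewrite scaler0 add0r mulrC.
split; first by move=> x; case: (key x).
have -> : partial i (prodf u) = prodf u2 by apply/funext => x; case: (key x).
apply: IH => j; rewrite /u2; case: eqP => // _; exact: smooth1W.
Qed.

Lemma is_smooth_prodf u : (forall k i, smooth1 k (u i)) -> is_smooth (prodf u).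
Proof. by move=> su k; exact: is_Ck_prodf. Qed.

End product_functions.

(** * The Poincare inequality *)

Lemma eps_continuous (R : realType) (U V : normedModType R) (g : U -> V) :
  (forall x e, 0 < e -> exists2 d : R, 0 < d & forall y, `|x - y| < d -> `|g x - g y| < e) ->
  continuous g.
Proof.
move=> h x A /nbhs_ballP[e /= e0 eA]; have [d d0 hd] := h x e e0.
apply/nbhs_ballP; exists d => //= y; rewrite -ball_normE/= => xy.
by apply: eA; rewrite -ball_normE/=; exact: hd.
Qed.

Lemma continuous_eps (R : realType) (U V : normedModType R) (g : U -> V) x e :
  {for x, continuous g} -> 0 < e ->
  exists2 d : R, 0 < d & forall y, `|x - y| < d -> `|g x - g y| < e.
Proof.
move=> cg e0; have /cg/nbhs_ballP[d /= d0 hd] : nbhs (g x) (ball (g x) e) by exact: nbhsx_ballx.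
exists d => // y xy; have := hd y; rewrite -!ball_normE/=; exact.
Qed.

Lemma rV_subE (R : realType) n (x y : 'rV[R]_n) i : (x - y) ord0 i = x ord0 i - y ord0 i.
Proof. by rewrite !mxE. Qed.

Section average.
Context d (T : measurableType d) (R : realType) (nu : {measure set T -> \bar R}).

(** No loss occurs: a function above its average throughout D would exceed it by a positive function
    of integral zero. *)
Lemma exists_le_average (D : set T) (h : T -> \bar R) (L : R) :
  measurable D -> nu D = L%:E -> 0 < L -> measurable_fun D h ->
  (forall t, D t -> 0 <= h t)%E ->
  exists2 t, D t & (L%:E * h t <= \int[nu]_(t in D) h t)%E.
Proof.
move=> mD DL L0 mh h0; apply: contrapT => /forall2NP H.
have hJ t : D t -> (\int[nu]_(t in D) h t < L%:E * h t)%E.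
  by move=> Dt; case: (H t) => // /negP; rewrite -ltNge.
set J := (\int[nu]_(t in D) h t)%E in hJ.
have J0 : (0 <= J)%E by exact: integral_ge0.
have [t0 Dt0] : D !=set0.
  by apply/set0P/eqP => D0; move: DL; rewrite D0 measure0 => -[L0']; rewrite -L0' ltxx in L0.
have Jfin : J \is a fin_num.
  rewrite ge0_fin_numE//; apply: lt_le_trans (hJ _ Dt0) _; exact: leey.
pose c := fine J / L.
have ch t : D t -> (c%:E < h t)%E.
  move=> Dt; have := hJ t Dt; rewrite -(fineK Jfin).
  case: (h t) (h0 t Dt) => [x|_ _|//]; last by rewrite ltry.
  by rewrite lee_fin -EFinM !lte_fin => _; rewrite /c ltr_pdivrMr// mulrC.
have c0 : 0 <= c by rewrite divr_ge0 ?fine_ge0// ltW.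
pose g t := (h t - c%:E)%E.
have g0 t : D t -> (0 <= g t)%E by move=> Dt; rewrite /g sube_ge0// ltW// ch.
have mg : measurable_fun D g by apply: emeasurable_funB.
have e : (J = \int[nu]_(t in D) g t + J)%E.
  rewrite {1}/J (_ : (\int[nu]_(t in D) h t = \int[nu]_(t in D) (g t + c%:E))%E); last first.
    by apply: eq_integral => t _; rewrite /g subeK.
  rewrite ge0_integralD//.
  by congr (_ + _)%E; rewrite integral_cst// DL -EFinM /c mulrVK ?unitf_gt0// fineK.
have ge : (\int[nu]_(t in D) g t = 0)%E.
  have gi0 : (0 <= \int[nu]_(t in D) g t)%E by exact: integral_ge0.
  move: e gi0; rewrite -(fineK Jfin); case: (\int[nu]_(t in D) g t)%E => [x [e] _|//|//].
  by congr EFin; lra.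
have [N [mN N0 DN]] : ae_eq nu D g (cst 0).
  apply/ae_eq_integral_abs => //; rewrite -ge; apply: eq_integral => t.
  by rewrite inE => Dt; rewrite gee0_abs// g0.
have : (nu D <= nu N)%E.
  apply: le_mu => // t Dt; apply: DN => /= /(_ Dt) gt.
  by have := ch t Dt; rewrite -sube_gt0 -/(g t) gt ltxx.
by rewrite N0 DL lee_fin leNgt L0.
Qed.

End average.

(** * Integration and differentiation along slices *)

Section tonelli_rV.
Variables (R : realType) (n : nat).
Local Notation leb := (@lebesgue_measure R).

Lemma ge0_integral_rVS (f : 'rV[R]_n.+1 -> \bar R) :
  measurable_fun setT f -> (forall x, 0 <= f x)%E ->
  (\int[lebesgue_rV R n.+1]_x f x =
   \int[leb]_t \int[lebesgue_rV R n]_v f (rV_cons (t, v)))%E.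
Proof.
move=> mf f0.
transitivity (\int[pushforward (leb \x lebesgue_rV R n) (@rV_cons R n)]_x f x)%E; first by [].
rewrite ge0_integral_pushforward//; last exact: measurable_rV_cons.
rewrite preimage_setT fubini_tonelli1//.
- by apply: measurableT_comp mf _; exact: measurable_rV_cons.
- by move=> x; exact: f0.
Qed.

Definition rV_tail (a : 'rV[R]_n.+1) : 'rV[R]_n := \row_j a ord0 (lift ord0 j).

Lemma ball_cons (a : 'rV[R]_n.+1) r t v : 0 < r ->
  ball a r (rV_cons (t, v)) <-> (ball (a ord0 ord0) r t /\ ball (rV_tail a) r v).
Proof.
move=> r0; rewrite !ball_rVE -ball_normE/=; split.
  move=> /norm_rV_lt => /(_ r0) h; split.
    by have := h ord0; rewrite rV_subE rV_cons0.
  by apply/norm_rV_lt => // j; have := h (lift ord0 j); rewrite !rV_subE rV_consS mxE.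
move=> [h0 hv]; have {hv} h := (norm_rV_lt _ r0).1 hv; apply/norm_rV_lt => // i; rewrite rV_subE.
have [j ->|->] := unliftP ord0 i; last by rewrite rV_cons0.
by have := h j; rewrite rV_subE mxE rV_consS.
Qed.

Lemma ge0_integral_ballS (a : 'rV[R]_n.+1) r (f : 'rV[R]_n.+1 -> \bar R) : 0 < r ->
  measurable_fun setT f -> (forall x, 0 <= f x)%E ->
  (\int[lebesgue_rV R n.+1]_(x in ball a r) f x =
   \int[leb]_(t in ball (a ord0 ord0) r) \int[lebesgue_rV R n]_(v in ball (rV_tail a) r) f (rV_cons (t, v)))%E.
Proof.
move=> r0 mf f0; rewrite integral_mkcond ge0_integral_rVS//; last 2 first.
- apply/(measurable_restrictT _ _).1; first exact: measurable_ball_rV.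
  exact: measurable_funTS.
- by move=> x; apply: erestrict_ge0.
rewrite [RHS]integral_mkcond; apply: eq_integral => t _; rewrite [RHS]patchE.
case: ifPn => [/set_mem ht|/negP ht].
  rewrite [RHS]integral_mkcond; apply: eq_integral => v _; rewrite !patchE.
  case: ifPn => [/set_mem/(ball_cons _ _ _ r0)[_ hv]|h]; first by rewrite mem_set.
  by case: ifPn => // /set_mem hv; case/negP: h; apply/mem_set/(ball_cons _ _ _ r0).
apply: integral0_eq => v _; rewrite patchE.
by case: ifPn => // /set_mem/(ball_cons _ _ _ r0)[h _]; case: ht; exact/mem_set.
Qed.

Lemma continuous_cons (t : R) : continuous (fun v : 'rV[R]_n => rV_cons (t, v)).
Proof.
apply: eps_continuous => v e e0; exists e => // w vw.
apply/norm_rV_lt => // i; rewrite rV_subE.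
have [j ->|->] := unliftP ord0 i; last by rewrite !rV_cons0 subrr normr0.
rewrite !rV_consS; move/norm_rV_lt : vw => /(_ e0 j); by rewrite rV_subE.
Qed.

Lemma set_coord_cons0 (t s : R) (u : 'rV[R]_n) : set_coord (rV_cons (t, u)) ord0 s = rV_cons (s, u).
Proof.
apply/rowP => i; rewrite set_coordE; have [j ->|->] := unliftP ord0 i.
  by rewrite !rV_consS.
by rewrite eqxx rV_cons0.
Qed.

Lemma set_coord_consS (t s : R) (u : 'rV[R]_n) j :
  set_coord (rV_cons (t, u)) (lift ord0 j) s = rV_cons (t, set_coord u j s).
Proof.
apply/rowP => i; rewrite set_coordE; have [k ->|->] := unliftP ord0 i.
  by rewrite !rV_consS set_coordE (inj_eq lift_inj).
by rewrite !rV_cons0.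
Qed.

Lemma is_C1_slice (f : 'rV[R]_n.+1 -> R) (t : R) : is_Ck 1 f ->
  is_Ck 1 (fun v => f (rV_cons (t, v))) /\
  forall i v, partial i (fun v => f (rV_cons (t, v))) v = partial (lift ord0 i) f (rV_cons (t, v)).
Proof.
move=> [cf hf].
have key i (v : 'rV[R]_n) : derivable (fun v => f (rV_cons (t, v))) v (delta_mx ord0 i) /\
    partial i (fun v => f (rV_cons (t, v))) v = partial (lift ord0 i) f (rV_cons (t, v)).
  apply: derivable_slice.
  have -> : (fun s => f (rV_cons (t, set_coord v i s))) = (fun s => f (set_coord (rV_cons (t, v)) (lift ord0 i) s)).
    by apply/funext => s; rewrite set_coord_consS.
  have [dfi _] := hf (lift ord0 i).
  have := @slice_is_derive _ _ f (rV_cons (t, v)) (lift ord0 i) (v ord0 i) (dfi _).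
  by rewrite set_coord_consS set_coord_id.
have cc (g : 'rV[R]_n.+1 -> R) : continuous g -> continuous (fun v => g (rV_cons (t, v))).
  move=> cg v; apply: (@continuous_comp _ _ _ (fun v => rV_cons (t, v)) g v) => //.
    exact: continuous_cons.
  exact: cg.
split; last by move=> i v; case: (key i v).
split; first exact: cc.
move=> i; split; first by move=> v; case: (key i v).
split => //; rewrite (_ : partial i _ = fun v => partial (lift ord0 i) f (rV_cons (t, v))).
  by apply: cc; case: (hf (lift ord0 i)) => _ [].
by apply/funext => v; case: (key i v).
Qed.

Lemma slice_increment (f : 'rV[R]_n.+1 -> R) (u : 'rV[R]_n) (c r s t : R) : is_Ck 1 f ->
  ball c r s -> ball c r t ->
  (`|f (rV_cons (s, u)) - f (rV_cons (t, u))|%:E <=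
   \int[leb]_(z in ball c r) `|partial ord0 f (rV_cons (z, u))|%:E)%E.
Proof.
move=> Cf; wlog st : s t / s <= t.
  move=> W hs ht; have [|/ltW] := leP s t; first by move=> ?; exact: W.
  by move=> ?; rewrite distrC; exact: W.
move=> hs ht; have [cf hf] := Cf; have [df [cdf _]] := hf ord0.
have cc (g : 'rV[R]_n.+1 -> R) : continuous g -> continuous (fun z : R => g (rV_cons (z, u))).
  move=> cg z; apply: (@continuous_comp _ _ _ (fun z : R => rV_cons (z, u)) g z); last exact: cg.
  move: z; apply: eps_continuous => z e e0; exists e => // w vw.
  apply/norm_rV_lt => // i; rewrite rV_subE.
  have [j ->|->] := unliftP ord0 i; last by rewrite !rV_cons0.
  by rewrite !rV_consS subrr normr0.
have cF := cc _ cf; have cdF := cc _ cdf.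
have mdF : measurable_fun setT (fun z : R => partial ord0 f (rV_cons (z, u))).
  exact: continuous_measurable_fun.
have [->|sNt] := eqVneq s t.
  by rewrite subrr normr0 integral_ge0.
have {sNt}st : s < t by rewrite lt_neqAle sNt.
have dF z : is_derive z (1 : R) (fun z => f (rV_cons (z, u))) (partial ord0 f (rV_cons (z, u))).
  have := @slice_is_derive _ _ f (rV_cons (s, u)) ord0 z (df _).
  rewrite set_coord_cons0 (_ : (fun s0 => _) = (fun z => f (rV_cons (z, u))))//.
  by apply/funext => z'; rewrite set_coord_cons0.
have FTC := @continuous_FTC2 R (fun z => partial ord0 f (rV_cons (z, u))) (fun z => f (rV_cons (z, u))) s t st.
rewrite distrC -abse_EFin EFinB -FTC; last 3 first.
- exact: continuous_subspaceT.
- split.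
  + by move=> z _; exact: ex_derive.
  + by apply: cvg_at_right_filter; exact: cF.
  + by apply: cvg_at_left_filter; exact: cF.
- by move=> z _; rewrite derive1E; exact: derive_val.
apply: le_trans.
  apply: le_abse_integral => //; apply/measurable_EFinP; exact: measurable_funTS.
apply: ge0_subset_integral => //.
- exact: measurable_ball.
- apply/measurable_EFinP; apply: measurable_funTS; exact: measurableT_comp.
- move=> z /=; rewrite in_itv/= => /andP[h1 h2].
  move: hs ht; rewrite -!ball_normE/= !ltr_norml => /andP[? ?] /andP[? ?].
  by apply/andP; split; lra.
Qed.

End tonelli_rV.

Section poincare.
Variable R : realType.

Lemma is_C1_measurable n (f : 'rV[R]_n -> R) : is_Ck 1 f ->
  measurable_fun setT f /\ forall i, measurable_fun setT (partial i f).
Proof.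
move=> [cf hf]; split; first exact: continuous_measurable_rV.
by move=> i; have [_ [c _]] := hf i; exact: continuous_measurable_rV.
Qed.

(* Induction on n: y lies in a slice over which the integrals of the derivatives along
   the slice are at most their averages. *)
Lemma poincare n (f : 'rV[R]_n -> R) (a : 'rV[R]_n) (r : R) : 0 < r -> is_Ck 1 f ->
  exists2 y, ball a r y &
  (\int[lebesgue_rV R n]_(x in ball a r) `|f x - f y|%:E <=
   (2 * r)%:E * \sum_(i < n) \int[lebesgue_rV R n]_(x in ball a r) `|partial i f x|%:E)%E.
Proof.
move=> r0; elim: n f a => [f a _|n IH f a Cf].
  exists a; first exact: ballxx.
  rewrite big_ord0 mule0 (_ : (\int[_]_(x in _) _ = 0)%E)//.
  apply: integral0_eq => x _.
  by rewrite (_ : x = a) ?subrr ?normr0//; apply/rowP; case.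
have [mf mdf] := is_C1_measurable Cf.
have mabs (g : 'rV[R]_n.+1 -> R) : measurable_fun setT g ->
   measurable_fun [set: R * 'rV[R]_n] (fun p => `|g (rV_cons p)|%:E).
  move=> mg; apply/measurable_EFinP; apply: measurableT_comp => //.
  by apply: measurableT_comp mg _; exact: measurable_rV_cons.
set I := ball (a ord0 ord0) r; set B := ball (rV_tail a) r.
have mI : measurable I by exact: measurable_ball.
have mB : measurable B by exact: measurable_ball_rV.
have leI : lebesgue_measure I = (2 * r)%:E by rewrite lebesgue_measure_ball ?ltW// mulr_natl.
have mslice (g : 'rV[R]_n.+1 -> R) : measurable_fun setT g ->
    measurable_fun setT (fun t : R => \int[lebesgue_rV R n]_(v in B) `|g (rV_cons (t, v))|%:E)%E.
  move=> mg; under eq_fun do rewrite integral_mkcond.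
  apply: (@measurable_fun_fubini_tonelli_F _ _ _ _ _ (lebesgue_rV R n)
     (fun p => ((fun v => `|g (rV_cons (p.1, v))|%:E) \_ B) p.2)).
    rewrite (_ : (fun p => _) = (fun p : R * 'rV[R]_n => `|g (rV_cons p)|%:E) \_ (setT `*` B)).
      apply/(measurable_restrictT _ _).1; first exact: measurableX.
      by apply: measurable_funTS; exact: mabs.
    apply/funext => -[t v]; rewrite !patchE/=.
    by rewrite in_setX/= in_setT/= ?andbT.
  by move=> [t v]; apply: erestrict_ge0 => x _; rewrite lee_fin.
pose h t := (\sum_(i < n) \int[lebesgue_rV R n]_(v in B) `|partial (lift ord0 i) f (rV_cons (t, v))|%:E)%E.
have mh : measurable_fun I h.
  by apply: measurable_funTS; apply: emeasurable_sum => i; exact: mslice.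
have h0 t : (0 <= h t)%E.
  by apply: sume_ge0 => i _; apply: integral_ge0 => v _; rewrite lee_fin.
have r20 : 0 < 2 * r by rewrite mulr_gt0.
have [t0 It0 ht0] := @exists_le_average _ _ R lebesgue_measure I h (2 * r) mI leI r20 mh (fun t _ => h0 t).
have [Cs ps] := is_C1_slice t0 Cf.
have [y By hy] := IH _ (rV_tail a) Cs.
exists (rV_cons (t0, y)); first exact/ball_cons.
pose D v := (\int[lebesgue_measure]_(z in I) `|partial ord0 f (rV_cons (z, v))|%:E)%E.
have D0 v : (0 <= D v)%E by apply: integral_ge0 => z _; rewrite lee_fin.
have mD : measurable_fun setT D.
  rewrite /D; under eq_fun do rewrite integral_mkcond.
  apply: (@measurable_fun_fubini_tonelli_G _ _ _ _ _ lebesgue_measure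
     (fun p => ((fun z => `|partial ord0 f (rV_cons (z, p.2))|%:E) \_ I) p.1)).
    rewrite (_ : (fun p => _) = (fun p : R * 'rV[R]_n => `|partial ord0 f (rV_cons p)|%:E) \_ (I `*` setT)).
      apply/(measurable_restrictT _ _).1; first exact: measurableX.
      by apply: measurable_funTS; exact: mabs.
    apply/funext => -[z v]; rewrite !patchE/=.
    by rewrite in_setX/= in_setT/= ?andbT.
  by move=> [z v]; apply: erestrict_ge0 => x _; rewrite lee_fin.
pose G v : \bar R := `|f (rV_cons (t0, v)) - f (rV_cons (t0, y))|%:E.
have mG : measurable_fun setT G.
  have [mf0 _] := is_C1_measurable Cs.
  by apply/measurable_EFinP; apply: measurableT_comp => //; exact: measurable_funB.
have mF : measurable_fun setT (fun x : 'rV[R]_n.+1 => `|f x - f (rV_cons (t0, y))|).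
  by apply: measurableT_comp => //; exact: measurable_funB.
have DE : (\int[lebesgue_rV R n]_(v in B) D v =
   \int[lebesgue_rV R n.+1]_(x in ball a r) `|partial ord0 f x|%:E)%E.
  rewrite ge0_integral_ballS//; last by apply/measurable_EFinP; apply: measurableT_comp.
  rewrite [LHS]integral_mkcond [RHS]integral_mkcond.
  pose H (p : R * 'rV[R]_n) := ((fun p => `|partial ord0 f (rV_cons p)|%:E) \_ (I `*` B)) p.
  have e1 : D \_ B = fun v => (\int[lebesgue_measure]_z H (z, v))%E.
    apply/funext => v; rewrite patchE; case: ifPn => [/set_mem Bv|/negP Bv].
      rewrite /D integral_mkcond; apply: eq_integral => z _; rewrite /H !patchE.
      by case: ifPn => [/set_mem Iz|/negP Iz];
        case: ifPn => //; [move=> /negP[]; apply/mem_set|move=> /set_mem[/= Iz' _]; case: Iz; apply/mem_set].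
    apply/esym/integral0_eq => z _; rewrite /H patchE; case: ifPn => // /set_mem[/= _ Bv'].
    by case: Bv; apply/mem_set.
  have e2 : (fun t => \int[lebesgue_rV R n]_(v in B) `|partial ord0 f (rV_cons (t, v))|%:E)%E \_ I
      = fun t => (\int[lebesgue_rV R n]_v H (t, v))%E.
    apply/funext => t; rewrite patchE; case: ifPn => [/set_mem It|/negP It].
      rewrite integral_mkcond; apply: eq_integral => v _; rewrite /H !patchE.
      by case: ifPn => [/set_mem Iz|/negP Iz];
        case: ifPn => //; [move=> /negP[]; apply/mem_set|move=> /set_mem[/= _ Iz']; case: Iz; apply/mem_set].
    apply/esym/integral0_eq => v _; rewrite /H patchE; case: ifPn => // /set_mem[/= It' _].
    by case: It; apply/mem_set.
  rewrite e1 e2; apply/esym; apply: fubini_tonelli.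
    apply/(measurable_restrictT _ _).1; first exact: measurableX.
    by apply: measurable_funTS; exact: mabs.
  by move=> p; apply: erestrict_ge0 => x _; rewrite lee_fin.
have hE : (\int[lebesgue_measure]_(t in I) h t = \sum_(i < n)
   \int[lebesgue_rV R n.+1]_(x in ball a r) `|partial (lift ord0 i) f x|%:E)%E.
  rewrite ge0_integral_sum//; last 2 first.
  - by move=> i; apply: measurable_funTS; exact: mslice.
  - by move=> i t _; apply: integral_ge0 => v _; rewrite lee_fin.
  apply: eq_bigr => i _; rewrite ge0_integral_ballS//.
  by apply/measurable_EFinP; apply: measurableT_comp.
have GE : (\int[lebesgue_rV R n]_(v in B) G v <= \int[lebesgue_measure]_(t in I) h t)%E.
  apply: le_trans hy _; apply: le_trans ht0.
  apply: lee_wpmul2l; first by rewrite lee_fin ltW.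
  by apply: lee_sum => i _; under eq_integral do rewrite ps.
rewrite ge0_integral_ballS//; last exact/measurable_EFinP.
rewrite big_ord_recl -DE -hE.
(* From (t, v) one moves along the first axis to (t0, v), at cost [D v], and then inside the slice
   t0 to y, at cost [G v]. *)
apply: (@le_trans _ _ (\int[lebesgue_measure]_(t in I) (\int[lebesgue_rV R n]_(v in B) D v +
    \int[lebesgue_rV R n]_(v in B) G v))%E).
  apply: ge0_le_integral => //.
  - by move=> t _; apply: integral_ge0 => v _; rewrite lee_fin.
  - by apply: measurable_funTS; apply: (mslice (fun x => f x - f (rV_cons (t0, y)))); exact: measurable_funB.
  move=> t It; rewrite -ge0_integralD//; last 3 first.
  - exact: measurable_funTS.
  - by move=> v _; rewrite lee_fin.
  - exact: measurable_funTS.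
  apply: ge0_le_integral => //.
  - apply: measurable_funTS; apply/measurable_EFinP; apply: measurableT_comp mF _.
    by apply: measurableT_comp (@measurable_rV_cons R n) _; exact: pair1_measurable.
  - by apply: emeasurable_funD; exact: measurable_funTS.
  move=> v _; apply: le_trans (leeD2r _ (slice_increment v Cf It It0)).
  by rewrite -EFinD lee_fin; apply: ler_distD.
apply: (@le_trans _ _ ((2 * r)%:E * (\int[lebesgue_rV R n]_(v in B) D v +
    \int[lebesgue_rV R n]_(v in B) G v)))%E; last first.
  by apply: lee_wpmul2l; [rewrite lee_fin ltW|exact: leeD2l].
by rewrite integral_cst// muleC -leI.
Qed.

End poincare.

(** * The John-Stromberg inequality *)

Section john_stromberg.
Variables (R : realType) (n : nat).
Local Notation Rn := 'rV[R]_n.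
Local Notation mu := (lebesgue_rV R n).
Variables (s : R) (F : Rn -> R) (a : nat -> 'rV[int]_n -> R) (l : R).
Hypotheses (s0 : 0 < s) (mF : measurable_fun setT F) (l0 : 0 < l).

Let C k m : set Rn := cell (dyadic s k) m.
Let v k : R := dyadic s k ^+ n.
Let bad (al : R) : set Rn := [set z | l < `|F z - al|].

(* F is within l of a constant on most of each dyadic cell; this yields
   integrability of F on cells, with no a priori assumption on F. *)
Hypothesis osc : forall k m, (mu (C k m `&` bad (a k m)) <= (v k / (4 * 2 ^+ n))%:E)%E.

Let sk0 k : 0 < dyadic s k. Proof. exact: dyadic_gt0. Qed.
Let v0 k : 0 < v k. Proof. by rewrite exprn_gt0. Qed.
Let mC k m : measurable (C k m). Proof. exact: measurable_cell. Qed.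
Let muC k m : mu (C k m) = (v k)%:E. Proof. exact: lebesgue_cell. Qed.
Let int_cst k m (c : R) : (\int[mu]_(z in C k m) c%:E = (c * v k)%:E)%E.
Proof.
transitivity (c%:E * mu (C k m))%E; first exact: integral_cst.
by rewrite muC.
Qed.
Let vS k : v k = 2 ^+ n * v k.+1.
Proof. by rewrite /v dyadicS -exprMn mulrCA divff ?mulr1. Qed.

Let mdiff al : measurable_fun setT (fun z : Rn => `|F z - al|).
Proof.
by apply: (measurableT_comp (@normr_measurable _ setT)); exact: measurable_funB.
Qed.

Let mbad al : measurable (bad al).
Proof. by rewrite -[X in measurable X]setTI; apply: measurable_fun_ltr. Qed.

Let common (Q A B : set Rn) : measurable Q -> measurable A -> measurable B ->
  (mu (Q `&` A) + mu (Q `&` B) < mu Q)%E -> exists z, [/\ Q z, ~ A z & ~ B z].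
Proof.
move=> mQ mA mB; apply: contraPP => /forallNP h; apply/negP; rewrite -leNgt.
apply: le_trans; last by apply: measureU2; exact: measurableI.
apply: le_mu => //; first by apply: measurableU; exact: measurableI.
move=> z Qz; have [Az|nA] := pselect (A z); first by left.
by right; split => //; apply: contrapT => nB; exact: (h z).
Qed.

(** The [2 ^+ n] in [osc] pays for the passage to a child: there the bad sets of both constants
    together fill at most half, so some point is good for both. *)
Let dista k m m' : m = parent_cell m' -> `|a k m - a k.+1 m'| <= 2 * l.
Proof.
move=> mm'.
have sub : C k.+1 m' `<=` C k m.
  move=> z; rewrite /C /cell/= => zm'; rewrite mm' -zm' dyadicS.
  by rewrite -cell_index_half.
have [|z [_ /negP + /negP]] := @common (C k.+1 m') (bad (a k m)) (bad (a k.+1 m')) (mC _ _) (mbad _) (mbad _).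
  apply: (@le_lt_trans _ _ ((v k / (4 * 2 ^+ n))%:E + (v k.+1 / (4 * 2 ^+ n))%:E)%E).
    apply: leeD => //; apply: le_trans (osc k m).
    apply: le_mu; [exact: measurableI|exact: measurableI|].
    by apply: setSI.
  rewrite muC -EFinD lte_fin (vS k).
  have e : 2 ^+ n * v k.+1 / (4 * 2 ^+ n) = v k.+1 / 4.
    have : 2 ^+ n != 0 :> R by rewrite expf_neq0.
    by set w := 2 ^+ n => w0; field.
  rewrite e.
  have : v k.+1 / (4 * 2 ^+ n) <= v k.+1 / 4.
    rewrite ler_pM2l// lef_pV2 ?posrE// ?mulr_gt0 ?exprn_gt0//.
    by rewrite ler_peMr// exprn_ege1// ler1n.
  have := v0 k.+1; lra.
rewrite -!leNgt => h1 h2.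
have := ler_normB (F z - a k.+1 m') (F z - a k m).
rewrite (_ : _ - _ - _ = a k m - a k.+1 m'); last by ring.
by move=> h; apply: le_trans h _; lra.
Qed.

Section trunc.
Variable (N : R).
Hypothesis N0 : 0 < N.
(** Truncation at N supplies the finite bound from which the iteration in [js_trunc] starts; the
    resulting bound does not depend on N. *)
Let g al (z : Rn) : R := Num.min `|F z - al| N.

Let g0 al z : 0 <= g al z. Proof. by rewrite /g le_min normr_ge0 ltW. Qed.
Let gN al z : g al z <= N. Proof. by rewrite /g ge_min lexx orbT. Qed.
Let mgr al : measurable_fun setT (g al).
Proof. by apply: measurable_minr. Qed.
Let mg al : measurable_fun setT (fun z => (g al z)%:E).
Proof. exact/measurable_EFinP. Qed.
Let gD al be z : g al z <= g be z + `|al - be|.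
Proof.
rewrite /g; have := ler_distD be (F z) al; have := distrC be al.
have := normr_ge0 (al - be).
rewrite minElt [Num.min _ N]minElt; case: ifP => h1; case: ifP => h2; lra.
Qed.

Section step.
Variable B : R.
Hypothesis B0 : 0 <= B.
Hypothesis hB : forall k m, (\int[mu]_(z in C k m) (g (a k m) z)%:E <= (B * v k)%:E)%E.

Section top.
Variables (k0 : nat) (m0 : 'rV[int]_n).
Let al := a k0 m0.
Let E : set Rn := C k0 m0 `&` bad al.
Let mE : measurable E. Proof. exact: measurableI. Qed.

Section depth.
Variable d : nat.
Let Rr : set Rn := E `&` [set z | 2%:E * mu (E `&` cell (dyadic s (k0 + d)) (cell_index (dyadic s (k0 + d)) z))
     <= (dyadic s (k0 + d) ^+ n)%:E]%E.
Let mR : measurable Rr.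
Proof.
apply: measurableI => //.
exact: (@measurable_cell_union R n (dyadic s (k0 + d))
  [set m | 2%:E * mu (E `&` cell (dyadic s (k0 + d)) m) <= (dyadic s (k0 + d) ^+ n)%:E]%E).
Qed.

(** A stopped subcell contributes at most [B + 4 * l] times its volume, where [4 * l] is the drift
    of the constants from the top cell, two steps of [2 * l]. As E fills more than half of the
    subcell, this is at most [2 * (B + 4 * l)] times the measure of E inside. On [Rr] only the
    trivial bound N is left. *)
Let rhs (z : Rn) : \bar R := ((2 * (B + 4 * l))%:E * (\1_E z)%:E + N%:E * (\1_Rr z)%:E)%E.
Let mrhs : measurable_fun setT rhs.
Proof.
by apply: emeasurable_funD; apply: measurable_funeM; apply/measurable_EFinP; exact: measurable_indic.
Qed.
Let rhs0 z : (0 <= rhs z)%E.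
Proof. by rewrite adde_ge0// mule_ge0// lee_fin// ?mulr_ge0 ?addr_ge0 ?mulr_ge0// ltW. Qed.

Let int_rhs (Q : set Rn) : measurable Q -> (\int[mu]_(z in Q) rhs z =
  (2 * (B + 4 * l))%:E * mu (E `&` Q) + N%:E * mu (Rr `&` Q))%E.
Proof.
move=> mQ; rewrite ge0_integralD//; last first.
- apply: measurable_funTS; apply: measurable_funeM; apply/measurable_EFinP; exact: measurable_indic.
- by move=> z _; rewrite mule_ge0// lee_fin// ltW.
- apply: measurable_funTS; apply: measurable_funeM; apply/measurable_EFinP; exact: measurable_indic.
- by move=> z _; rewrite mule_ge0// lee_fin// mulr_ge0// addr_ge0// mulr_ge0// ltW.
rewrite !ge0_integralZl//; last first.
- by rewrite lee_fin mulr_ge0// addr_ge0// mulr_ge0// ltW.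
- apply: measurable_funTS; apply/measurable_EFinP; exact: measurable_indic.
- by rewrite lee_fin ltW.
- apply: measurable_funTS; apply/measurable_EFinP; exact: measurable_indic.
by rewrite !integral_indic.
Qed.

(* In a cell that E fills at most by half, stop at the maximal subcells that E fills by
   more than a half; they are treated by [hB], and what is left lies in Rr. *)
Let claim j : (j <= d)%N -> forall m, C (k0 + (d - j)) m `<=` C k0 m0 ->
  (2%:E * mu (E `&` C (k0 + (d - j)) m) <= (v (k0 + (d - j)))%:E)%E ->
  (\int[mu]_(z in C (k0 + (d - j)) m `&` E) (g al z)%:E <=
   \int[mu]_(z in C (k0 + (d - j)) m) rhs z)%E.
Proof.
elim: j => [_|j IH jd] m sub; rewrite ?subn0.
  rewrite int_rhs// => h.
  apply: (@le_trans _ _ (N%:E * mu (C (k0 + d) m `&` E))%E).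
    rewrite -integral_cst; last exact: measurableI.
    apply: ge0_le_integral => //.
    - exact: measurableI.
    - by move=> z _; rewrite lee_fin.
    - exact: measurable_funTS.
    - by move=> z _; rewrite lee_fin.
  apply: (@le_trans _ _ (N%:E * mu (Rr `&` C (k0 + d) m))%E).
    rewrite lee_pmul2l// ?lte_fin//; apply: le_mu; [exact: measurableI|exact: measurableI|].
    by move=> z [zm Ez]; split => //; split => //=; rewrite [cell_index _ _]zm.
  by rewrite leeDr// mule_ge0// lee_fin mulr_ge0// addr_ge0// mulr_ge0// ltW.
move=> h.
have dj : (d - j = (d - j.+1).+1)%N by lia.
have k0E : (k0 + (d - j) = (k0 + (d - j.+1)).+1)%N by rewrite dj addnS.
set k := (k0 + (d - j.+1))%N in sub h k0E *.
rewrite [leLHS]integral_mkcond [leRHS]integral_mkcond.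
apply: (@integral_cells_le _ _ (dyadic s k.+1)) => //.
- apply/(measurable_restrictT _ _).1; first exact: measurableI.
  exact: measurable_funTS.
- by move=> z; apply: erestrict_ge0 => // x _; rewrite lee_fin.
- apply/(measurable_restrictT _ _).1 => //; exact: measurable_funTS.
- by move=> z; apply: erestrict_ge0.
move=> m'; rewrite -/(C k.+1 m').
have [mm'|mm'] := eqVneq m (parent_cell m'); last first.
  rewrite -!integral_mkcondr (_ : C k.+1 m' `&` (C k m `&` E) = set0) ?integral_set0//.
    by apply: integral_ge0.
  rewrite -subset0 => z [zm' [zm _]]; move/eqP: mm'; apply.
  move: zm' zm; rewrite /C /cell/= => <- <-; rewrite dyadicS.
  by rewrite -cell_index_half.
have sub' : C k.+1 m' `<=` C k m.
  move=> z; rewrite /C /cell/= => zm'; rewrite mm' -zm' dyadicS.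
  by rewrite -cell_index_half.
rewrite -!integral_mkcondr.
rewrite (setIidl sub') setIA (setIidl sub').
have [h'|h'] := leP (2%:E * mu (E `&` C k.+1 m'))%E (v k.+1)%:E.
  have := IH (ltnW jd) m'; rewrite k0E => /(_ _ h'); apply.
  exact: subset_trans sub' sub.
have d1 := @dista k m m' mm'.
(* The parent was not stopped: E fills at most half of it, so some point lies neither in E nor in
   the bad set of [a k m], and links [al] to [a k m]. *)
have d2 : `|al - a k m| <= 2 * l.
  have [|z [Qz nE nb]] := @common (C k m) E (bad (a k m)) (mC _ _) mE (mbad _).
    rewrite muC setIC.
    have fE : mu (E `&` C k m) \is a fin_num.
      rewrite ge0_fin_numE//; apply: (@le_lt_trans _ _ (mu (C k m))).
        by apply: le_mu => //; exact: measurableI.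
      by rewrite muC ltry.
    apply: (@le_lt_trans _ _ (mu (E `&` C k m) + (v k / (4 * 2 ^+ n))%:E)%E).
      exact: leeD.
    move: h; rewrite -(fineK fE) -EFinM -EFinD lee_fin lte_fin => h.
    have : v k / (4 * 2 ^+ n) <= v k / 4.
      rewrite ler_pM2l// lef_pV2 ?posrE// ?mulr_gt0 ?exprn_gt0//.
      by rewrite ler_peMr// exprn_ege1// ler1n.
    have := v0 k; lra.
  have h1 : `|F z - al| <= l.
    by rewrite leNgt; apply/negP => hz; apply: nE; split => //; exact: sub.
  have h2 : `|F z - a k m| <= l by rewrite leNgt; apply/negP.
  have := ler_normB (F z - a k m) (F z - al).
  rewrite (_ : _ - _ - _ = al - a k m); last by ring.
  by move=> h3; apply: le_trans h3 _; lra.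
have d3 : `|al - a k.+1 m'| <= 4 * l.
  by have := ler_distD (a k m) al (a k.+1 m'); lra.
apply: (@le_trans _ _ (\int[mu]_(z in C k.+1 m') ((g (a k.+1 m') z)%:E + (4 * l)%:E))%E).
  apply: (@le_trans _ _ (\int[mu]_(z in C k.+1 m') (g al z)%:E)%E).
    apply: ge0_subset_integral => //; first exact: measurableI.
      exact: measurable_funTS.
    by move=> z _; rewrite lee_fin.
  apply: ge0_le_integral => //.
  - by move=> z _; rewrite lee_fin.
  - exact: measurable_funTS.
  - by apply: emeasurable_funD => //; exact: measurable_funTS.
  - by move=> z _; rewrite -EFinD lee_fin; apply: le_trans (gD _ (a k.+1 m') _) _; rewrite lerD2l.
rewrite ge0_integralD//; last first.
- by move=> z _; rewrite lee_fin mulr_ge0// ltW.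
- exact: measurable_funTS.
- by move=> z _; rewrite lee_fin.
rewrite int_cst.
apply: (@le_trans _ _ ((B + 4 * l)%:E * (v k.+1)%:E)%E).
  by apply: le_trans (leeD2r _ (hB _ _)) _; rewrite -EFinM -EFinD lee_fin; lra.
apply: (@le_trans _ _ ((B + 4 * l)%:E * (2%:E * mu (E `&` C k.+1 m')))%E).
  by rewrite lee_wpmul2l ?(ltW h')// lee_fin addr_ge0// mulr_ge0// ltW.
by rewrite int_rhs// muleA -EFinM [(B + _) * 2]mulrC leeDl// mule_ge0// lee_fin ltW.
Qed.

Let Esmall : (2%:E * mu E <= (v k0)%:E)%E.
Proof.
apply: (@le_trans _ _ (2%:E * (v k0 / (4 * 2 ^+ n))%:E)%E).
  by rewrite lee_pmul2l// ?lte_fin//; exact: osc.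
have : v k0 / (4 * 2 ^+ n) <= v k0 / 4.
  rewrite ler_pM2l// lef_pV2 ?posrE// ?mulr_gt0 ?exprn_gt0//.
  by rewrite ler_peMr// exprn_ege1// ler1n.
by rewrite -EFinM lee_fin; have := v0 k0; lra.
Qed.

(** The constant is [l] from the complement of E, plus [2 * (B + 4 * l)] times the measure of E,
    which is at most a quarter of the cell. *)
Lemma js_depth : (\int[mu]_(z in C k0 m0) (g al z)%:E <=
  ((3 * l + B / 2) * v k0)%:E + N%:E * mu Rr)%E.
Proof.
have := claim (leqnn d); rewrite subnn addn0 => /(_ m0 (fun _ => id)).
have EC : E `&` C k0 m0 = E by rewrite setIC setIA setIid.
rewrite EC => /(_ Esmall) h.
rewrite int_rhs// EC in h.
apply: (@le_trans _ _ (\int[mu]_(z in C k0 m0) (l%:E + (g al z * \1_E z)%:E))%E).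
  apply: ge0_le_integral => //.
  - by move=> z _; rewrite lee_fin.
  - exact: measurable_funTS.
  - apply: measurable_funTS; apply: emeasurable_funD => //.
    apply/measurable_EFinP/measurable_funM; first exact: mgr.
    exact: measurable_indic.
  - move=> z Cz; rewrite -EFinD lee_fin indicE; case: (boolP (z \in E)) => /=.
      by move=> _; rewrite mulr1 lerDr ltW.
    rewrite notin_setE mulr0 addr0 => nE.
    rewrite /g ge_min leNgt; apply/orP; left; apply/negP => hz; apply: nE; by split.
rewrite ge0_integralD//; last first.
- apply: measurable_funTS; apply/measurable_EFinP/measurable_funM; first exact: mgr.
  exact: measurable_indic.
- by move=> z _; rewrite lee_fin mulr_ge0.
- by move=> z _; rewrite lee_fin ltW.
rewrite int_cst.
have -> : (\int[mu]_(z in C k0 m0) (g al z * \1_E z)%:E)%E = (\int[mu]_(z in C k0 m0 `&` E) (g al z)%:E)%E.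
  rewrite integral_mkcondr; apply: eq_integral => z _; rewrite /restrict indicE.
  by case: ifP; rewrite ?mulr1 ?mulr0.
apply: (@le_trans _ _ ((l * v k0)%:E + ((2 * (B + 4 * l))%:E * mu E + N%:E * mu Rr))%E).
  apply: leeD => //; apply: le_trans h _; apply: leeD => //.
  rewrite lee_pmul2l ?lte_fin//; apply: le_mu => //; exact: measurableI.
rewrite addeA leeD2r//.
apply: (@le_trans _ _ ((l * v k0)%:E + (2 * (B + 4 * l))%:E * (v k0 / (4 * 2 ^+ n))%:E)%E).
  apply: leeD => //; rewrite lee_wpmul2l ?osc//.
  by rewrite lee_fin mulr_ge0// addr_ge0// mulr_ge0// ltW.
rewrite -EFinM -EFinD lee_fin.
have : v k0 / (4 * 2 ^+ n) <= v k0 / 4.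
  rewrite ler_pM2l// lef_pV2 ?posrE// ?mulr_gt0 ?exprn_gt0//.
  by rewrite ler_peMr// exprn_ege1// ler1n.
have p : 0 <= 2 * (B + 4 * l) by rewrite mulr_ge0// addr_ge0// mulr_ge0// ltW.
move=> /(ler_wpM2l p); lra.
Qed.

End depth.

(** The depth d is free: by density of E in its dyadic cells, the remainder [Rr] can be given
    measure at most [e / N]. *)
Lemma js_step : (\int[mu]_(z in C k0 m0) (g al z)%:E <= ((3 * l + B / 2) * v k0)%:E)%E.
Proof.
apply/lee_addgt0Pr => e e0.
have eN : 0 < e / N by rewrite divr_gt0.
have [d hd] := @cells_density R n (dyadic s k0) m0 E (e / N) (sk0 _) mE (@subIsetl _ _ _) eN.
apply: (le_trans (js_depth d)); rewrite leeD2l//.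
apply: (@le_trans _ _ (N%:E * (e / N)%:E)%E); last first.
  by rewrite -EFinM mulrCA divff ?gt_eqF// mulr1.
rewrite lee_pmul2l ?lte_fin//.
have e2 : dyadic (dyadic s k0) d = dyadic s (k0 + d).
  by rewrite /dyadic exprD invfM mulrA.
by move: hd; rewrite e2.
Qed.

End top.
End step.

(** The map B -> 3 l + B / 2 has fixed point 6 l; from the trivial bound N, j iterations lead to at
    most 6 l + N / 2^j. *)
Lemma js_trunc k m : (\int[mu]_(z in C k m) (g (a k m) z)%:E <= (6 * l * v k)%:E)%E.
Proof.
have base k' m' : (\int[mu]_(z in C k' m') (g (a k' m') z)%:E <= (N * v k')%:E)%E.
  rewrite EFinM -(muC k' m') -integral_cst//; apply: ge0_le_integral => //.
  - by move=> z _; rewrite lee_fin.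
  - exact: measurable_funTS.
  - by move=> z _; rewrite lee_fin.
have it j k' m' : (\int[mu]_(z in C k' m') (g (a k' m') z)%:E <= ((6 * l + N * 2^-1 ^+ j) * v k')%:E)%E.
  elim: j k' m' => [|j IH] k' m'.
    apply: (le_trans (base _ _)); rewrite expr0 mulr1 lee_fin ler_wpM2r ?(ltW (v0 _))//.
    by rewrite lerDr mulr_ge0// (ltW l0).
  have p : 0 <= 6 * l + N * 2^-1 ^+ j by rewrite addr_ge0// mulr_ge0// ltW.
  apply: le_trans (js_step p IH _ _) _; rewrite lee_fin exprS.
  rewrite (_ : 3 * l + _ = 6 * l + N * (2^-1 * 2^-1 ^+ j))//.
  by set w := _ ^+ j; field.
apply/lee_addgt0Pr => e e0.
have [j /(_ j (leqnn j)) hj] := @cvg_half R (e / (N * v k)) (divr_gt0 e0 (mulr_gt0 N0 (v0 k))).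
apply: (le_trans (it j k m)); rewrite -EFinD lee_fin mulrDl lerD2l.
move: hj; rewrite ltr_pdivlMr ?mulr_gt0// => /ltW; apply: le_trans.
by rewrite mulrAC mulrC.
Qed.

End trunc.

Lemma john_stromberg k m : (\int[mu]_(z in C k m) (`|F z - a k m|%:E) <= (6 * l * v k)%:E)%E.
Proof.
pose g N (z : Rn) := (Num.min `|F z - a k m| N.+1%:R)%:E.
have gc z : g^~ z @ \oo --> `|F z - a k m|%:E.
  apply: cvg_near_cst; exists (Num.truncn `|F z - a k m|) => // N /= hN.
  congr EFin; apply/min_idPl; apply: le_trans (ltW (truncnS_gt _)) _.
  by rewrite ler_nat ltnS.
have := @cvg_monotone_convergence _ _ _ mu (C k m) (mC k m) g.
have -> : (fun x => limn (g^~ x)) = (fun z => `|F z - a k m|%:E).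
  by apply/funext => z; apply/cvg_lim.
move=> h; have {}h : (fun N => \int[mu]_(z in C k m) g N z)%E @ \oo -->
   (\int[mu]_(z in C k m) (`|F z - a k m|%:E))%E.
  apply: h.
  - by move=> N; apply: measurable_funTS; apply/measurable_EFinP; apply: measurable_minr.
  - by move=> N z _; rewrite lee_fin le_min normr_ge0 ler0n.
  - move=> z _ i j ij; rewrite lee_fin le_min ge_min lexx/= ge_min ler_nat ltnS.
    by rewrite ij orbT.
rewrite -(cvg_lim _ h)//; apply: lime_le; first by apply/cvg_ex; eexists; exact: h.
by near=> N; exact: js_trunc.
Unshelve. all: by end_near. Qed.

End john_stromberg.

(** * Calderon-Zygmund operators away from the diagonal *)

Lemma nneseries_le_bound (R : realType) (v : nat -> R) (C : R) :
  (forall j, 0 <= v j) -> (forall N, \sum_(j < N) v j <= C) ->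
  (\sum_(j <oo) (v j)%:E <= C%:E)%E.
Proof.
move=> v0 h; apply: lime_le; first by apply: is_cvg_nneseries => j _ _; rewrite lee_fin.
by near=> N; rewrite sumEFin lee_fin big_mkord.
Unshelve. all: by end_near. Qed.

(** Each point of D is charged to one set containing it. The sets may overlap, so shells can be
    enlarged to balls, whose measure is explicit. *)
Lemma integral_le_shells d (T : measurableType d) (R : realType)
    (nu : {measure set T -> \bar R}) (D : set T) (g : T -> \bar R)
    (B : nat -> set T) (c : nat -> R) : measurable D -> measurable_fun D g ->
  (forall y, D y -> 0 <= g y)%E -> (forall j, measurable (B j)) -> (forall j, 0 <= c j) ->
  (forall y, D y -> exists j, B j y /\ (g y <= (c j)%:E)%E) ->
  (\int[nu]_(y in D) g y <= \sum_(j <oo) (c j)%:E * nu (B j))%E.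
Proof.
move=> mD mg g0 mB c0 h.
pose f j y : \bar R := ((c j)%:E * (\1_(B j) y)%:E)%E.
have f0 j y : (0 <= f j y)%E by rewrite mule_ge0// lee_fin.
have mf j : measurable_fun setT (f j).
  by apply: measurable_funeM; apply/measurable_EFinP; exact: measurable_indic.
apply: (@le_trans _ _ (\int[nu]_(y in D) \sum_(j <oo) f j y)%E).
  apply: ge0_le_integral => //.
    by apply: ge0_emeasurable_sum => // j *; exact: measurable_funTS.
  move=> y Dy; have [j [By gy]] := h y Dy.
  apply: (le_trans gy); apply: (@le_trans _ _ (f j y)).
    by rewrite /f indicE mem_set//= mule1.
  apply: le_trans (nneseries_lim_ge j.+1 _); last by move=> *; exact: f0.
  by rewrite big_nat_recr//= leeDr// sume_ge0.
apply: (@le_trans _ _ (\int[nu]_y \sum_(j <oo) f j y)%E).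
  apply: ge0_subset_integral => //.
    by apply: ge0_emeasurable_sum => // j *; exact: mf.
  by move=> y _; apply: nneseries_ge0 => *; exact: f0.
rewrite integral_nneseries//; apply: lee_nneseries => j.
  by move=> _ _; apply: integral_ge0.
move=> _; rewrite ge0_integralZl//; last 2 first.
- by apply/measurable_EFinP; exact: measurable_indic.
- by rewrite lee_fin.
by rewrite integral_indic// setIT.
Qed.

(** * Dyadic form of the Dini condition *)

Section dini.
Variables (R : realType) (w : R -> R).
Hypotheses (hmod : modulus_of_continuity w) (hdini : dini w).

Lemma modulus_ge0 t : 0 <= t -> 0 <= w t.
Proof. by case: hmod => w0 wm _ t0; rewrite -w0 wm. Qed.

(** Between 2^-(N+1) and 2^-N the integrand is at least w(2^-(N+1)) / 2^-N, on an interval of length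
    2^-N / 2; hence the factor 2 between the sums and the integral. *)
Lemma dini_sum : exists2 W : R, 0 <= W & forall N, \sum_(j < N) w (half_pow R j.+1) <= W.
Proof.
have [w0 wm _] := hmod.
pose g (t : R) : \bar R := (w t / t)%:E.
have g0 (t : R) : 0 < t -> (0 <= g t)%E.
  by move=> t0; rewrite lee_fin divr_ge0 ?modulus_ge0// ltW.
have lev0 := @half_pow_gt0 R.
have levS k : half_pow R k.+1 = half_pow R k / 2 by rewrite /half_pow exprS mulrC.
have lev1 k : half_pow R k <= 1.
  by rewrite /half_pow exprn_ile1// ?invf_le1// ler1n.
have mg (a : R) : 0 <= a -> measurable_fun `]a, 1%R] g.
  move=> a0; apply/measurable_EFinP; apply: measurable_funM.
    (* [w] is monotone on nonnegative arguments only; composing with the maximum with 0 gives a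
       function monotone on the whole line. *)
    apply: (eq_measurable_fun (g := w) (fun t : R => w (Num.max t 0))).
      move=> t; rewrite inE/= in_itv/= => /andP[h _].
      by rewrite max_l// ltW// (le_lt_trans a0).
    apply: nondecreasing_measurable => // x y xy.
    apply: wm; first by rewrite le_max lexx orbT.
    by rewrite ge_max !le_max xy lexx orbT.
  apply: (eq_measurable_fun (g := GRing.inv) (fun t : R => powR t (-1))).
    move=> t; rewrite inE/= in_itv/= => /andP[h _].
    by rewrite powR_inv1// (le_trans a0 (ltW h)).
  by apply: measurable_funTS; exact: measurable_powR.
have step N : (((\sum_(j < N) w (half_pow R j.+1)) / 2)%:E <= \int[@lebesgue_measure R]_(t in `](half_pow R N), 1%R]) g t)%E.
  elim: N => [|N IH].
    rewrite big_ord0 mul0r; apply: integral_ge0 => t /=; rewrite in_itv/= => /andP[t0 _].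
    by apply: g0; exact: lt_trans t0.
  have hN : half_pow R N.+1 < half_pow R N by rewrite levS; have := lev0 N; lra.
  have -> : `](half_pow R N.+1), 1%R]%classic = `](half_pow R N.+1), (half_pow R N)]%classic `|` `](half_pow R N), 1%R]%classic.
    apply/seteqP; split => t /=; rewrite !in_itv/=.
      move=> /andP[h1 h2]; have [h|h] := leP t (half_pow R N); [left|right]; by apply/andP.
    move=> [/andP[h1 h2]|/andP[h1 h2]]; apply/andP; split => //.
      exact: le_trans h2 (lev1 N).
    exact: lt_trans h1.
  rewrite ge0_integral_setU//; last 3 first.
  - apply: measurable_funS (mg (half_pow R N.+1) (ltW (lev0 _))) => // t /=.
    rewrite !in_itv/= => -[/andP[h1 h2]|/andP[h1 h2]]; apply/andP; split => //.
      exact: le_trans h2 (lev1 N).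
    exact: lt_trans h1.
  - move=> t /= [|]; rewrite in_itv/= => /andP[h1 _]; apply: g0.
      exact: lt_trans h1.
    exact: lt_trans h1.
  - apply/disj_setPRL => t /=; rewrite !in_itv/= => /andP[h1 _] /andP[_ h2].
    by move: h1; rewrite ltNge h2.
  rewrite big_ord_recr/= mulrDl EFinD addeC leeD//.
  apply: (@le_trans _ _ (\int[@lebesgue_measure R]_(t in `](half_pow R N.+1), (half_pow R N)]) (w (half_pow R N.+1) / half_pow R N)%:E)%E).
    rewrite integral_cst//= lebesgue_measure_itv/= lte_fin hN -EFinB -EFinM lee_fin levS.
    have e : half_pow R N - half_pow R N / 2 = half_pow R N / 2 by have := lev0 N; lra.
    have z : half_pow R N != 0 by rewrite gt_eqF.
    rewrite e; set q := half_pow R N in z *; set u := w _.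
    by rewrite (_ : u / q * (q / 2) = u / 2)//; field.
  apply: ge0_le_integral => //.
  - by move=> t _; rewrite lee_fin divr_ge0 ?modulus_ge0// ltW.
  - apply: measurable_funS (mg (half_pow R N.+1) (ltW (lev0 _))) => // t /=.
    rewrite !in_itv/= => /andP[-> h]/=; exact: le_trans h (lev1 N).
  - move=> t /=; rewrite in_itv/= => /andP[h1 h2]; rewrite lee_fin.
    have t0 : 0 < t by exact: lt_trans h1.
    apply: ler_pM; rewrite ?invr_ge0 ?modulus_ge0 ?(ltW (lev0 _))//.
      by apply: wm; rewrite ltW.
    by rewrite lef_pV2// posrE.
set J := (\int[@lebesgue_measure R]_(t in `]0%R, 1%R]) g t)%E.
have Jfin : J \is a fin_num.
  rewrite ge0_fin_numE//; apply: integral_ge0 => t /=; rewrite in_itv/= => /andP[t0 _].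
  exact: g0.
exists (2 * fine J).
  rewrite mulr_ge0// fine_ge0//; apply: integral_ge0 => t /=; rewrite in_itv/= => /andP[t0 _].
  exact: g0.
move=> N; rewrite -ler_pdivrMl// mulrC -lee_fin fineK//; apply: le_trans (step N) _.
apply: ge0_subset_integral => //; first exact: mg.
  by move=> t /=; rewrite in_itv/= => /andP[t0 _]; exact: g0.
by move=> t /=; rewrite !in_itv/= => /andP[h1 ->]; rewrite andbT; exact: lt_trans h1.
Qed.

End dini.

(* A is the weak type constant and W bounds the dyadic Dini sums of w. *)
Definition CZ_data (R : realType) (n : nat) (T : ('rV[R]_n -> R) -> 'rV[R]_n -> R)
    (K : 'rV[R]_n -> 'rV[R]_n -> R) (w : R -> R) (A W : R) :=
  [/\ linear_on_L1 T, represented_by T K, modulus_of_continuity w, kernel_smoothness K w &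
  [/\ 0 <= A, forall f, f \in Lfun (lebesgue_rV R n) 1 ->
     measurable_fun setT (T f) /\ forall l, 0 < l ->
       (l%:E * lebesgue_rV R n [set x | (l < `|T f x|)%R] <=
        A%:E * \int[lebesgue_rV R n]_x `|f x|%:E)%E,
     0 <= W & forall N, \sum_(j < N) w (half_pow R j.+1) <= W]].

Lemma CZ_operator_data (R : realType) (n : nat) (T : ('rV[R]_n -> R) -> 'rV[R]_n -> R) K :
  CZ_operator T K -> exists w A W, CZ_data T K w A W.
Proof.
move=> [lT [A hA] rT [w [mw dw kw]]]; have [W W0 hW] := dini_sum mw dw.
exists w, (Num.max A 0), W; split => //; split => //; first by rewrite le_max lexx orbT.
move=> f fL; have [mTf h] := hA f fL; split => // l l0.
apply: le_trans (h l l0) _; rewrite Lnorm1.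
rewrite (_ : (\int[_]_x `|(EFin \o f) x| = \int[lebesgue_rV R n]_x `|f x|%:E)%E)//.
apply: lee_wpmul2r; first by apply: integral_ge0 => x _; rewrite lee_fin.
by rewrite lee_fin le_max lexx.
Qed.

(** * Integrals of real-valued functions *)

Lemma integrable_EFinB d (T : measurableType d) (R : realType)
    (nu : {measure set T -> \bar R}) (D : set T) (f g : T -> R) : measurable D ->
  nu.-integrable D (EFin \o f) -> nu.-integrable D (EFin \o g) ->
  nu.-integrable D (EFin \o (fun x => f x - g x)).
Proof.
by move=> mD fi gi; rewrite (_ : _ \o _ = (EFin \o f) \- (EFin \o g))%E//; exact: integrableB.
Qed.

Lemma ae_eq_integrable d (T : measurableType d) (R : realType)
    (nu : {measure set T -> \bar R}) (f g : T -> \bar R) : measurable_fun setT g ->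
  ae_eq nu setT f g -> nu.-integrable setT f -> nu.-integrable setT g.
Proof.
move=> mg fg /integrableP[mf fi]; apply/integrableP; split => //.
rewrite (_ : (\int[nu]_x `|g x|)%E = (\int[nu]_x `|f x|)%E)//.
apply: ge0_ae_eq_integral => //; [exact: measurableT_comp|exact: measurableT_comp|].
by apply: filterS fg => x h /h ->.
Qed.

(** A finite extended integral would force both the positive and the negative part to be integrable;
    otherwise [fine] returns its default 0. *)
Lemma Rintegral_nonintegrable d (T : measurableType d) (R : realType)
    (nu : {measure set T -> \bar R}) (f : T -> R) : measurable_fun setT f ->
  ~ nu.-integrable setT (EFin \o f) -> \int[nu]_x f x = 0.
Proof.
move=> mf nf; rewrite /Rintegral; apply/eqP/negPn/negP => h; apply: nf.
have fin : (\int[nu]_x (f x)%:E)%E \is a fin_num.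
  by apply: contraNT h; case: (\int[nu]_x _)%E.
move: fin; rewrite integralE fin_numB => /andP[fp fn].
apply/integrableP; split; first exact/measurable_EFinP.
rewrite -[fun x => _]/(abse \o (EFin \o f)) fune_abse ge0_integralD//; last 2 first.
- by apply: measurable_funepos; exact/measurable_EFinP.
- by apply: measurable_funeneg; exact/measurable_EFinP.
have p0 : (0 <= \int[nu]_x (fun x0 : T => (f x0)%:E)^\+ x)%E by apply: integral_ge0.
have n0 : (0 <= \int[nu]_x (fun x0 : T => (f x0)%:E)^\- x)%E by apply: integral_ge0.
by apply: lte_add_pinfty; rewrite -ge0_fin_numE.
Qed.

(** Without integrability both sides take the default value 0. *)
Lemma measurable_RintegralZl d (T : measurableType d) (R : realType)
    (nu : {measure set T -> \bar R}) (f : T -> R) (c : R) : measurable_fun setT f ->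
  \int[nu]_x (c * f x) = c * \int[nu]_x f x.
Proof.
move=> mf; have [->|c0] := eqVneq c 0.
  by rewrite mul0r; under eq_Rintegral do rewrite mul0r; rewrite /Rintegral integral0.
have [fi|nf] := pselect (nu.-integrable setT (EFin \o f)); first exact: RintegralZl.
rewrite (Rintegral_nonintegrable mf nf) mulr0; apply: Rintegral_nonintegrable.
  exact: measurable_funM.
move=> /(integrableZl measurableT c^-1) h; apply: nf; move: h; congr (integrable _ _ _).
by apply/funext => x /=; rewrite -EFinM mulKf.
Qed.

Lemma eps_continuous_at (R : realType) (U V : normedModType R) (g : U -> V) (x : U) :
  (forall e, 0 < e -> exists2 d : R, 0 < d & forall y, `|x - y| < d -> `|g x - g y| < e) ->
  {for x, continuous g}.
Proof.
move=> h A /nbhs_ballP[e /= e0 eA]; have [d d0 hd] := h e e0.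
apply/nbhs_ballP; exists d => //= y; rewrite -ball_normE/= => xy.
by apply: eA; rewrite -ball_normE/=; exact: hd.
Qed.

Lemma le_normr_EFin_Rintegral d (T : measurableType d) (R : realType)
    (nu : {measure set T -> \bar R}) (g : T -> R) : nu.-integrable setT (EFin \o g) ->
  (`|\int[nu]_y g y|%:E <= \int[nu]_y `|g y|%:E)%E.
Proof.
move=> ig; rewrite /Rintegral -abse_EFin fineK; last exact: integrable_fin_num.
apply: le_trans (le_abse_integral _ measurableT _) _ => //.
by case/integrableP: ig.
Qed.

Lemma Rintegral_Fubini d1 d2 (T1 : measurableType d1) (T2 : measurableType d2) (R : realType)
    (m1 : {sigma_finite_measure set T1 -> \bar R}) (m2 : {sigma_finite_measure set T2 -> \bar R})
    (F : T1 * T2 -> R) : measurable_fun setT F ->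
  (\int[m1]_x \int[m2]_y `|F (x, y)|%:E < +oo)%E ->
  [/\ m1.-integrable setT (EFin \o fun x => \int[m2]_y F (x, y)),
      m2.-integrable setT (EFin \o fun y => \int[m1]_x F (x, y)) &
      \int[m1]_x \int[m2]_y F (x, y) = \int[m2]_y \int[m1]_x F (x, y)].
Proof.
move=> mF hF.
have iF : (m1 \x m2)%E.-integrable setT (EFin \o F).
  by apply/integrable12ltyP; first exact/measurable_EFinP.
have i1 := integrable_fubini_F iF.
have iF' : (m2 \x m1)%E.-integrable setT (EFin \o (fun p => F (p.2, p.1))).
  apply/integrable12ltyP.
    by apply/measurable_EFinP; apply: measurableT_comp => //; exact: measurable_swap.
  move: hF; rewrite (fubini_tonelli (fun p => `|F p|%:E))//.
  by apply/measurable_EFinP; exact: measurableT_comp.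
have i2 := integrable_fubini_F iF'.
have e1 : ae_eq m1 setT (fun x => \int[m2]_y (F (x, y))%:E)%E
    (EFin \o fun x => \int[m2]_y F (x, y)).
  apply: filterS (ae_integrable1 iF) => x ix _ /=.
  by rewrite /Rintegral fineK//; exact: integrable_fin_num.
have e2 : ae_eq m2 setT (fun y => \int[m1]_x (F (x, y))%:E)%E
    (EFin \o fun y => \int[m1]_x F (x, y)).
  apply: filterS (ae_integrable2 iF) => y iy _ /=.
  by rewrite /Rintegral fineK//; exact: integrable_fin_num.
have m1' : measurable_fun setT (EFin \o fun x => \int[m2]_y F (x, y)).
  apply/measurable_EFinP; apply: (measurableT_comp (f := fine)) => //.
  exact: measurable_int i1.
have m2' : measurable_fun setT (EFin \o fun y => \int[m1]_x F (x, y)).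
  apply/measurable_EFinP; apply: (measurableT_comp (f := fine)) => //.
  exact: measurable_int i2.
split.
- exact: ae_eq_integrable e1 i1.
- exact: ae_eq_integrable e2 i2.
- rewrite [LHS]/Rintegral [RHS]/Rintegral; congr fine.
  rewrite -(ae_eq_integral _ _ measurableT _ _ e1)//; last exact: measurable_int i1.
  rewrite -(ae_eq_integral _ _ measurableT _ _ e2)//; last exact: measurable_int i2.
  exact: (Fubini iF).
Qed.

(** * Bounded functions of bounded support *)

Section nice.
Variables (R : realType) (n : nat).
Local Notation Rn := 'rV[R]_n.
Local Notation mu := (lebesgue_rV R n).

(** The working domain of T: it lies in L^1, consists of compactly supported functions, and is
    stable under multiplication by indicators, which cut functions into local and far parts. *)
Definition nice (f : Rn -> R) : Prop := [/\ measurable_fun setT f,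
  exists M : R, forall x, `|f x| <= M & exists2 r : R, 0 < r & forall x, r <= `|x| -> f x = 0].

Lemma nice_integrable f : nice f -> mu.-integrable setT (EFin \o f).
Proof.
move=> [mf [M hM] [r r0 hr]].
have mB := measurable_ball_rV (0 : Rn) r.
have : mu.-integrable setT (fun x : Rn => (M * \1_(ball (0 : Rn) r) x)%:E).
  rewrite (_ : (fun x => _) = (fun x : Rn => (M%:E * (\1_(ball (0 : Rn) r) x)%:E)%E))//.
  apply: integrableZl => //; apply/integrableP; split.
    by apply/measurable_EFinP; exact: measurable_indic.
  under eq_integral do rewrite gee0_abs ?lee_fin//.
  have h : (mu (ball (0%R : Rn) r) < +oo)%E by rewrite lebesgue_ball// ltry.
  by rewrite integral_indic// setIT; exact: h.
apply: le_integrable => //; first exact/measurable_EFinP.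
move=> x _; rewrite /= lee_fin indicE ball_rVE; case: (boolP (x \in _)).
  by move=> _; rewrite mulr1 (le_trans (hM x))// ler_norm.
rewrite notin_setE/= => /negP; rewrite -leNgt sub0r normrN => /hr ->.
by rewrite normr0.
Qed.

Lemma nice_Lfun f : nice f -> f \in Lfun mu 1.
Proof. by move=> nf; apply/Lfun1_integrable; exact: nice_integrable. Qed.

Lemma supp_subset_closed (f : Rn -> R) (C : set Rn) : closed C -> (forall x, ~ C x -> f x = 0) ->
  supp f `<=` C.
Proof.
move=> cC h; rewrite /supp closureE => x; apply; split => // y /= fy.
by apply: contrapT => /h /eqP; rewrite (negbTE fy).
Qed.

Lemma continuous_dist (a : Rn) : continuous (fun x : Rn => `|a - x|).
Proof.
apply: eps_continuous => x e e0; exists e => // y xy.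
apply: le_lt_trans xy; have -> : x - y = (a - y) - (a - x).
  by apply/rowP => i; rewrite !rV_subE; ring.
by rewrite distrC ler_dist_dist.
Qed.

Lemma closed_norm_le (a : Rn) (r : R) : closed [set x : Rn | `|a - x| <= r].
Proof.
rewrite -[X in closed X]/((fun x : Rn => `|a - x|) @^-1` [set t | t <= r]).
apply: preimage_closed; last exact: closed_le.
by move=> x _; exact: continuous_dist.
Qed.

Lemma closed_norm_ge (a : Rn) (r : R) : closed [set x : Rn | r <= `|a - x|].
Proof.
rewrite -[X in closed X]/((fun x : Rn => `|a - x|) @^-1` [set t | r <= t]).
apply: preimage_closed; last exact: closed_ge.
by move=> x _; exact: continuous_dist.
Qed.

Lemma nice_supp f : nice f -> compactly_supported f.
Proof.
move=> [_ _ [r r0 hr]]; apply: bounded_closed_compact; last exact: closed_closure.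
have sub : supp f `<=` [set x : Rn | `|0 - x| <= r].
  apply: supp_subset_closed; first exact: closed_norm_le.
  by move=> x /= /negP; rewrite -ltNge sub0r normrN => /ltW /hr.
exists r; split; first exact: num_real.
by move=> M rM x /sub /=; rewrite sub0r normrN => h; rewrite (le_trans h)// ltW.
Qed.

Lemma notin_supp f (a z : Rn) (r : R) : (forall y, `|a - y| < r -> f y = 0) ->
  `|a - z| < r -> ~ supp f z.
Proof.
move=> h az; have sub : supp f `<=` [set x : Rn | r <= `|a - x|].
  apply: supp_subset_closed; first exact: closed_norm_ge.
  by move=> x /= /negP; rewrite -ltNge => /h.
by move=> /sub /=; rewrite leNgt az.
Qed.

Lemma niceM (g f : Rn -> R) : measurable_fun setT g -> (exists M : R, forall x, `|g x| <= M) ->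
  nice f -> nice (fun x => g x * f x).
Proof.
move=> mg [N hN] [mf [M hM] [r r0 hr]]; split.
- exact: measurable_funM.
- by exists (N * M) => x; rewrite normrM ler_pM.
- by exists r => // x /hr ->; rewrite mulr0.
Qed.

Lemma nice_lin (a b : R) (f g : Rn -> R) : nice f -> nice g -> nice (fun x => a * f x + b * g x).
Proof.
move=> [mf [M hM] [r r0 hr]] [mg [N hN] [q q0 hq]]; split.
- by apply: measurable_funD; apply: measurable_funM.
- exists (`|a| * M + `|b| * N) => x; rewrite (le_trans (ler_normD _ _))// !normrM.
  by apply: lerD; apply: ler_wpM2l.
- exists (r + q); first by rewrite addr_gt0.
  move=> x hx; rewrite hr ?hq ?mulr0 ?addr0//; apply: le_trans hx.
    by rewrite lerDr ltW.
  by rewrite lerDl ltW.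
Qed.

Lemma niceD (f g : Rn -> R) : nice f -> nice g -> nice (fun x => f x + g x).
Proof.
move=> nf ng; rewrite (_ : (fun x => _) = (fun x => 1 * f x + 1 * g x)); first exact: nice_lin.
by apply/funext => x; rewrite !mul1r.
Qed.

Lemma niceB (f g : Rn -> R) : nice f -> nice g -> nice (fun x => f x - g x).
Proof.
move=> nf ng; rewrite (_ : (fun x => _) = (fun x => 1 * f x + -1 * g x)); first exact: nice_lin.
by apply/funext => x; rewrite mul1r mulN1r.
Qed.

Lemma nice_ball (a : Rn) r : nice (\1_(ball a r) : Rn -> R).
Proof.
split; first by apply: measurable_indic; exact: measurable_ball_rV.
  by exists 1 => x; rewrite indicE; case: (_ \in _); rewrite ?normr1 ?normr0.
exists (`|a| + `|r| + 1); first by rewrite ltr_wpDl// addr_ge0.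
move=> x hx; rewrite indicE memNset// ball_rVE/=; apply/negP; rewrite -leNgt.
have := ler_norm r; have : `|x| <= `|a| + `|a - x|.
  by rewrite -{1}(subKr a x) (le_trans (ler_normB _ _)).
lra.
Qed.

Lemma ex_bound_indic (A : set Rn) : exists M : R, forall x, `|\1_A x : R| <= M.
Proof. by exists 1 => x; rewrite indicE; case: (_ \in _); rewrite ?normr1 ?normr0. Qed.

Lemma nice_int_fin f : nice f -> (\int[mu]_x `|f x|%:E)%E \is a fin_num.
Proof.
move=> /nice_integrable /integrableP[_ h]; rewrite ge0_fin_numE//.
by apply: integral_ge0 => x _; rewrite lee_fin.
Qed.

End nice.

(** * Consequences of the smoothness and of the weak type *)

Section CZ_basics.
Variables (R : realType) (n : nat) (T : ('rV[R]_n -> R) -> 'rV[R]_n -> R).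
Variables (K : 'rV[R]_n -> 'rV[R]_n -> R) (w : R -> R) (A W : R).
Local Notation Rn := 'rV[R]_n.
Local Notation mu := (lebesgue_rV R n).
Hypotheses (n0 : (0 < n)%N) (H : CZ_data T K w A W).

Let lT : linear_on_L1 T. Proof. by case: H. Qed.
Let rT : represented_by T K. Proof. by case: H. Qed.
Let mw : modulus_of_continuity w. Proof. by case: H. Qed.
Let kw : kernel_smoothness K w. Proof. by case: H. Qed.
Let A0 : 0 <= A. Proof. by case: H => _ _ _ _ []. Qed.
Let W0 : 0 <= W. Proof. by case: H => _ _ _ _ []. Qed.
Let hW N : \sum_(j < N) w (half_pow R j.+1) <= W. Proof. by case: H => _ _ _ _ []. Qed.
Let nR : (1 : R) <= n%:R. Proof. by rewrite ler1n. Qed.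

(* Cubes are balls of the sup norm. The factor n covers the comparison with the
   Euclidean norm: off [ball a (Lam * s)], [kernel_smoothness] applies on [ball a s]. *)
Definition Lam : R := 8 * n%:R.
Let Lam8 : 8 <= Lam. Proof. by rewrite /Lam ler_peMr. Qed.
Let Lam0 : 0 < Lam. Proof. exact: lt_le_trans Lam8. Qed.

(* Bound on the oscillation of [K^~ y] on [ball a s] when [`|a - y| = t]. *)
Definition osc_kernel (s t : R) : R := 2 ^+ n * w (4 * n%:R * s / t) / t ^+ n.

(** Origin of [osc_kernel] and of the 8 in [Lam]: z and z' are at Euclidean distance at most 2 n s,
    while y is at distance at least |a - y| / 2 >= 4 n s from z. So the smoothness condition
    applies, with ratio at most 4 n s / |a - y|. *)
Lemma kernel_diff (a z z' y : Rn) s : 0 < s -> ball a s z -> ball a s z' -> Lam * s <= `|a - y| ->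
  `|K z y - K z' y| <= osc_kernel s `|a - y|.
Proof.
rewrite ball_rVE /= => s0 az az' ay; have [_ wm _] := mw.
set D := `|a - y|.
have nn : 0 < n%:R :> R by rewrite ltr0n.
have D8 : 8 * (n%:R * s) <= D by rewrite mulrA.
have s1 : s <= n%:R * s by rewrite ler_peMl// ltW.
have D0 : 0 < D by apply: lt_le_trans ay; rewrite mulr_gt0.
have zy : D / 2 <= `|z - y|.
  have : D <= `|a - z| + `|z - y| by exact: ler_distD.
  lra.
have zz : `|z - z'| < 2 * s.
  have : `|z - z'| <= `|z - a| + `|a - z'| by exact: ler_distD.
  rewrite (distrC z a); lra.
have ezz : enorm (z - z') <= 2 * (n%:R * s).
  by apply: le_trans (enorm_le_norm _) _; rewrite mulrCA ler_pM2l// ltW.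
have ezy : D / 2 <= enorm (z - y) by exact: le_trans zy (le_norm_enorm _).
have zNy : z != y.
  by apply: contraTneq zy => ->; rewrite subrr normr0 -ltNge divr_gt0.
have ezy0 : 0 < enorm (z - y) by apply: lt_le_trans ezy; rewrite divr_gt0.
apply: le_trans (kw zNy _) _.
  by lra.
rewrite /osc_kernel -/D.
set q := w (4 * n%:R * s / D).
have -> : 2 ^+ n * q / D ^+ n = q * ((D / 2) ^+ n)^-1.
  rewrite expr_div_n invf_div; set u := D ^+ n; set v := 2 ^+ n; ring.
apply: ler_pM.
- by apply: (modulus_ge0 mw); rewrite divr_ge0// enorm_ge0.
- by rewrite invr_ge0 exprn_ge0// enorm_ge0.
- apply: wm; first by rewrite divr_ge0// enorm_ge0.
  rewrite (_ : 4 * _ * _ / _ = (2 * (n%:R * s)) * (D / 2)^-1); last first.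
    have z0 : D != 0 by rewrite gt_eqF.
    by field.
  apply: ler_pM; rewrite ?enorm_ge0 ?invr_ge0 ?enorm_ge0//.
  by rewrite lef_pV2 ?posrE// divr_gt0.
- by rewrite lef_pV2 ?posrE ?exprn_gt0 ?divr_gt0// ler_pXn2r ?nnegrE ?(ltW ezy0) ?divr_ge0 ?(ltW D0).
Qed.

Lemma osc_kernel_ge0 s t : 0 <= s -> 0 <= t -> 0 <= osc_kernel s t.
Proof.
move=> s0 t0; rewrite /osc_kernel divr_ge0 ?exprn_ge0// mulr_ge0 ?exprn_ge0//.
by apply: (modulus_ge0 mw); rewrite divr_ge0// !mulr_ge0.
Qed.

Lemma osc_kernel_anti s t t' : 0 <= s -> 0 < t -> t <= t' -> osc_kernel s t' <= osc_kernel s t.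
Proof.
move=> s0 t0 tt'; have t'0 : 0 < t' by exact: lt_le_trans tt'.
have [_ wm _] := mw.
rewrite /osc_kernel; apply: ler_pM.
- by rewrite mulr_ge0 ?exprn_ge0//; apply: (modulus_ge0 mw); rewrite divr_ge0 ?(ltW t'0)// !mulr_ge0.
- by rewrite invr_ge0 exprn_ge0 ?ltW.
- rewrite ler_pM2l ?exprn_gt0//; apply: wm; first by rewrite divr_ge0 ?(ltW t'0)// !mulr_ge0.
  by rewrite ler_wpM2l ?mulr_ge0// lef_pV2.
- by rewrite lef_pV2 ?posrE ?exprn_gt0// ler_pXn2r ?nnegrE ?(ltW t0) ?(ltW t'0).
Qed.

Definition far (a : Rn) (s : R) : set Rn := [set y | Lam * s <= `|a - y|].

Lemma measurable_far a s : measurable (far a s).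
Proof.
rewrite -[far a s]setTI; apply: measurable_fun_ler => //.
by apply: measurable_dist => //; exact: measurable_id.
Qed.

Lemma measurable_osc_kernel s (a : Rn) : 0 < s ->
  measurable_fun (far a s) (fun y : Rn => osc_kernel s `|a - y|).
Proof.
move=> s0; have mnorm : measurable_fun setT (fun y : Rn => `|a - y|).
  by apply: measurable_dist => //; exact: measurable_id.
have Ls : 0 < Lam * s by rewrite mulr_gt0.
pose k t := osc_kernel s (Num.max t (Lam * s)).
have mk : measurable_fun setT k.
  apply: nonincreasing_measurable => // x y xy.
  apply: osc_kernel_anti; rewrite ?(ltW s0) ?lt_max ?Ls ?orbT//.
  by rewrite ge_max le_max xy/= le_max lexx orbT.
apply: (eq_measurable_fun (g := fun y : Rn => osc_kernel s `|a - y|) (fun y : Rn => k `|a - y|)).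
  by move=> y; rewrite inE /far/= /k => h; rewrite max_l.
by apply: measurable_funTS; exact: measurableT_comp mk mnorm.
Qed.

(** At radius 2^j [Lam] s the argument of w is 2^-(j+1), because 4 n / [Lam] = 1/2, and the kernel
    bound times the volume of the next ball is 8^n w(2^-(j+1)). The shells add up to a dyadic Dini
    sum. *)
Lemma int_osc_kernel (a : Rn) s : 0 < s ->
  (\int[mu]_(y in far a s) (osc_kernel s `|a - y|)%:E <= (8 ^+ n * W)%:E)%E.
Proof.
move=> s0; have Ls : 0 < Lam * s by rewrite mulr_gt0.
pose r j : R := 2 ^+ j * (Lam * s).
have r0 j : 0 < r j by rewrite mulr_gt0// exprn_gt0.
apply: le_trans.
  apply: (@integral_le_shells _ _ R mu _ _ (fun j => ball a (r j.+1)) (fun j => osc_kernel s (r j))).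
  - exact: measurable_far.
  - apply/measurable_EFinP; exact: measurable_osc_kernel.
  - by move=> y _; rewrite lee_fin osc_kernel_ge0// ltW.
  - by move=> j; exact: measurable_ball_rV.
  - by move=> j; rewrite osc_kernel_ge0 ?ltW.
  - move=> y; rewrite /far/= => hy.
    have ex : exists j, `|a - y| < r j.+1.
      have [N /(_ N (leqnn N))] := @cvg_half R (Lam * s / (`|a - y| + 1)) (divr_gt0 Ls (ltr_wpDl (normr_ge0 _) ltr01)).
      rewrite exprVn ltr_pdivlMr ?(ltr_wpDl (normr_ge0 _) ltr01)// -ltr_pdivlMl ?invr_gt0 ?exprn_gt0// invrK => hN.
      exists N; rewrite /r exprS; have := r0 N; rewrite /r; lra.
    exists (ex_minn ex); case: ex_minnP => j hj hmin; split; first by rewrite ball_rVE.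
    rewrite lee_fin; apply: osc_kernel_anti; rewrite ?(ltW s0)//.
    case: j hj hmin => [|j] _ hmin; first by rewrite /r expr0 mul1r.
    by rewrite leNgt; apply/negP => /hmin; rewrite ltnn.
have e j : ((osc_kernel s (r j))%:E * mu (ball a (r j.+1)) = (8 ^+ n * w (half_pow R j.+1))%:E)%E.
  rewrite lebesgue_ball// -EFinM; congr EFin.
  have -> : r j.+1 = 2 * r j by rewrite /r exprS -mulrA.
  rewrite /osc_kernel.
  have -> : 4 * n%:R * s / r j = half_pow R j.+1.
    rewrite /r /half_pow exprVn exprS /Lam; have : 2 ^+ j != 0 :> R by rewrite expf_neq0.
    have : n%:R != 0 :> R by rewrite gt_eqF// ltr0n.
    have : s != 0 by rewrite gt_eqF.
    by move: (2 ^+ j) (n%:R) => u v h1 h2 h3; field; rewrite h1 h2 h3.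
  have -> : 8 = 2 * (2 * 2) :> R by ring.
  have : r j ^+ n != 0 by rewrite gt_eqF// exprn_gt0.
  move: (r j) => q; rewrite !exprMn; move: (q ^+ n) (2 ^+ n) (w _) => u v x h; by field.
under eq_eseriesr do rewrite e.
apply: nneseries_le_bound => [j|N].
  by rewrite mulr_ge0 ?exprn_ge0//; apply: (modulus_ge0 mw); exact/ltW/half_pow_gt0.
by rewrite -mulr_sumr ler_pM2l// exprn_gt0.
Qed.

Lemma near_Lam (a : Rn) s x : 0 < s -> ball a s x -> `|a - x| < Lam * s.
Proof.
rewrite ball_rVE/= => s0 h; apply: lt_le_trans h _; rewrite ler_peMl ?(ltW s0)//.
by apply: le_trans Lam8; rewrite ler1n.
Qed.

Lemma CZ_osc_int f (a : Rn) s z z' : 0 < s -> f \in Lfun mu 1 -> compactly_supported f ->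
  (forall y, `|a - y| < Lam * s -> f y = 0) -> ball a s z -> ball a s z' ->
  (`|T f z - T f z'|%:E <= \int[mu]_(y in far a s) (osc_kernel s `|a - y| * `|f y|)%:E)%E.
Proof.
move=> s0 fL fc f0 az az'.
have near x : ball a s x -> `|a - x| < Lam * s by exact: near_Lam.
have mf : measurable_fun setT f.
  by move/Lfun1_integrable: fL => /integrableP[/measurable_EFinP].
have [iz ez] := rT fL fc (notin_supp f0 (near _ az)).
have [iz' ez'] := rT fL fc (notin_supp f0 (near _ az')).
have -> : T f z - T f z' = \int[mu]_y (K z y * f y - K z' y * f y).
  by rewrite RintegralB// ez ez'.
have ib : mu.-integrable setT (EFin \o (fun y => K z y * f y - K z' y * f y)).
  exact: integrable_EFinB.
apply: (@le_trans _ _ (\int[mu]_y `|K z y * f y - K z' y * f y|%:E)%E).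
  apply: le_trans (le_normr_EFin_Rintegral ib) _ => //.
have mf' : measurable_fun (far a s) (fun y => `|K z y * f y - K z' y * f y|%:E).
  apply: measurable_funTS; apply/measurable_EFinP; apply: measurableT_comp => //.
  by move/integrableP: ib => [/measurable_EFinP].
rewrite (_ : (\int[mu]_y _)%E = (\int[mu]_(y in far a s) `|K z y * f y - K z' y * f y|%:E)%E); last first.
  rewrite [in RHS]integral_mkcond; apply: eq_integral => y _; rewrite patchE.
  case: ifPn => //; rewrite notin_setE /far/= => /negP; rewrite -ltNge => h.
  by rewrite f0// !mulr0 subrr normr0.
apply: ge0_le_integral => //.
- exact: measurable_far.
- apply/measurable_EFinP; apply: measurable_funM; first exact: measurable_osc_kernel.
  by apply: measurable_funTS; exact: measurableT_comp.
- move=> y hy; rewrite lee_fin -mulrBl normrM ler_wpM2r//.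
  exact: kernel_diff s0 az az' hy.
Qed.

Lemma CZ_osc f (a : Rn) s z z' M : 0 < s -> f \in Lfun mu 1 -> compactly_supported f ->
  (forall y, `|a - y| < Lam * s -> f y = 0) -> (forall y, `|f y| <= M) ->
  ball a s z -> ball a s z' -> `|T f z - T f z'| <= M * (8 ^+ n * W).
Proof.
move=> s0 fL fc f0 fM az az'; rewrite -lee_fin.
have M0 : 0 <= M by exact: le_trans (fM 0).
have mf : measurable_fun setT f.
  by move/Lfun1_integrable: fL => /integrableP[/measurable_EFinP].
apply: le_trans (CZ_osc_int s0 fL fc f0 az az') _.
apply: (@le_trans _ _ (\int[mu]_(y in far a s) (M%:E * (osc_kernel s `|a - y|)%:E))%E).
  have mk := measurable_osc_kernel (a := a) s0.
  apply: ge0_le_integral => //.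
  - exact: measurable_far.
  - by move=> y _; rewrite lee_fin mulr_ge0// osc_kernel_ge0// ltW.
  - apply/measurable_EFinP; apply: measurable_funM => //.
    by apply: measurable_funTS; exact: measurableT_comp.
  - by apply: measurable_funeM; exact/measurable_EFinP.
  - move=> y _; rewrite -EFinM lee_fin mulrC ler_wpM2r//.
    by rewrite osc_kernel_ge0// ltW.
rewrite ge0_integralZl//; last 3 first.
- exact: measurable_far.
- by apply/measurable_EFinP; exact: measurable_osc_kernel.
- by move=> y _; rewrite lee_fin osc_kernel_ge0// ltW.
rewrite EFinM; apply: lee_wpmul2l; first by rewrite lee_fin.
exact: int_osc_kernel.
Qed.

(** The first term is the weak type constant divided over a ball of volume (2 s)^n, the second is
    [osc_kernel s (Lam * s)], both multiplied by s^n. *)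
Definition annulus_cst : R := A / 2 ^+ n + 2 ^+ n * w (1 / 2) / Lam ^+ n.

Lemma annulus_cst_ge0 : 0 <= annulus_cst.
Proof.
rewrite addr_ge0// ?divr_ge0 ?mulr_ge0 ?exprn_ge0// ?(ltW Lam0)//.
exact: (modulus_ge0 mw).
Qed.

(* The weak type bounds T f at one point of the ball, the smoothness of K at all others. *)
Lemma CZ_annulus f (a : Rn) s z : 0 < s -> f \in Lfun mu 1 -> compactly_supported f ->
  (forall y, `|a - y| < Lam * s -> f y = 0) -> ball a s z ->
  (`|T f z|%:E <= (annulus_cst / s ^+ n)%:E * \int[mu]_y `|f y|%:E)%E.
Proof.
move=> s0 fL fc f0 az.
have fi : mu.-integrable setT (EFin \o f) by exact/Lfun1_integrable.
have mf : measurable_fun setT f by move/integrableP: fi => [/measurable_EFinP].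
have Ls : 0 < Lam * s by rewrite mulr_gt0.
have [I I0 eI] : exists2 I : R, 0 <= I & (\int[mu]_y `|f y|%:E = I%:E)%E.
  exists (fine (\int[mu]_y `|f y|%:E)%E).
    by rewrite fine_ge0//; apply: integral_ge0 => y _; rewrite lee_fin.
  rewrite fineK// ge0_fin_numE; first by case/integrableP: fi.
  by apply: integral_ge0 => y _; rewrite lee_fin.
rewrite eI -EFinM lee_fin.
have osc z' : ball a s z' -> `|T f z - T f z'| <= osc_kernel s (Lam * s) * I.
  move=> az'; rewrite -lee_fin; apply: le_trans (CZ_osc_int s0 fL fc f0 az az') _.
  rewrite EFinM -eI.
  apply: (@le_trans _ _ (\int[mu]_(y in far a s) ((osc_kernel s (Lam * s))%:E * `|f y|%:E))%E).
    apply: ge0_le_integral => //.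
    - exact: measurable_far.
    - by move=> y _; rewrite lee_fin mulr_ge0// osc_kernel_ge0// ltW.
    - apply/measurable_EFinP; apply: measurable_funM; first exact: measurable_osc_kernel.
      by apply: measurable_funTS; exact: measurableT_comp.
    - apply: measurable_funeM; apply/measurable_EFinP.
      by apply: measurable_funTS; exact: measurableT_comp.
    - by move=> y hy; rewrite -EFinM lee_fin ler_wpM2r// osc_kernel_anti// ltW.
  rewrite ge0_integralZl//; last 3 first.
  - exact: measurable_far.
  - by apply/measurable_EFinP; apply: measurable_funTS; exact: measurableT_comp.
  - by rewrite lee_fin osc_kernel_ge0// ltW.
  apply: lee_wpmul2l; first by rewrite lee_fin osc_kernel_ge0// ltW.
  apply: ge0_subset_integral => //; first exact: measurable_far.
  by apply/measurable_EFinP; exact: measurableT_comp.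
have e : annulus_cst / s ^+ n * I = A * I / (2 * s) ^+ n + osc_kernel s (Lam * s) * I.
  rewrite /annulus_cst /osc_kernel (exprMn _ Lam s) (exprMn _ 2 s).
  rewrite (_ : 4 * n%:R * s / (Lam * s) = 1 / 2); last first.
    have : n%:R != 0 :> R by rewrite gt_eqF// ltr0n.
    have : s != 0 by rewrite gt_eqF.
    by rewrite /Lam; move: (n%:R) => u h1 h2; field; rewrite h1 h2.
  have : s ^+ n != 0 by rewrite gt_eqF// exprn_gt0.
  have : Lam ^+ n != 0 by rewrite gt_eqF// exprn_gt0.
  have : 2 ^+ n != 0 :> R by rewrite gt_eqF// exprn_gt0.
  move: (2 ^+ n) (Lam ^+ n) (s ^+ n) (w _) => u v x q h1 h2 h3.
  by field; rewrite h1 h2 h3.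
rewrite e leNgt; apply/negP => hlt.
(* The midpoint between the weak type threshold of the ball and [|T f z|] minus the oscillation: the
   whole ball then lies in the level set of d, which is too large for the weak type. *)
pose d := (`|T f z| - osc_kernel s (Lam * s) * I + A * I / (2 * s) ^+ n) / 2.
have AI0 : 0 <= A * I / (2 * s) ^+ n.
  by rewrite divr_ge0 ?mulr_ge0// exprn_ge0// mulr_ge0// ltW.
have d0 : 0 < d by rewrite /d; lra.
have [mT /(_ d d0)] := (let: And5 _ _ _ _ (And4 _ h _ _) := H in h) f fL.
rewrite eI -EFinM; apply/negP; rewrite -ltNge.
have Aid : A * I < d * (2 * s) ^+ n.
  rewrite -ltr_pdivrMr; first by rewrite /d; lra.
  by rewrite exprn_gt0// mulr_gt0.
apply: (@lt_le_trans _ _ (d%:E * mu (ball a s))%E).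
  by rewrite lebesgue_ball// -EFinM lte_fin.
apply: lee_wpmul2l; first by rewrite lee_fin ltW.
apply: le_mu; first exact: measurable_ball_rV.
  rewrite -[X in measurable X]setTI; apply: measurable_fun_ltr => //.
  exact: measurableT_comp.
move=> z' /= az'; have := osc z' az'; have : `|T f z| <= `|T f z - T f z'| + `|T f z'|.
  by rewrite -{1}(subrK (T f z') (T f z)) ler_normD.
rewrite /d; lra.
Qed.

(* Apply [CZ_annulus] at x to the product of f and the sign of [K x y * f y]. *)
Lemma CZ_size f (x : Rn) s : 0 < s -> nice f -> (forall y, `|x - y| < Lam * s -> f y = 0) ->
  mu.-integrable setT (EFin \o (fun y => K x y * f y)) /\
  (\int[mu]_y `|K x y * f y|%:E <= (annulus_cst / s ^+ n)%:E * \int[mu]_y `|f y|%:E)%E.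
Proof.
move=> s0 nf f0; have xx : ball x s x by exact: ballxx.
have [ik _] := rT (nice_Lfun nf) (nice_supp nf) (notin_supp f0 (near_Lam s0 xx)).
split => //.
pose g y := Num.sg (K x y * f y) * f y.
have mk : measurable_fun setT (fun y => K x y * f y) by move/integrableP: ik => [/measurable_EFinP].
have ng : nice g.
  apply: niceM => //.
    rewrite (_ : (fun y => _) = (fun t : R => Num.sg t) \o (fun y => K x y * f y))//.
    apply: measurableT_comp mk; apply: nondecreasing_measurable => // u v uv.
    case: (ltgtP u 0) => [u0|u0|].
    - by rewrite (ltr0_sg u0); case: sgrP.
    - by rewrite !gtr0_sg// (lt_le_trans u0).
    - by move=> u0; rewrite u0 sgr0 sgr_ge0 -u0.
  by exists 1 => y; rewrite normr_sg; case: (_ != 0).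
have g0 y : `|x - y| < Lam * s -> g y = 0 by move=> /f0; rewrite /g => ->; rewrite mulr0.
have := CZ_annulus s0 (nice_Lfun ng) (nice_supp ng) g0 xx.
have [_ ->] := rT (nice_Lfun ng) (nice_supp ng) (notin_supp g0 (near_Lam s0 xx)).
have e y : K x y * g y = `|K x y * f y|.
  by rewrite /g mulrCA -normrEsg.
have -> : \int[mu]_y (K x y * g y) = fine (\int[mu]_y `|K x y * f y|%:E)%E.
  by rewrite /Rintegral; congr fine; apply: eq_integral => y _; rewrite e.
have h0 : (0 <= \int[mu]_y `|K x y * f y|%:E)%E by apply: integral_ge0 => y _; rewrite lee_fin.
rewrite ger0_norm ?fine_ge0// fineK; last first.
  by rewrite ge0_fin_numE//; case/integrableP: ik.
move=> /le_trans; apply; apply: lee_wpmul2l.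
  by rewrite lee_fin divr_ge0 ?annulus_cst_ge0// exprn_ge0// ltW.
apply: ge0_le_integral => //.
- by apply/measurable_EFinP; apply: measurableT_comp => //; case: ng.
- by apply/measurable_EFinP; apply: measurableT_comp => //; case: nf.
- move=> y _; rewrite lee_fin /g normrM normr_sg.
  by case: (_ != 0); rewrite ?mul1r// mul0r.
Qed.

(** By monotonicity the Dini sum is at least N w(2^-N), so w tends to 0 at 0. *)
Lemma modulus_small e : 0 < e -> exists2 d : R, 0 < d & w d < e.
Proof.
move=> e0; have [_ wm _] := mw.
pose N := (Num.truncn (W / e)).+1.
have hN : W < e * N%:R.
  by rewrite -ltr_pdivrMl// mulrC; exact: truncnS_gt.
exists (half_pow R N); first exact: half_pow_gt0.
have : \sum_(j < N) w (half_pow R N) <= W.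
  apply: le_trans (hW N); apply: ler_sum => j _; apply: wm; first exact/ltW/half_pow_gt0.
  by rewrite /half_pow; apply: ler_wiXn2l; rewrite ?invr_ge0 ?invf_le1 ?ler1n.
rewrite sumr_const card_ord -mulr_natr => h.
by have := le_lt_trans h hN; rewrite ltr_pM2r// ltr0n.
Qed.

Lemma kernel_continuous x y : x != y -> {for x, continuous (K^~ y)}.
Proof.
move=> xy; have [_ wm _] := mw.
pose D := enorm (x - y).
have D0 : 0 < D.
  by apply: lt_le_trans (le_norm_enorm _); rewrite normr_gt0 subr_eq0.
have nn : 0 < n%:R :> R by rewrite ltr0n.
apply: eps_continuous_at => e e0.
have [d d0 hd] := modulus_small (mulr_gt0 e0 (exprn_gt0 n D0)).
exists (n%:R^-1 * Num.min (d * D) (D / 2)).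
  by rewrite mulr_gt0 ?invr_gt0// lt_min mulr_gt0// divr_gt0.
move=> x' hx'.
have h : n%:R * `|x - x'| < Num.min (d * D) (D / 2) by rewrite -ltr_pdivlMl.
move: h; rewrite lt_min => /andP[h1 h2].
have en := enorm_le_norm (x - x').
apply: le_lt_trans (kw xy _) _; first by apply: le_trans en (ltW h2).
rewrite -/D ltr_pdivrMr ?exprn_gt0//; apply: le_lt_trans hd; apply: wm.
  by rewrite divr_ge0 ?enorm_ge0.
by rewrite ler_pdivrMr//; apply: le_trans en (ltW h1).
Qed.

(** The integrability in the representation, applied to indicators of bounded sets away from x,
    makes [K x] measurable there, and these sets exhaust the complement of a ball. *)
Lemma kernel_measurable_y (x : Rn) (r : R) : 0 < r -> measurable_fun setT (fun y : Rn => if r < `|x - y| then K x y else 0).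
Proof.
move=> r0.
have mr : measurable_fun setT (fun y : Rn => r < `|x - y|).
  apply: measurable_fun_ltr => //; apply: measurable_dist => //; exact: measurable_id.
have mi : measurable [set y : Rn | r < `|x - y|] by rewrite -[X in measurable X]setTI; exact: mr.
pose f k (y : Rn) : R := \1_[set y : Rn | r < `|x - y|] y * \1_(ball (0 : Rn) k.+1%:R) y.
have nf k : nice (f k).
  by apply: niceM; [exact: measurable_indic|exact: ex_bound_indic|exact: nice_ball].
apply: (@measurable_fun_cvg _ _ _ _ (fun k y => K x y * f k y)).
  move=> k; have f0 y : `|x - y| < Lam * (r / Lam) -> f k y = 0.
    rewrite mulrC divfK ?gt_eqF// => h; rewrite /f indicE memNset ?mul0r//= => h'.
    by have := lt_trans h h'; rewrite ltxx.
  have [+ _] := CZ_size (divr_gt0 r0 Lam0) (nf k) f0.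
  by move=> /integrableP[/measurable_EFinP].
move=> y _; apply: cvg_near_cst; near=> k.
have hk : `|y| < k.+1%:R.
  apply: lt_le_trans (truncnS_gt `|y|) _; rewrite ler_nat ltnS.
  by near: k; exact: nbhs_infty_ge.
rewrite /f !indicE [in X in _ * (_ * X)]mem_set ?mulr1; last by rewrite ball_rVE/= sub0r normrN.
case: ifPn => h; first by rewrite mem_set// mulr1.
by rewrite memNset ?mulr0//=; exact/negP.
Unshelve. all: by end_near. Qed.

(** Fubini is applied to this truncation: it is jointly measurable, by continuity in x and
    measurability in y, and equals K wherever the functions at hand are nonzero. *)
Definition off_kernel (rho : R) (x y : Rn) : R := if rho < `|x - y| then K x y else 0.

Lemma measurable_off_kernel rho : 0 < rho -> measurable_fun [set: Rn * Rn] (fun p => off_kernel rho p.1 p.2).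
Proof.
by move=> r0; apply: offdiag_measurable => //; [exact: kernel_measurable_y|exact: kernel_continuous].
Qed.

Lemma off_kernel_measurable_y rho (x : Rn) : 0 < rho -> measurable_fun setT (off_kernel rho x).
Proof.
move=> r0; rewrite (_ : off_kernel rho x = (fun p => off_kernel rho p.1 p.2) \o pair x)//.
by apply: measurableT_comp; [exact: measurable_off_kernel|exact: pair1_measurable].
Qed.

Lemma off_kernel_measurable_x rho (y : Rn) : 0 < rho -> measurable_fun setT (off_kernel rho ^~ y).
Proof.
move=> r0; rewrite (_ : (fun x => _) = (fun p => off_kernel rho p.1 p.2) \o pair^~ y)//.
by apply: measurableT_comp; [exact: measurable_off_kernel|exact: pair2_measurable].
Qed.

Lemma off_kernel_far rho s (a x y : Rn) : 0 < s -> rho <= s -> ball a s x -> Lam * s <= `|a - y| ->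
  off_kernel rho x y = K x y.
Proof.
rewrite ball_rVE/= => s0 rs ax ay; rewrite /off_kernel ifT//.
have : `|a - y| <= `|a - x| + `|x - y| by exact: ler_distD.
have : 8 * s <= Lam * s by rewrite ler_pM2r.
lra.
Qed.

(** [zeta] is merely bounded, so the kernel alone need not be integrable against it at infinity; the
    difference with [K a y] decays like [osc_kernel]. *)
Lemma kernel_diff_integral (a z : Rn) s (zeta : Rn -> R) M : 0 < s -> measurable_fun setT zeta ->
  (forall y, `|zeta y| <= M) -> (forall y, `|a - y| < Lam * s -> zeta y = 0) -> ball a s z ->
  mu.-integrable setT (EFin \o (fun y => (K z y - K a y) * zeta y)) /\
  (\int[mu]_y `|(K z y - K a y) * zeta y|%:E <= (M * (8 ^+ n * W))%:E)%E.
Proof.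
move=> s0 mz zM z0 az.
have M0 : 0 <= M by exact: le_trans (zM 0).
have aa : ball a s a by exact: ballxx.
have eK y : (K z y - K a y) * zeta y = (off_kernel s z y - off_kernel s a y) * zeta y.
  have [h|h] := ltP `|a - y| (Lam * s); first by rewrite z0// !mulr0.
  by rewrite (off_kernel_far s0 _ az h)// (off_kernel_far s0 _ aa h).
have mF : measurable_fun setT (fun y => (K z y - K a y) * zeta y).
  under eq_fun do rewrite eK; apply: measurable_funM => //.
  by apply: measurable_funB; exact: off_kernel_measurable_y.
have mk := measurable_osc_kernel (a := a) s0.
have bd : (\int[mu]_y `|(K z y - K a y) * zeta y|%:E <= (M * (8 ^+ n * W))%:E)%E.
  apply: (@le_trans _ _ (\int[mu]_(y in far a s) (M%:E * (osc_kernel s `|a - y|)%:E))%E); last first.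
    rewrite ge0_integralZl//; last 3 first.
    - exact: measurable_far.
    - exact/measurable_EFinP.
    - by move=> y _; rewrite lee_fin osc_kernel_ge0// ltW.
    rewrite EFinM; apply: lee_wpmul2l; first by rewrite lee_fin.
    exact: int_osc_kernel.
  rewrite (_ : (\int[mu]_y _)%E = (\int[mu]_(y in far a s) `|(K z y - K a y) * zeta y|%:E)%E); last first.
    rewrite [in RHS]integral_mkcond; apply: eq_integral => y _; rewrite patchE.
    case: ifPn => //; rewrite notin_setE /far/= => /negP; rewrite -ltNge => h.
    by rewrite z0// mulr0 normr0.
  apply: ge0_le_integral => //.
  - exact: measurable_far.
  - by apply/measurable_EFinP; apply: measurable_funTS; exact: measurableT_comp.
  - by apply: measurable_funeM; exact/measurable_EFinP.
  - move=> y hy; rewrite -EFinM lee_fin normrM mulrC ler_pM//.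
    exact: kernel_diff s0 az aa hy.
split => //; apply/integrableP; split; first exact/measurable_EFinP.
by apply: le_lt_trans bd _; rewrite ltry.
Qed.

Lemma CZ_far_Fubini (a : Rn) s (phi zeta : Rn -> R) M : 0 < s -> nice phi ->
  (forall x, s <= `|a - x| -> phi x = 0) ->
  measurable_fun setT zeta -> (forall y, `|zeta y| <= M) ->
  (forall y, `|a - y| < Lam * s -> zeta y = 0) ->
  [/\ mu.-integrable setT (EFin \o (fun x => phi x * \int[mu]_y ((K x y - K a y) * zeta y))),
      mu.-integrable setT (EFin \o (fun y => \int[mu]_x (phi x * ((K x y - K a y) * zeta y)))) &
      \int[mu]_y \int[mu]_x (phi x * ((K x y - K a y) * zeta y)) =
      \int[mu]_x (phi x * \int[mu]_y ((K x y - K a y) * zeta y))].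
Proof.
move=> s0 np p0 mz zM z0.
have M0 : 0 <= M by exact: le_trans (zM 0).
have aa : ball a s a by exact: ballxx.
have mp : measurable_fun setT phi by case: np.
have inb x : phi x != 0 -> ball a s x.
  by rewrite ball_rVE/= ltNge; apply: contraNN => /p0 ->.
pose F (p : Rn * Rn) := phi p.1 * ((off_kernel s p.1 p.2 - off_kernel s a p.2) * zeta p.2).
have mF : measurable_fun setT F.
  apply: measurable_funM; first exact: measurableT_comp.
  apply: measurable_funM; last exact: measurableT_comp.
  apply: measurable_funB; first exact: measurable_off_kernel.
  by apply: (measurableT_comp (f := off_kernel s a)) => //; exact: off_kernel_measurable_y.
have FE x y : F (x, y) = phi x * ((K x y - K a y) * zeta y).
  rewrite /F/=; have [->|/inb ax] := eqVneq (phi x) 0; first by rewrite !mul0r.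
  have [h|h] := ltP `|a - y| (Lam * s); first by rewrite z0// !mulr0.
  by rewrite (off_kernel_far s0 _ ax h)// (off_kernel_far s0 _ aa h).
have kd x : phi x != 0 -> _ := fun h => kernel_diff_integral s0 mz zM z0 (inb x h).
have e1 x : \int[mu]_y F (x, y) = phi x * \int[mu]_y ((K x y - K a y) * zeta y).
  transitivity (\int[mu]_y (phi x * ((K x y - K a y) * zeta y))).
    by apply: eq_Rintegral => y _; rewrite FE.
  have [->|/kd[ik _]] := eqVneq (phi x) 0; last by rewrite RintegralZl.
  rewrite mul0r; under eq_Rintegral do rewrite mul0r.
  by rewrite /Rintegral integral0.
have [|i1 i2 e12] := @Rintegral_Fubini _ _ _ _ _ mu mu F mF.
  apply: (@le_lt_trans _ _ (\int[mu]_x (`|phi x|%:E * (M * (8 ^+ n * W))%:E))%E).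
    apply: ge0_le_integral => //.
    - by move=> x _; apply: integral_ge0 => y _; rewrite lee_fin.
    - apply: (measurable_fun_fubini_tonelli_F (fun p => `|F p|%:E)) => //.
      by apply/measurable_EFinP; exact: measurableT_comp.
    - apply: emeasurable_funM => //; apply/measurable_EFinP; exact: measurableT_comp.
    - move=> x _; have [px|/[dup] pnz /kd[ik bk]] := eqVneq (phi x) 0.
        rewrite px normr0 mul0e; under eq_integral do rewrite /F/= px mul0r normr0.
        by rewrite integral0.
      under eq_integral do rewrite FE normrM EFinM.
      rewrite ge0_integralZl//; first by apply: lee_wpmul2l; rewrite ?lee_fin.
      by case/integrableP: ik => /measurable_EFinP h _; apply/measurable_EFinP; exact: measurableT_comp.
  rewrite ge0_integralZr//; last 2 first.
  - by apply/measurable_EFinP; exact: measurableT_comp.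
  - by rewrite lee_fin !mulr_ge0// exprn_ge0.
  rewrite lte_mul_pinfty//; first by apply: integral_ge0 => x _; rewrite lee_fin.
  + exact: nice_int_fin.
  + by rewrite ltry.
have eF y : \int[mu]_x F (x, y) = \int[mu]_x (phi x * ((K x y - K a y) * zeta y)).
  by apply: eq_Rintegral => x _; rewrite FE.
split.
- by move: i1; congr (integrable _ _ _); apply/funext => x /=; rewrite e1.
- by move: i2; congr (integrable _ _ _); apply/funext => y /=; rewrite eF.
- transitivity (\int[mu]_y \int[mu]_x F (x, y)); first by apply: eq_Rintegral => y _; rewrite eF.
  by rewrite -e12; apply: eq_Rintegral => x _; rewrite e1.
Qed.

(** Since [phi] has integral 0, [K a y] can be subtracted under the inner integral, which produces
    the convergent kernel of [CZ_far_Fubini]. *)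
Lemma CZ_pairing_far (a : Rn) s (phi zeta : Rn -> R) M : 0 < s -> nice phi ->
  (forall x, s <= `|a - x| -> phi x = 0) -> \int[mu]_x phi x = 0 ->
  measurable_fun setT zeta -> (forall y, `|zeta y| <= M) ->
  (forall y, `|a - y| < Lam * s -> zeta y = 0) ->
  [/\ mu.-integrable setT (EFin \o (fun x => phi x * \int[mu]_y ((K x y - K a y) * zeta y))),
      mu.-integrable setT (EFin \o (fun y => (\int[mu]_x (K x y * phi x)) * zeta y)) &
      \int[mu]_y ((\int[mu]_x (K x y * phi x)) * zeta y) =
      \int[mu]_x (phi x * \int[mu]_y ((K x y - K a y) * zeta y))].
Proof.
move=> s0 np p0 ip mz zM z0.
have aa : ball a s a by exact: ballxx.
have mp : measurable_fun setT phi by case: np.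
have inb x : phi x != 0 -> ball a s x.
  by rewrite ball_rVE/= ltNge; apply: contraNN => /p0 ->.
have e2 y : \int[mu]_x (phi x * ((K x y - K a y) * zeta y)) = (\int[mu]_x (K x y * phi x)) * zeta y.
  have [z00|znz] := eqVneq (zeta y) 0.
    rewrite z00 mulr0; under eq_Rintegral do rewrite !mulr0.
    by rewrite /Rintegral integral0.
  have hy : Lam * s <= `|a - y| by rewrite leNgt; apply: contraNN znz => /z0 ->.
  have ipK : mu.-integrable setT (EFin \o (fun x => K x y * phi x)).
    apply: (@le_integrable _ _ _ _ _ measurableT _
       (fun x => (osc_kernel s `|a - y| + `|K a y|)%:E * (phi x)%:E)%E).
    - apply/measurable_EFinP; rewrite (_ : (fun x => _) = (fun x => off_kernel s x y * phi x)).
        by apply: measurable_funM => //; exact: off_kernel_measurable_x.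
      apply/funext => x; have [->|/inb ax] := eqVneq (phi x) 0; first by rewrite !mulr0.
      by rewrite (off_kernel_far s0 _ ax hy).
    - move=> x _; rewrite -EFinM !abse_EFin lee_fin !normrM.
      have [->|/inb ax] := eqVneq (phi x) 0; first by rewrite normr0 !mulr0.
      apply: ler_wpM2r => //; rewrite [leRHS]ger0_norm ?addr_ge0 ?osc_kernel_ge0 ?(ltW s0)//.
      rewrite -{1}(subrK (K a y) (K x y)); apply: le_trans (ler_normD _ _) _.
      by rewrite lerD2r; exact: kernel_diff s0 ax aa hy.
    - apply: integrableZl => //; exact: nice_integrable.
  have ipa : mu.-integrable setT (EFin \o (fun x => K a y * phi x)).
    rewrite (_ : _ \o _ = (fun x => (K a y)%:E * (EFin \o phi) x)%E)//.
    by apply: integrableZl => //; exact: nice_integrable.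
  transitivity (\int[mu]_x (zeta y * (K x y * phi x - K a y * phi x))).
    by apply: eq_Rintegral => x _; ring.
  rewrite RintegralZl//; last first.
    exact: integrable_EFinB.
  rewrite RintegralB// (RintegralZl _ _ (nice_integrable np))// ip mulr0 subr0.
  by rewrite mulrC.
have [i1 i2 e12] := CZ_far_Fubini s0 np p0 mz zM z0; split => //.
- by move: i2; congr (integrable _ _ _); apply/funext => y /=; rewrite e2.
- by rewrite -e12; apply: eq_Rintegral => y _; rewrite e2.
Qed.

(** Separated supports make the double integral absolutely convergent, by [CZ_size]. The lemma
    serves to exchange one cutoff for another: their difference contributes equally to both terms of
    the pairing, with opposite signs. *)
Lemma CZ_pairing_away (phi zeta : Rn -> R) rho : 0 < rho -> nice phi -> nice zeta ->
  (forall x y, phi x != 0 -> zeta y != 0 -> rho < `|x - y|) ->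
  [/\ mu.-integrable setT (EFin \o (fun x => T zeta x * phi x)),
      mu.-integrable setT (EFin \o (fun y => (\int[mu]_x (K x y * phi x)) * zeta y)) &
      \int[mu]_y ((\int[mu]_x (K x y * phi x)) * zeta y) = \int[mu]_x (T zeta x * phi x)].
Proof.
move=> r0 np nz sep.
have mp : measurable_fun setT phi by case: np.
have mz : measurable_fun setT zeta by case: nz.
pose s := rho / Lam.
have s0 : 0 < s by rewrite divr_gt0.
have Ls : Lam * s = rho by rewrite /s mulrC divfK// gt_eqF.
have zx x : phi x != 0 -> forall y, `|x - y| < Lam * s -> zeta y = 0.
  rewrite Ls => px y h; apply/eqP/negPn/negP => /(sep _ _ px) /(lt_trans h).
  by rewrite ltxx.
pose F (p : Rn * Rn) := phi p.1 * (off_kernel rho p.1 p.2 * zeta p.2).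
have mF : measurable_fun setT F.
  apply: measurable_funM; first exact: measurableT_comp.
  by apply: measurable_funM; [exact: measurable_off_kernel|exact: measurableT_comp].
have FE x y : F (x, y) = phi x * (K x y * zeta y).
  rewrite /F/=; have [->|px] := eqVneq (phi x) 0; first by rewrite !mul0r.
  have [->|zy] := eqVneq (zeta y) 0; first by rewrite !mulr0.
  by rewrite /off_kernel ifT// sep.
have sz x : phi x != 0 -> _ := fun h => CZ_size s0 nz (zx x h).
have e1 x : \int[mu]_y F (x, y) = T zeta x * phi x.
  transitivity (\int[mu]_y (phi x * (K x y * zeta y))).
    by apply: eq_Rintegral => y _; rewrite FE.
  have [->|px] := eqVneq (phi x) 0.
    rewrite mulr0; under eq_Rintegral do rewrite mul0r.
    by rewrite /Rintegral integral0.
  have [_ ->] := rT (nice_Lfun nz) (nice_supp nz)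
    (notin_supp (zx x px) (near_Lam s0 (ballxx x s0))).
  by rewrite RintegralZl// 1?mulrC//; case: (sz x px).
have e2 y : \int[mu]_x F (x, y) = (\int[mu]_x (K x y * phi x)) * zeta y.
  have [z00|zy] := eqVneq (zeta y) 0.
    rewrite z00 mulr0; under eq_Rintegral do rewrite /F/= z00 !mulr0.
    by rewrite /Rintegral integral0.
  (* Integrability in x is available at best for almost every y, so [zeta y] is factored out by the
     form that allows the default value 0. *)
  rewrite mulrC -measurable_RintegralZl.
    by apply: eq_Rintegral => x _; rewrite FE; ring.
  rewrite (_ : (fun x => _) = (fun x => off_kernel rho x y * phi x)).
    by apply: measurable_funM => //; exact: off_kernel_measurable_x.
  apply/funext => x; have [->|px] := eqVneq (phi x) 0; first by rewrite !mulr0.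
  by rewrite /off_kernel ifT// sep.
have fin : (\int[mu]_x \int[mu]_y `|F (x, y)|%:E < +oo)%E.
  apply: (@le_lt_trans _ _ (\int[mu]_x (`|phi x|%:E * ((annulus_cst / s ^+ n)%:E * \int[mu]_y `|zeta y|%:E)))%E).
    apply: ge0_le_integral => //.
    - by move=> x _; apply: integral_ge0 => y _; rewrite lee_fin.
    - apply: (measurable_fun_fubini_tonelli_F (fun p => `|F p|%:E)) => //.
      by apply/measurable_EFinP; exact: measurableT_comp.
    - apply: emeasurable_funM => //; apply/measurable_EFinP; exact: measurableT_comp.
    - move=> x _; have [px|/sz[ik bk]] := eqVneq (phi x) 0.
        rewrite px normr0 mul0e; under eq_integral do rewrite /F/= px mul0r normr0.
        by rewrite integral0.
      under eq_integral do rewrite FE normrM EFinM.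
      rewrite ge0_integralZl//; first by apply: lee_wpmul2l; rewrite ?lee_fin.
      by case/integrableP: ik => /measurable_EFinP h _; apply/measurable_EFinP; exact: measurableT_comp.
  rewrite -(fineK (nice_int_fin nz)) -EFinM ge0_integralZr//; last 2 first.
  - by apply/measurable_EFinP; exact: measurableT_comp.
  - rewrite lee_fin mulr_ge0// ?divr_ge0 ?annulus_cst_ge0 ?exprn_ge0 ?(ltW s0)// fine_ge0//.
    by apply: integral_ge0 => x _; rewrite lee_fin.
  by rewrite -(fineK (nice_int_fin np)) -EFinM ltry.
have [i1 i2 e12] := Rintegral_Fubini mF fin.
split.
- by move: i1; congr (integrable _ _ _); apply/funext => x /=; rewrite e1.
- by move: i2; congr (integrable _ _ _); apply/funext => y /=; rewrite e2.
- transitivity (\int[mu]_y \int[mu]_x F (x, y)); first by apply: eq_Rintegral => y _; rewrite e2.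
  by rewrite -e12; apply: eq_Rintegral => x _; rewrite e1.
Qed.

End CZ_basics.

(** * The du Bois-Reymond lemma *)

Lemma integrable_EFinZ d (T : measurableType d) (R : realType)
    (nu : {measure set T -> \bar R}) (D : set T) (f : T -> R) (r : R) : measurable D ->
  nu.-integrable D (EFin \o f) -> nu.-integrable D (EFin \o (fun x => r * f x)).
Proof.
by move=> mD fi; rewrite (_ : _ \o _ = fun x => (r%:E * (EFin \o f) x)%E)//; exact: integrableZl.
Qed.

Section bumps.
Variables (R : realType) (n : nat).
Local Notation Rn := 'rV[R]_n.
Local Notation mu := (lebesgue_rV R n).

Lemma is_Ck_lin k (a b : R) (f g : Rn -> R) : is_Ck k f -> is_Ck k g ->
  is_Ck k (fun x => a * f x + b * g x).
Proof.
have cont (u v : Rn -> R) : continuous u -> continuous v -> continuous (fun x => a * u x + b * v x).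
  by move=> cu cv x; exact: (cvgD (cvgM (cvg_cst a) (cu x)) (cvgM (cvg_cst b) (cv x))).
elim: k f g => [|k IH] f g /=; first by move=> [cf _] [cg _]; split => //; exact: cont.
move=> [cf hf] [cg hg]; split; first exact: cont.
move=> i; have [df pf] := hf i; have [dg pg] := hg i.
have e : (fun x => a * f x + b * g x) = a *: f + b *: g by apply/funext.
split; first by move=> x; rewrite e; apply: derivableD; exact: derivableZ.
rewrite (_ : partial i _ = fun x => a * partial i f x + b * partial i g x); first exact: IH.
apply/funext => x; rewrite /partial e deriveD ?deriveZ//; exact: derivableZ.
Qed.

Lemma is_smooth_lin (a b : R) (f g : Rn -> R) : is_smooth f -> is_smooth g ->
  is_smooth (fun x => a * f x + b * g x).
Proof. by move=> sf sg k; exact: is_Ck_lin. Qed.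

Lemma is_smooth_continuous (f : Rn -> R) : is_smooth f -> continuous f.
Proof. by move=> /(_ 0%N)[]. Qed.

(** Each factor vanishes on the outer side of its face and is 1 from depth 1/k on. *)
Definition bump (al be : Rn) (k : nat) : Rn -> R :=
  prodf (fun i t => step (2 - k%:R * (t - al ord0 i)) * step (2 - k%:R * (be ord0 i - t))).

Lemma bump_smooth al be k : is_smooth (bump al be k).
Proof.
apply: is_smooth_prodf => j i; apply: smooth1M.
  rewrite (_ : (fun t => _) = (fun t => step (- k%:R * t + (2 + k%:R * al ord0 i)))).
    by apply: smooth1_affine; exact: smooth1_step.
  by apply/funext => t; congr step; ring.
rewrite (_ : (fun t => _) = (fun t => step (k%:R * t + (2 - k%:R * be ord0 i)))).
  by apply: smooth1_affine; exact: smooth1_step.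
by apply/funext => t; congr step; ring.
Qed.

Lemma bump_ge0 al be k x : 0 <= bump al be k x.
Proof. by apply: prodr_ge0 => i _; rewrite mulr_ge0// step_ge0. Qed.

Lemma bump_le1 al be k x : bump al be k x <= 1.
Proof.
apply: prodr_ile1 => i _; rewrite mulr_ge0 ?step_ge0//=.
by rewrite mulr_ile1 ?step_ge0 ?step_le1.
Qed.

Lemma bump_box al be k x : bump al be k x != 0 -> open_box al be x.
Proof.
move=> /prodf_neq0 h i; have := h i isT; rewrite mulf_eq0 negb_or => /andP[h1 h2].
have {}h1 : 2 - k%:R * (x ord0 i - al ord0 i) < 2.
  by rewrite ltNge; apply: contraNN h1 => /step0 ->.
have {}h2 : 2 - k%:R * (be ord0 i - x ord0 i) < 2.
  by rewrite ltNge; apply: contraNN h2 => /step0 ->.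
have k0 : 0 <= k%:R :> R by rewrite ler0n.
apply/andP; split; rewrite -subr_gt0 ltNge; apply/negP => hh.
  by have := mulr_ge0_le0 k0 hh; lra.
by have := mulr_ge0_le0 k0 hh; lra.
Qed.

Lemma open_box_bounded al be (x : Rn) : open_box al be x -> `|x| <= `|al| + `|be|.
Proof.
move=> h; apply/norm_rV_le; first by rewrite addr_ge0.
move=> i; have /andP[h1 h2] := h i.
have := coord_le_norm al i; have := coord_le_norm be i.
rewrite !ler_norml => /andP[? ?] /andP[? ?]; apply/andP.
by have := normr_ge0 al; have := normr_ge0 be; lra.
Qed.

Lemma bump_nice al be k : nice (bump al be k).
Proof.
split.
- by apply: continuous_measurable_rV; apply: is_smooth_continuous; exact: bump_smooth.
- by exists 1 => x; rewrite ger0_norm ?bump_ge0 ?bump_le1.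
- exists (`|al| + `|be| + 1); first by rewrite ltr_wpDl// addr_ge0.
  move=> x hx; apply/eqP/negPn/negP => /bump_box /open_box_bounded; lra.
Qed.

Lemma bump_eventually al be (x : Rn) : \forall k \near \oo, bump al be k x = \1_(open_box al be) x.
Proof.
have [h|h] := pselect (open_box al be x); last first.
  near=> k; rewrite indicE memNset//; apply/eqP/negPn/negP => /bump_box; exact: h.
pose c := \sum_i ((x ord0 i - al ord0 i)^-1 + (be ord0 i - x ord0 i)^-1).
have p i : 0 < (x ord0 i - al ord0 i)^-1 /\ 0 < (be ord0 i - x ord0 i)^-1.
  by have /andP[h1 h2] := h i; rewrite !invr_gt0 !subr_gt0.
have ci i : (x ord0 i - al ord0 i)^-1 + (be ord0 i - x ord0 i)^-1 <= c.
  rewrite /c (bigD1 i)//= lerDl sumr_ge0// => j _.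
  by have [? ?] := p j; rewrite addr_ge0// ltW.
near=> k.
have ck : c <= k%:R.
  apply: ltW; apply: lt_le_trans (truncnS_gt c) _; rewrite ler_nat.
  by near: k; exact: nbhs_infty_ge.
rewrite indicE mem_set//; apply: big1 => i _; have [p1 p2] := p i; have := ci i.
have /andP[h1 h2] := h i => hc.
rewrite !step1 ?mulr1//.
  suff : 1 <= k%:R * (be ord0 i - x ord0 i) by lra.
  rewrite -ler_pdivrMr ?subr_gt0// mul1r; lra.
suff : 1 <= k%:R * (x ord0 i - al ord0 i) by lra.
rewrite -ler_pdivrMr ?subr_gt0// mul1r; lra.
Unshelve. all: by end_near. Qed.

Lemma bump_integral_cvg (g : Rn -> R) al be : mu.-integrable setT (EFin \o g) ->
  (\int[mu]_x (g x * bump al be k x)%:E)%E @[k --> \oo] --> (\int[mu]_(x in open_box al be) (g x)%:E)%E.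
Proof.
move=> ig; have mg : measurable_fun setT g by case/integrableP: ig => /measurable_EFinP.
have mb k : measurable_fun setT (bump al be k) by case: (bump_nice al be k).
have mB := measurable_open_box al be.
rewrite (_ : (\int[mu]_(x in open_box al be) (g x)%:E)%E =
   (\int[mu]_x (g x * \1_(open_box al be) x)%:E)%E); last first.
  rewrite integral_mkcond; apply: eq_integral => x _; rewrite patchE indicE.
  by case: ifPn; rewrite ?mulr1 ?mulr0.
have h1 k : measurable_fun setT (fun x => (g x * bump al be k x)%:E).
  by apply/measurable_EFinP; exact: measurable_funM.
have h2 : measurable_fun setT (fun x => (g x * \1_(open_box al be) x)%:E).
  by apply/measurable_EFinP; apply: measurable_funM => //; exact: measurable_indic.
have h3 : {ae mu, forall x, setT x ->
    (g x * bump al be k x)%:E @[k --> \oo] --> (g x * \1_(open_box al be) x)%:E}.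
  apply: aeW => x _; apply: cvg_near_cst.
  by apply: filterS (bump_eventually al be x) => k ->.
have h5 : {ae mu, forall x k, setT x -> (`|(g x * bump al be k x)%:E| <= `|(g x)%:E|)%E}.
  apply: aeW => x k _; rewrite !abse_EFin lee_fin normrM ler_piMr//.
  by rewrite ger0_norm ?bump_ge0 ?bump_le1.
by have [_ _] := dominated_convergence measurableT h1 h2 h3 (integrable_abse ig) h5.
Qed.

(** Vanishing outside one box makes the total integral zero, which the complement step of the Dynkin
    argument requires. *)
Lemma ae_eq0_of_boxes (g : Rn -> R) al be : mu.-integrable setT (EFin \o g) ->
  (forall x, ~ open_box al be x -> g x = 0) ->
  (forall a b, \int[mu]_(x in open_box a b) (g x)%:E = 0)%E ->
  {ae mu, forall x, g x = 0}.
Proof.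
move=> ig g0 hb.
have sub D : measurable D -> mu.-integrable D (EFin \o g).
  by move=> mD; apply: integrableS ig.
have mg : measurable_fun setT (EFin \o g) by case/integrableP: ig.
have intT : (\int[mu]_x (g x)%:E = 0)%E.
  rewrite -(hb al be) [RHS]integral_mkcond; apply: eq_integral => x _; rewrite patchE.
  by case: ifPn => //; rewrite notin_setE => /g0 ->.
have all E : measurable E -> (\int[mu]_(x in E) (g x)%:E = 0)%E.
  have := @dynkin_induction _ Rn _ (fun E => \int[mu]_(x in E) (g x)%:E = 0)%E
    (measurable_rV_open_box R n) (@open_box_setI R n) intT.
  rewrite -measurable_rV_open_box; apply => //.
  - by move=> _ [a [b ->]].
  - move=> S mS S0; rewrite -intT -[in RHS](setUv S) integral_setU//.
    + by rewrite S0 add0e.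
    + exact: measurableC.
    + exact: measurable_funTS.
    + by rewrite disj_set2E setICr.
  - move=> F mF tF F0; rewrite integral_bigcup//.
      by rewrite eseries0// => i _ _; exact: F0.
    by apply: sub; exact: bigcup_measurable.
have := @integral_ae_eq _ _ _ mu setT measurableT (cst 0%E) (EFin \o g) ig.
case=> // [E _ mE|N [mN N0 sN]]; first by rewrite /= all// integral0.
by exists N; split => // x /= hx; apply: sN => /= h; apply: hx; have [] := h I.
Qed.

Section du_bois_reymond.
Variables (al be : Rn) (h : Rn -> R).
Local Notation P := (open_box al be).
Hypothesis lt_al_be : forall i, al ord0 i < be ord0 i.
Hypothesis mh : measurable_fun setT h.
Hypothesis ih : mu.-integrable P (EFin \o h).
Hypothesis h0 : forall phi, is_smooth phi -> nice phi -> (forall x, phi x != 0 -> P x) ->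
  \int[mu]_x phi x = 0 -> \int[mu]_x (h x * phi x) = 0.

Lemma open_box_measure_gt0 : (0 < mu P)%E.
Proof.
have -> : P = [set x : Rn | forall i, `](al ord0 i), (be ord0 i)[%classic (x ord0 i)].
  by apply/seteqP; split => x /= hx i; have := hx i; rewrite in_itv.
rewrite (@lebesgue_rV_box R n (fun i => `](al ord0 i), (be ord0 i)[%classic)); last by move=> i; exact: measurable_itv.
under eq_bigr do rewrite lebesgue_measure_itv/= lte_fin lt_al_be -EFinB.
by rewrite prodEFin lte_fin prodr_gt0// => i _; rewrite subr_gt0.
Qed.

Lemma open_box_measure_fin : (mu P < +oo)%E.
Proof.
apply: (@le_lt_trans _ _ (mu (ball (0%R : Rn) (`|al| + `|be| + 1)))); last first.
  by rewrite lebesgue_ball ?ltry// ltr_wpDl// addr_ge0.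
apply: le_mu; [exact: measurable_open_box|exact: measurable_ball_rV|].
move=> x /open_box_bounded hx; rewrite ball_rVE/= sub0r normrN; lra.
Qed.

Lemma du_bois_reymond : exists c : R, {ae mu, forall x, P x -> h x = c}.
Proof.
have mP := measurable_open_box al be.
pose H x := h x * \1_P x.
have iH : mu.-integrable setT (EFin \o H).
  apply: (eq_integrable measurableT ((EFin \o h) \_ P)); last exact/(integrable_mkcond _ mP).
  by move=> x _; rewrite /H/= patchE indicE; case: (x \in P); rewrite ?mulr1 ?mulr0.
have iP : mu.-integrable setT (EFin \o (\1_P : Rn -> R)).
  apply/integrableP; split; first by apply/measurable_EFinP; exact: measurable_indic.
  under eq_integral => x _ do rewrite /= ger0_norm//.
  by rewrite integral_indic// setIT; exact: open_box_measure_fin.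
have [k0 I0] : exists k, 0 < \int[mu]_x bump al be k x.
  have := bump_integral_cvg (al := al) (be := be) iP.
  have -> : (\int[mu]_(x in P) (\1_P x)%:E = mu P)%E.
    by rewrite integral_indic// setIid.
  move=> cv; have [N _ hN] : \forall k \near \oo, (0 < \int[mu]_x (\1_P x * bump al be k x)%:E)%E.
    exact: cv (open_ereal_gt' open_box_measure_gt0).
  exists N; have := hN N (leqnn N).
  have -> : (\int[mu]_x (\1_P x * bump al be N x)%:E = \int[mu]_x (bump al be N x)%:E)%E.
    apply: eq_integral => x _; rewrite indicE; case: (boolP (x \in P)); first by rewrite mul1r.
    by rewrite notin_setE => Px; rewrite mul0r; congr EFin; apply/esym/eqP/negPn/negP => /bump_box.
  rewrite /Rintegral -lte_fin fineK//.
  exact/integrable_fin_num/nice_integrable/bump_nice.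
pose psi := bump al be k0.
pose I := \int[mu]_x psi x.
(* Subtracting from any phi the multiple of [psi] with the same integral leaves integral zero; hence
   h integrates against phi as the constant c does. *)
pose c := (\int[mu]_x (h x * psi x)) / I.
exists c.
pose g x := H x - c * \1_P x.
have ig : mu.-integrable setT (EFin \o g).
  apply: integrable_EFinB => //.
  exact: integrable_EFinZ.
have Hphi phi x : (phi x != 0 -> P x) -> H x * phi x = h x * phi x.
  move=> hp; have [->|/hp px] := eqVneq (phi x) 0; first by rewrite !mulr0.
  by rewrite /H indicE mem_set// mulr1.
have ihphi (phi : Rn -> R) : nice phi -> (forall x, phi x != 0 -> P x) ->
    mu.-integrable setT (EFin \o (fun x => h x * phi x)).
  move=> [mp [M hM] _] pp.
  apply: (@le_integrable _ _ _ _ _ measurableT _ (fun x => M%:E * (EFin \o H) x)%E).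
  - by apply/measurable_EFinP; exact: measurable_funM.
  - move=> x _; rewrite [(EFin \o _) x]/= [(EFin \o H) x]/= -EFinM !abse_EFin -Hphi; last exact: pp.
    rewrite lee_fin !normrM mulrC ler_wpM2r//.
    exact: le_trans (hM x) (ler_norm _).
  - exact: integrableZl.
have test phi : is_smooth phi -> nice phi -> (forall x, phi x != 0 -> P x) ->
    \int[mu]_x (h x * phi x) = c * \int[mu]_x phi x.
  move=> sp np pp; pose r := (\int[mu]_x phi x) / I.
  have npsi := bump_nice al be k0.
  have ppsi x : psi x != 0 -> P x by exact: bump_box.
  have := @h0 (fun x => 1 * phi x + - r * psi x).
  have e : \int[mu]_x (1 * phi x + - r * psi x) = 0.
    under eq_Rintegral do rewrite mul1r mulNr.
    rewrite RintegralB//; last 2 first.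
    - exact: nice_integrable.
    - by apply: integrable_EFinZ => //; exact: nice_integrable.
    rewrite RintegralZl//; last exact: nice_integrable.
    by rewrite -/I /r divfK ?subrr// gt_eqF.
  move=> /(_ (is_smooth_lin _ _ sp (bump_smooth _ _ _)) (nice_lin _ _ np npsi) _ e) h1.
  have {}h1 : \int[mu]_x (h x * phi x - r * (h x * psi x)) = 0.
    rewrite -[RHS]h1; first by apply: eq_Rintegral => x _; ring.
    move=> x; apply: contraNP => nP; apply/eqP.
    have -> : phi x = 0 by apply/eqP/negPn/negP => /pp.
    have -> : psi x = 0 by apply/eqP/negPn/negP => /ppsi.
    by rewrite !mulr0 addr0.
  move: h1; rewrite RintegralB//; last 2 first.
  - exact: ihphi.
  - by apply: integrable_EFinZ => //; exact: ihphi.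
  rewrite RintegralZl//; last exact: ihphi.
  move/eqP; rewrite subr_eq0 => /eqP ->; rewrite /r /c; ring.
have gP x : ~ P x -> g x = 0.
  by move=> nP; rewrite /g /H indicE memNset// !mulr0 subr0.
have : {ae mu, forall x, g x = 0}.
  apply: (ae_eq0_of_boxes ig gP) => a b.
  (* Test functions must live in P, so boxes are first intersected with it. *)
  have [a' [b' eab]] : exists a' b', open_box a b `&` P = open_box a' b'.
    by apply: open_box_setI; [exists a, b|exists al, be].
  have -> : (\int[mu]_(x in open_box a b) (g x)%:E = \int[mu]_(x in open_box a' b') (g x)%:E)%E.
    rewrite -eab [LHS]integral_mkcond [RHS]integral_mkcond; apply: eq_integral => x _.
    rewrite !patchE in_setI; case: (x \in open_box a b) => //=.
    by case: ifPn => //; rewrite notin_setE => /gP ->.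
  have P' k x : bump a' b' k x != 0 -> P x by move=> /bump_box; rewrite -eab => -[].
  have cv := bump_integral_cvg (al := a') (be := b') ig.
  apply/esym/(cvg_unique _ _ cv); first exact: ereal_hausdorff.
  rewrite (_ : (fun k => _) = cst 0%E); first exact: cvg_cst.
  apply/funext => k /=.
  have nb := bump_nice a' b' k.
  have := test _ (bump_smooth a' b' k) nb (P' k).
  move/eqP; rewrite -subr_eq0 -RintegralZl//; last exact: nice_integrable.
  rewrite -RintegralB//; last 2 first.
  - exact: ihphi (P' k).
  - by apply: integrable_EFinZ => //; exact: nice_integrable.
  move=> /eqP e.
  have ifin : mu.-integrable setT (EFin \o (fun x => h x * bump a' b' k x - c * bump a' b' k x)).
    apply: integrable_EFinB => //; first exact: ihphi (P' k).
    by apply: integrable_EFinZ => //; exact: nice_integrable.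
  transitivity (\int[mu]_x (h x * bump a' b' k x - c * bump a' b' k x)%:E)%E.
    apply: eq_integral => x _; congr EFin; rewrite /g mulrBl Hphi; last exact: P'.
    have [->|/P' px] := eqVneq (bump a' b' k x) 0; first by rewrite !mulr0.
    by rewrite indicE mem_set// mulr1.
  by rewrite -[LHS]fineK ?integrable_fin_num// -/(Rintegral _ _ _) e.
apply: filterS => x gx Px; move: gx; rewrite /g /H indicE mem_set// !mulr1.
by move/eqP; rewrite subr_eq0 => /eqP.
Qed.

End du_bois_reymond.

End bumps.

(** * Calderon-Zygmund operators on cutoffs *)

Lemma le_mu_ae d (T : measurableType d) (R : realType) (nu : {measure set T -> \bar R}) (A B : set T) :
  measurable A -> measurable B -> {ae nu, forall x, A x -> B x} -> (nu A <= nu B)%E.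
Proof.
move=> mA mB [N [mN N0 sN]].
apply: (@le_trans _ _ (nu (B `|` N))).
  apply: le_mu => //; first exact: measurableU.
  move=> x Ax; have [Bx|nB] := pselect (B x); [by left|right].
  by apply: sN => /= /(_ Ax).
by rewrite measureU0.
Qed.

Lemma int_le_ball (R : realType) n (f : 'rV[R]_n -> R) (a : 'rV[R]_n) (r : R) : 0 < r ->
  measurable_fun setT f -> (forall x, `|f x| <= 1) -> (forall x, r <= `|a - x| -> f x = 0) ->
  (\int[lebesgue_rV R n]_x `|f x|%:E <= ((2 * r) ^+ n)%:E)%E.
Proof.
move=> r0 mf f1 fr; rewrite -(lebesgue_ball a r0).
have mB := measurable_ball_rV a r.
have -> : lebesgue_rV R n (ball a r) = (\int[lebesgue_rV R n]_x (\1_(ball a r) x)%:E)%E.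
  by rewrite integral_indic// setIT.
apply: ge0_le_integral => //.
- by apply/measurable_EFinP; exact: measurableT_comp.
- by apply/measurable_EFinP; exact: measurable_indic.
- move=> x _; rewrite lee_fin indicE ball_rVE; case: (boolP (x \in _)) => // h.
  by move: h; rewrite notin_setE/= => /negP; rewrite -leNgt => /fr ->; rewrite normr0.
Qed.

Section CZ_bmo.
Variables (R : realType) (n : nat) (T : ('rV[R]_n -> R) -> 'rV[R]_n -> R).
Variables (K : 'rV[R]_n -> 'rV[R]_n -> R) (w : R -> R) (A W : R).
Local Notation Rn := 'rV[R]_n.
Local Notation mu := (lebesgue_rV R n).
Hypotheses (n0 : (0 < n)%N) (H : CZ_data T K w A W).
Local Notation L := (Lam R n).

Let lT : linear_on_L1 T. Proof. by case: H. Qed.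
Let A0 : 0 <= A. Proof. by case: H => _ _ _ _ []. Qed.
Let W0 : 0 <= W. Proof. by case: H => _ _ _ _ []. Qed.

Lemma Lam_ge8 : 8 <= L.
Proof. by rewrite /Lam ler_peMr// ler1n. Qed.

Lemma Lam_gt0 : 0 < L.
Proof. exact: lt_le_trans Lam_ge8. Qed.

Lemma CZ_measurable f : nice f -> measurable_fun setT (T f).
Proof. by case: H => _ _ _ _ [_ h _ _] /nice_Lfun /h []. Qed.

Lemma CZ_weak f l : nice f -> 0 < l ->
  (l%:E * mu [set x | (l < `|T f x|)%R] <= A%:E * \int[mu]_x `|f x|%:E)%E.
Proof. by case: H => _ _ _ _ [_ h _ _] /nice_Lfun /h [_]; apply. Qed.

Lemma CZ_add f g : nice f -> nice g ->
  {ae mu, forall x, T (fun z => f z + g z) x = T f x + T g x}.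
Proof.
move=> nf ng; have := lT 1 1 (nice_Lfun nf) (nice_Lfun ng).
rewrite (_ : (fun z => 1 * f z + 1 * g z) = (fun z => f z + g z)); last first.
  by apply/funext => z; rewrite !mul1r.
by apply: filterS => x; rewrite !mul1r.
Qed.

Lemma CZ_scale c f : nice f -> {ae mu, forall x, T (fun z => c * f z) x = c * T f x}.
Proof.
move=> nf; have := lT c 0 (nice_Lfun nf) (nice_Lfun nf).
rewrite (_ : (fun z => c * f z + 0 * f z) = (fun z => c * f z)); last first.
  by apply/funext => z; rewrite mul0r addr0.
by apply: filterS => x; rewrite mul0r addr0.
Qed.

Lemma measurable_bad f l (c : R) : nice f -> measurable [set x | l < `|T f x - c|].
Proof.
move=> nf; rewrite -[X in measurable X]setTI; apply: measurable_fun_ltr => //.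
by apply: measurableT_comp => //; apply: measurable_funB => //; exact: CZ_measurable.
Qed.

Lemma weak_ball f (a : Rn) r l : 0 < r -> nice f -> (forall x, `|f x| <= 1) ->
  (forall x, r <= `|a - x| -> f x = 0) -> 0 < l ->
  (l%:E * mu [set x | (l < `|T f x|)%R] <= (A * (2 * r) ^+ n)%:E)%E.
Proof.
move=> r0 nf f1 fr l0; apply: le_trans (CZ_weak nf l0) _.
rewrite EFinM; apply: lee_wpmul2l; first by rewrite lee_fin.
by apply: (int_le_ball (a := a)) => //; case: nf.
Qed.

(* Chebyshev level for the local part of T eta, plus the oscillation of the far part. *)
Definition js_level : R := A * (2 * L) ^+ n * (4 * 2 ^+ n) + 1 + 8 ^+ n * W.

Lemma js_level_gt0 : 0 < js_level.
Proof.
have L0 := Lam_gt0.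
by rewrite ltr_wpDr ?ltr_wpDl// ?mulr_ge0 ?exprn_ge0 ?mulr_ge0 ?exprn_ge0// ltW.
Qed.

Lemma CZ_mean_oscillation eta (s : R) : 0 < s -> nice eta -> (forall x, `|eta x| <= 1) ->
  exists a : 'rV[int]_n -> R, forall m,
    (\int[mu]_(x in cell s m) `|T eta x - a m|%:E <= (6 * js_level * s ^+ n)%:E)%E.
Proof.
move=> s0 ne e1; have L0 := Lam_gt0.
pose e2 (sk : R) m (y : Rn) := eta y - \1_(ball (corner sk m : Rn) (L * sk)) y * eta y.
(* On the cell, [T (e2 sk m)] is given by the kernel at every point and not just almost everywhere,
   so its value at the corner is meaningful; it serves as the constant of the cell. *)
pose a k m := T (e2 (dyadic s k) m) (corner (dyadic s k) m).
exists (a 0%N) => m; rewrite -[s in cell s]dyadic0 -[s in s ^+ n]dyadic0.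
apply: (@john_stromberg _ _ s (T eta) a js_level s0 (CZ_measurable ne) js_level_gt0) => {m} k m /=.
set sk := dyadic s k; set p : Rn := corner sk m.
have sk0 : 0 < sk by exact: dyadic_gt0.
have Lsk : 0 < L * sk by rewrite mulr_gt0.
pose f1 (y : Rn) : R := \1_(ball p (L * sk)) y * eta y.
have nf1 : nice f1.
  by apply: niceM => //; [apply: measurable_indic; exact: measurable_ball_rV|exact: ex_bound_indic].
have nf2 : nice (e2 sk m) by apply: niceB.
have b1 x : `|f1 x| <= 1.
  by rewrite /f1 indicE; case: (_ \in _); rewrite ?mul1r ?mul0r ?normr0.
have b2 x : `|e2 sk m x| <= 1.
  by rewrite /e2 indicE; case: (_ \in _); rewrite ?mul1r ?mul0r ?subrr ?normr0 ?subr0.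
have z2 y : `|p - y| < L * sk -> e2 sk m y = 0.
  by move=> h; rewrite /e2 indicE mem_set ?mul1r ?subrr// ball_rVE.
have z1 y : L * sk <= `|p - y| -> f1 y = 0.
  by move=> h; rewrite /f1 indicE memNset ?mul0r// ball_rVE/=; apply/negP; rewrite -leNgt.
pose t := A * (2 * L) ^+ n * (4 * 2 ^+ n) + 1.
have t0 : 0 < t.
  by rewrite /t ltr_wpDl// ?mulr_ge0 ?exprn_ge0 ?mulr_ge0 ?exprn_ge0// ltW.
have mB : measurable [set x | t < `|T f1 x|].
  rewrite (_ : [set x | _] = [set x | t < `|T f1 x - 0|]); first exact: measurable_bad.
  by under [RHS]eq_set do rewrite subr0.
apply: (@le_trans _ _ (mu [set x | t < `|T f1 x|])).
  apply: le_mu_ae => //.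
    by apply: measurableI; [exact: measurable_cell|exact: measurable_bad].
  have := CZ_add nf1 nf2.
  rewrite (_ : (fun z => f1 z + e2 sk m z) = eta); last first.
    by apply/funext => z; rewrite /e2 /f1 addrC subrK.
  apply: filterS => x hx [cx /=]; rewrite hx.
  have := @CZ_osc _ _ _ _ _ _ _ n0 H (e2 sk m) p sk x p 1 sk0 (nice_Lfun nf2)
     (nice_supp nf2) z2 b2 (cell_sub_ball sk0 cx) (ballxx p sk0).
  rewrite mul1r => h1.
  have : `|T f1 x + T (e2 sk m) x - a k m| <= `|T f1 x| + `|T (e2 sk m) x - a k m|.
    by rewrite -addrA ler_normD.
  move: h1; rewrite /a -/sk -/p /js_level -/t; lra.
rewrite -(@lee_pmul2l _ t%:E) ?lte_fin//.
apply: le_trans (weak_ball Lsk nf1 b1 z1 t0) _.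
rewrite -EFinM lee_fin.
have e : A * (2 * (L * sk)) ^+ n = A * (2 * L) ^+ n * (4 * 2 ^+ n) * (sk ^+ n / (4 * 2 ^+ n)).
  rewrite mulrA exprMn; have : 2 ^+ n != 0 :> R by rewrite expf_neq0.
  by move: ((2 * L) ^+ n) (2 ^+ n) (sk ^+ n) => u v x h; field.
rewrite e ler_wpM2r ?divr_ge0 ?exprn_ge0 ?mulr_ge0 ?exprn_ge0 ?(ltW sk0)//.
  exact: ltW.
by rewrite /t lerDl.
Qed.

Lemma CZ_integrable_cell eta (s : R) m : 0 < s -> nice eta -> (forall x, `|eta x| <= 1) ->
  mu.-integrable (cell s m) (EFin \o T eta).
Proof.
move=> s0 ne e1; have [a ha] := CZ_mean_oscillation s0 ne e1.
have mC := measurable_cell (R := R) m s0.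
have mT := CZ_measurable ne.
have cfin (c : R) : mu.-integrable (cell s m) (EFin \o cst c).
  have cf : (mu (cell s m) < +oo)%E by rewrite lebesgue_cell// ltry.
  apply: measurable_bounded_integrable => //.
  by exists `|c|; split; [exact: num_real|move=> M cM x _ /=; exact: ltW].
have ih : mu.-integrable (cell s m) (EFin \o (fun x => T eta x - a m)).
  apply/integrableP; split.
    by apply/measurable_EFinP; apply: measurable_funTS; apply: measurable_funB.
  by apply: le_lt_trans (ha m) _; rewrite ltry.
have := integrable_EFinB mC ih (cfin (- a m)).
by congr (integrable _ _ _); apply/funext => x /=; rewrite opprK subrK.
Qed.

(* [cutoff_at a rho] is 1 on the cube of centre a and half-side rho, 0 off the
   concentric cube of half-side 2 rho. *)
Definition cutoff_at (a : Rn) (rho : R) : Rn -> R :=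
  prodf (fun i t => plateau (rho^-1 * t + - (rho^-1 * a ord0 i))).

Lemma cutoff_atE a rho (x : Rn) :
  cutoff_at a rho x = \prod_i plateau (rho^-1 * (x ord0 i - a ord0 i)).
Proof. by apply: eq_bigr => i _; congr plateau; ring. Qed.

Lemma cutoff_at_smooth a rho : is_smooth (cutoff_at a rho).
Proof. by apply: is_smooth_prodf => k i; apply: smooth1_affine; exact: smooth1_plateau. Qed.

Lemma cutoff_at_ge0 a rho x : 0 <= cutoff_at a rho x.
Proof. by apply: prodr_ge0 => i _; exact: plateau_ge0. Qed.

Lemma cutoff_at_le1 a rho x : cutoff_at a rho x <= 1.
Proof. by apply: prodr_ile1 => i _; rewrite plateau_ge0 plateau_le1. Qed.

Lemma cutoff_at1 a rho x : 0 < rho -> `|a - x| <= rho -> cutoff_at a rho x = 1.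
Proof.
move=> r0 /(norm_rV_le _ (ltW r0)) h; rewrite cutoff_atE; apply: big1 => i _.
apply: plateau1; rewrite normrM gtr0_norm ?invr_gt0// ler_pdivrMl// mulr1.
by rewrite distrC -rV_subE.
Qed.

Lemma cutoff_at0 a rho x : 0 < rho -> 2 * rho <= `|a - x| -> cutoff_at a rho x = 0.
Proof.
move=> r0 h; rewrite cutoff_atE.
have r20 : 0 < 2 * rho by rewrite mulr_gt0.
have [i hi] : exists i, 2 * rho <= `|(a - x) ord0 i|.
  apply: contrapT => /forallNP hn; move: h; apply/negP; rewrite -ltNge.
  by apply/(norm_rV_lt _ r20) => i; rewrite ltNge; apply/negP/hn.
rewrite (bigD1 i)//= plateau0 ?mul0r//.
by rewrite normrM gtr0_norm ?invr_gt0// ler_pdivlMl// mulrC distrC -rV_subE.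
Qed.

Lemma cutoff_at_norm a rho x : `|cutoff_at a rho x| <= 1.
Proof. by rewrite ger0_norm ?cutoff_at_ge0 ?cutoff_at_le1. Qed.

Lemma cutoff_at_nice a rho : 0 < rho -> nice (cutoff_at a rho).
Proof.
move=> r0; split.
- by apply: continuous_measurable_rV; apply: is_smooth_continuous; exact: cutoff_at_smooth.
- by exists 1; exact: cutoff_at_norm.
- exists (`|a| + 2 * rho); first by rewrite ltr_wpDl// mulr_gt0.
  move=> x hx; apply: cutoff_at0 => //.
  have : `|x| <= `|a| + `|a - x| by rewrite -{1}(subKr a x) ler_normB.
  lra.
Qed.

Lemma cell_open_box (s : R) m : 0 < s -> {ae mu, forall x, cell s m x ->
  open_box (corner s m) (corner s m + const_mx s) x}.
Proof.
move=> s0; have : {ae mu, forall x : Rn, forall i : 'I_n, x ord0 i <> corner s m ord0 i}.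
  apply: (@ae_countable R) => i.
  have := @hyperplane_null R n i (corner s m ord0 i).
  exists [set x : Rn | x ord0 i = corner s m ord0 i]; split => //.
    exact: measurable_hyperplane.
  by move=> x /= /contrapT.
apply: filterS => x hx; rewrite cell_box//= => h i; have := h i; rewrite in_itv/=.
rewrite !mxE => /andP[h1 h2]; rewrite h2 andbT lt_neqAle h1 andbT eq_sym.
by apply/eqP; have := hx i; rewrite mxE.
Qed.

Section pairing_zero.
(** This is T(1) = 0, asked only where [T eta * phi] is integrable: the reduction splits off the
    integral of [b * phi], and the splitting needs integrability. *)
Hypothesis P0 : forall phi eta, D0 phi -> nice phi -> cutoff phi eta -> nice eta ->
  mu.-integrable setT (EFin \o (fun x => T eta x * phi x)) -> T1_pairing T K eta phi = 0.

(** [T eta + G], with G the integral of (K x y - K a y) (1 - eta y), represents T(1) on the cell up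
    to a constant. It integrates to zero against test functions of integral zero, hence is constant,
    and G is bounded by [8 ^+ n * W]. *)
Lemma CZ_cutoff_oscillation (s : R) m : 0 < s ->
  exists c, {ae mu, forall x, cell s m x ->
    `|T (cutoff_at (corner s m) (2 * L * s)) x - c| <= 8 ^+ n * W}.
Proof.
move=> s0; set a : Rn := corner s m; have L0 := Lam_gt0; have L8 := Lam_ge8.
pose rho := 2 * L * s; have r0 : 0 < rho by rewrite /rho mulr_gt0// mulr_gt0.
pose eta := cutoff_at a rho.
have ne : nice eta by exact: cutoff_at_nice.
have me : measurable_fun setT eta by case: ne.
pose zeta y := 1 - eta y.
have mz : measurable_fun setT zeta by exact: measurable_funB.
have zM y : `|zeta y| <= 1.
  rewrite /zeta ger0_norm ?subr_ge0 ?cutoff_at_le1//.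
  by rewrite lerBlDr lerDl cutoff_at_ge0.
have Ls : L * s <= rho by rewrite /rho -mulrA ler_peMl// ?mulr_ge0 ?(ltW L0) ?(ltW s0)// ler1n.
have z0 y : `|a - y| < L * s -> zeta y = 0.
  by move=> h; rewrite /zeta /eta cutoff_at1 ?subrr//; apply: le_trans (ltW h) Ls.
pose G x := \int[mu]_y ((K x y - K a y) * zeta y).
have G1 x : ball a s x -> `|G x| <= 8 ^+ n * W.
  move=> ax; have [iG bG] := kernel_diff_integral n0 H s0 mz zM z0 ax.
  by rewrite -lee_fin; apply: le_trans (le_normr_EFin_Rintegral iG) _; rewrite mul1r in bG.
pose b : Rn := a + const_mx s.
have boxball x : open_box a b x -> ball a s x.
  move=> hx; rewrite ball_rVE/=; apply/norm_rV_lt => // i.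
  have := hx i; rewrite rV_subE /b !mxE => /andP[h1 h2].
  by rewrite distrC gtr0_norm; lra.
pose h x := T eta x + \1_(ball a s) x * G x.
have nb : nice (\1_(ball a s) : Rn -> R) by exact: nice_ball.
have bs0 x : s <= `|a - x| -> (\1_(ball a s) x : R) = 0.
  by move=> hx; rewrite indicE memNset// ball_rVE/=; apply/negP; rewrite -leNgt.
(* The indicator of the ball in the role of phi yields measurability and integrability of the
   localised G. *)
have [iG _ _] := CZ_far_Fubini n0 H s0 nb bs0 mz zM z0.
have mG : measurable_fun setT (fun x : Rn => \1_(ball a s) x * G x).
  by case/integrableP: iG => /measurable_EFinP.
have mT := CZ_measurable ne.
have mP := measurable_open_box a b.
have subP : open_box a b `<=` cell s m.
  move=> x hx; rewrite cell_box//= => i; rewrite in_itv/=; have := hx i.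
  by rewrite /b !mxE => /andP[/ltW -> ->].
have iT : mu.-integrable (open_box a b) (EFin \o T eta).
  apply: (integrableS _ mP subP); first exact: measurable_cell.
  by apply: CZ_integrable_cell => // x; exact: cutoff_at_norm.
have [|||| c hc] := @du_bois_reymond R n a b h.
- by move=> i; rewrite /b !mxE ltrDl.
- exact: measurable_funD.
- have -> : EFin \o h = (EFin \o T eta) \+ (EFin \o (fun x : Rn => \1_(ball a s) x * G x)) by apply/funext.
  by apply: integrableD => //; apply: integrableS iG.
- move=> phi sp np pp ip.
  have p0 x : s <= `|a - x| -> phi x = 0.
    move=> hx; apply/eqP/negPn/negP => /pp /boxball; rewrite ball_rVE/=.
    by rewrite ltNge hx.
  have [j1 j2 j3] := CZ_pairing_far n0 H s0 np p0 ip mz zM z0.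
  have iTp : mu.-integrable setT (EFin \o (fun x => T eta x * phi x)).
    have [mp [M hM] _] := np.
    have iTP : mu.-integrable setT ((EFin \o T eta) \_ (open_box a b)) by exact/(integrable_mkcond _ mP).
    apply: (@le_integrable _ _ _ _ _ measurableT _ (fun x => M%:E * ((EFin \o T eta) \_ (open_box a b)) x)%E).
    + by apply/measurable_EFinP; exact: measurable_funM.
    + move=> x _; rewrite patchE [(EFin \o _) x]/=; have [->|/pp px] := eqVneq (phi x) 0.
        by rewrite mulr0 abse_EFin normr0 abse_ge0.
      rewrite mem_set// -EFinM !abse_EFin lee_fin !normrM mulrC ler_wpM2r//.
      exact: le_trans (hM x) (ler_norm _).
    + exact: integrableZl.
  have cut : cutoff phi eta.
    split; [exact: cutoff_at_smooth|exact: nice_supp|].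
    move=> x sx; have : [set x : Rn | `|a - x| <= s] x.
      have out y : ~ [set x : Rn | `|a - x| <= s] y -> phi y = 0.
        by move=> /= /negP; rewrite -ltNge => hy; apply: p0; rewrite ltW.
      by move: x sx; apply: supp_subset_closed out; exact: closed_norm_le.
    move=> /= xs; apply/nbhs_ballP; exists s => //= y; rewrite ball_rVE/= => xy.
    apply: cutoff_at1 => //; apply: le_trans (ler_distD x _ _) _.
    have : 8 * s <= L * s by rewrite ler_pM2r.
    move: Ls; lra.
  have := P0 (And3 sp (nice_supp np) ip) np cut ne iTp.
  rewrite /T1_pairing -/zeta j3 => hp.
  rewrite -[RHS]hp -RintegralD//; apply: eq_Rintegral => x _.
  rewrite /h mulrDl; congr (_ + _); have [->|/pp /boxball px] := eqVneq (phi x) 0.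
    by rewrite mulr0 mul0r.
  by rewrite indicE mem_set// mul1r mulrC.
exists c; apply: filterS2 hc (cell_open_box m s0) => x h1 h2 cx.
have px := h2 cx; have := h1 px; have bx := boxball x px.
rewrite /h indicE mem_set// mul1r => <-.
by rewrite -/a -/rho -/eta opprD addrA subrr sub0r normrN; exact: G1.
Qed.

(** This is [t + 2 * D] of [CZ_indicator_bound]: T of the indicator is within D of c, and c is at
    most [t + D]. The [8 * L] comes from the support of the cutoff, a cube of side 8 L s. *)
Definition indicator_cst : R := A * (2 * L) ^+ n * 2 + 1 + 2 * (8 ^+ n * W + annulus_cst n w A * (8 * L) ^+ n).

Lemma indicator_cst_ge0 : 0 <= indicator_cst.
Proof.
have L0 := Lam_gt0.
by rewrite !addr_ge0// ?mulr_ge0 ?addr_ge0 ?mulr_ge0 ?exprn_ge0 ?mulr_ge0 ?(annulus_cst_ge0 n0 H)// ltW.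
Qed.

Lemma CZ_indicator_bound (s : R) m : 0 < s ->
  {ae mu, forall x, cell s m x -> `|T \1_(ball (corner s m : Rn) (L * s)) x| <= indicator_cst}.
Proof.
move=> s0; set a : Rn := corner s m; have L0 := Lam_gt0; have L8 := Lam_ge8.
have [c hc] := CZ_cutoff_oscillation m s0; rewrite -/a in hc.
pose rho := 2 * L * s; have r0 : 0 < rho by rewrite /rho mulr_gt0// mulr_gt0.
pose eta := cutoff_at a rho; rewrite -/rho -/eta in hc.
have ne : nice eta by exact: cutoff_at_nice.
have Ls0 : 0 < L * s by rewrite mulr_gt0.
have Ls : L * s <= rho by rewrite /rho -mulrA ler_peMl// ?(ltW Ls0)// ler1n.
pose B := ball a (L * s).
have nB : nice (\1_B : Rn -> R) by exact: nice_ball.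
pose g y := eta y - \1_B y.
have ng : nice g by exact: niceB.
have g1 y : `|g y| <= 1.
  have [h1 h2] := (cutoff_at_ge0 a rho y, cutoff_at_le1 a rho y).
  rewrite /g indicE; case: (_ \in _); rewrite ler_norml /eta /=; apply/andP; split; lra.
have g0 y : `|a - y| < L * s -> g y = 0.
  move=> h; rewrite /g indicE mem_set; last by rewrite /B ball_rVE.
  by rewrite /eta cutoff_at1 ?subrr//; apply: le_trans (ltW h) Ls.
have gfar y : 2 * rho <= `|a - y| -> g y = 0.
  move=> h; rewrite /g /eta cutoff_at0// indicE memNset ?subrr// /B ball_rVE/=.
  apply/negP; rewrite -leNgt; apply: le_trans h; apply: le_trans Ls _.
  by rewrite ler_peMl ?ler1n// ltW.
have r20 : 0 < 2 * rho by rewrite mulr_gt0.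
have Tg x : ball a s x -> `|T g x| <= annulus_cst n w A * (8 * L) ^+ n.
  move=> ax; have := CZ_annulus n0 H s0 (nice_Lfun ng) (nice_supp ng) g0 ax.
  have mg : measurable_fun setT g by case: ng.
  have := int_le_ball r20 mg g1 gfar.
  have c0 : (0 <= (annulus_cst n w A / s ^+ n)%:E)%E.
    by rewrite lee_fin divr_ge0 ?(annulus_cst_ge0 n0 H)// exprn_ge0// ltW.
  move=> /(lee_wpmul2l c0) h1 h2; have := le_trans h2 h1.
  rewrite -EFinM lee_fin; congr (_ <= _).
  have -> : 2 * (2 * rho) = 8 * L * s by rewrite /rho; ring.
  rewrite (exprMn _ (8 * L) s); have : s ^+ n != 0 by rewrite gt_eqF// exprn_gt0.
  by move: (s ^+ n) ((8 * L) ^+ n) => u v h; field.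
pose D := 8 ^+ n * W + annulus_cst n w A * (8 * L) ^+ n.
have hB : {ae mu, forall x, cell s m x -> `|T \1_B x - c| <= D}.
  have := CZ_add nB ng.
  rewrite (_ : (fun z => \1_B z + g z) = eta); last first.
    by apply/funext => z; rewrite /g addrC subrK.
  apply: filterS2 hc => x h1 h2 cx; have := h1 cx; have := Tg x (cell_sub_ball s0 cx).
  rewrite h2 /D => h3 h4.
  have -> : T \1_B x - c = (T \1_B x + T g x - c) - T g x by ring.
  by apply: le_trans (ler_normB _ _) _; lra.
pose t := A * (2 * L) ^+ n * 2 + 1.
have t0 : 0 < t by rewrite ltr_wpDl// ?mulr_ge0 ?exprn_ge0 ?mulr_ge0// ltW.
have b1 x : `|\1_B x : R| <= 1 by rewrite indicE; case: (_ \in _); rewrite ?normr1 ?normr0.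
have b0 x : L * s <= `|a - x| -> (\1_B x : R) = 0.
  by move=> hx; rewrite indicE memNset// /B ball_rVE/=; apply/negP; rewrite -leNgt.
(* For a larger c, T of the indicator would exceed t almost everywhere on the cell, which the weak
   type excludes because t is larger than [A * (2 * L) ^+ n]. *)
have ct : `|c| <= t + D.
  rewrite leNgt; apply/negP => hct.
  have : (mu (cell s m) <= mu [set x | (t < `|T \1_B x|)%R])%E.
    apply: le_mu_ae; first exact: measurable_cell.
      rewrite (_ : [set x | _] = [set x | t < `|T \1_B x - 0|]); first exact: measurable_bad.
      by under [RHS]eq_set do rewrite subr0.
    apply: filterS hB => x h cx /=; have := h cx.
    have : `|c| <= `|T \1_B x| + `|T \1_B x - c|.
      by rewrite -{1}(subKr (T \1_B x) c) ler_normB.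
    lra.
  rewrite lebesgue_cell// => h.
  have := weak_ball Ls0 nB b1 b0 t0.
  have tt : (0 <= t%:E)%E by rewrite lee_fin ltW.
  move=> /(le_trans (lee_wpmul2l tt h)); rewrite -EFinM lee_fin.
  rewrite (mulrA 2) (exprMn _ (2 * L)) mulrA ler_pM2r ?exprn_gt0// /t.
  have : 0 <= A * (2 * L) ^+ n by rewrite mulr_ge0 ?exprn_ge0 ?mulr_ge0// ltW.
  lra.
apply: filterS hB => x h cx; have := h cx => h1.
have : `|T \1_B x| <= `|T \1_B x - c| + `|c| by rewrite -{1}(subrK c (T \1_B x)) ler_normD.
rewrite /indicator_cst -/t -/D; move: ct h1; rewrite /t /D; lra.
Qed.

End pairing_zero.

End CZ_bmo.

(** * Riesz potentials and chains of cubes *)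

Section C1c.
Variables (R : realType) (n : nat).
Local Notation Rn := 'rV[R]_n.
Local Notation mu := (lebesgue_rV R n).

Lemma supp_neq0 (f : Rn -> R) x : f x != 0 -> supp f x.
Proof. by move=> fx; apply: subset_closure. Qed.

Lemma continuous_compact_nice (f : Rn -> R) : continuous f -> compactly_supported f -> nice f.
Proof.
move=> cf kf; split; first exact: continuous_measurable_rV.
  have /compact_bounded[M [_ hM]] : compact (f @` supp f).
    by apply: continuous_compact kf; exact: continuous_subspaceT.
  exists (`|M| + 1) => x; have [->|fx] := eqVneq (f x) 0.
    by rewrite normr0 addr_ge0.
  by apply: hM; [rewrite ltr_pwDr// ler_norm|exists x => //; exact: supp_neq0].
have [M [_ hM]] := compact_bounded kf.
exists (`|M| + 2); first by rewrite ltr_wpDl.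
move=> x; apply: contraTeq => /supp_neq0 /(hM (`|M| + 1)) h; rewrite -ltNge.
have : `|x| <= `|M| + 1 by apply: h; rewrite ltr_pwDr// ler_norm.
lra.
Qed.

Lemma partial_supp (f : Rn -> R) i : supp (partial i f) `<=` supp f.
Proof.
apply: supp_subset_closed; first exact: closed_closure.
move=> x hx; have ox : nbhs x (~` supp f).
  by apply: open_nbhs_nbhs; split => //; apply: closed_openC; exact: closed_closure.
rewrite /partial (@near_eq_derive _ _ _ f (cst 0))//; first exact: derive_cst.
by apply: filterS ox => y hy; apply/eqP/negPn/negP => /supp_neq0.
Qed.

Lemma C1c_nice (f : Rn -> R) : is_Ck 1 f -> compactly_supported f -> nice f.
Proof. by move=> [cf _]; exact: continuous_compact_nice. Qed.

Lemma partial_nice (f : Rn -> R) i : is_Ck 1 f -> compactly_supported f -> nice (partial i f).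
Proof.
move=> [cf hf] kf; have [_ [cp _]] := hf i; apply: continuous_compact_nice => //.
by apply: subclosed_compact kf _; [exact: closed_closure|exact: partial_supp].
Qed.

Lemma partial_le_grad (f : Rn -> R) i x : `|partial i f x| <= enorm (gradient f x).
Proof.
apply: le_trans (le_norm_enorm _); apply: le_trans (coord_le_norm _ i).
by rewrite mxE.
Qed.

Lemma measurable_enorm : measurable_fun setT (@enorm R n).
Proof.
apply: measurableT_comp.
  by apply: continuous_measurable_fun; exact: sqrt_continuous.
apply: measurable_sum => i; apply: measurable_funX; exact: measurable_rV_coord.
Qed.

Lemma measurable_riesz_kernel (x : Rn) p :
  measurable_fun setT (fun y : Rn => (enorm (x - y) ^+ p)^-1).
Proof.
rewrite (_ : (fun y => _) = (fun y : Rn => powR (enorm (x - y) ^+ p) (-1))).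
  apply: (measurableT_comp (measurable_powR _)); apply: measurable_funX.
  apply: measurableT_comp; first exact: measurable_enorm.
  by apply: measurable_fun_rV => i; under eq_fun do rewrite rV_subE;
     apply: measurable_funB => //; exact: measurable_rV_coord.
by apply/funext => y; rewrite powR_inv1// exprn_ge0// enorm_ge0.
Qed.

Lemma grad_nice (f : Rn -> R) : is_Ck 1 f -> compactly_supported f ->
  nice (fun x => enorm (gradient f x)).
Proof.
move=> hf kf; have np i := partial_nice i hf kf; split.
- apply: measurableT_comp; first exact: measurable_enorm.
  by apply: measurable_fun_rV => i; under eq_fun do rewrite mxE; case: (np i).
- have /choice[M hM] : forall i, exists M : R, forall x, `|partial i f x| <= M.
    by move=> i; case: (np i).
  exists (n%:R * \sum_i `|M i|) => x; rewrite ger0_norm ?enorm_ge0//.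
  apply: le_trans (enorm_le_norm _) _; rewrite ler_wpM2l//.
  apply/norm_rV_le; first by rewrite sumr_ge0.
  move=> i; rewrite mxE; apply: le_trans (hM i x) _; apply: le_trans (ler_norm _) _.
  by rewrite (bigD1 i)//= lerDl sumr_ge0.
- have /choice[r hr] : forall i, exists r : R, 0 < r /\ forall x, r <= `|x| -> partial i f x = 0.
    by move=> i; have [_ _ [r r0 h]] := np i; exists r.
  exists (1 + \sum_i `|r i|); first by rewrite ltr_pwDl// sumr_ge0.
  move=> x hx; have -> : gradient f x = 0.
    apply/rowP => i; rewrite !mxE; apply: (hr i).2; apply: le_trans hx.
    rewrite (bigD1 i)//=; have : 0 <= \sum_(j | j != i) `|r j| by rewrite sumr_ge0.
    by have := ler_norm (r i); lra.
  apply/eqP; rewrite eq_le enorm_ge0 andbT; apply: le_trans (enorm_le_norm _) _.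
  by rewrite normr0 mulr0.
Qed.

End C1c.

Section riesz_sum.
Variables (R : realType) (n : nat).
Local Notation Rn := 'rV[R]_n.
Local Notation mu := (lebesgue_rV R n).
Local Notation L := (Lam R n).
Hypothesis hn : (2 <= n)%N.
Variable g : Rn -> R.
Hypotheses (ng : nice g) (g0 : forall x, 0 <= g x).

Let n0 : (0 < n)%N. Proof. exact: leq_trans hn. Qed.

(** Up to a constant this is s times the mean of g, the natural bound for the oscillation of f at
    scale s. *)
Definition avg (s : R) (m : 'rV[int]_n) : R :=
  (s ^+ n.-1)^-1 * \int[mu]_(y in ball (corner s m : Rn) (L * s)) g y.

(** For n >= 2 the terms at least double with k, so the sum is at most twice its last nonzero term,
    taken at a scale still comparable with t. *)
Lemma geometric_shells (s0 t : R) N : 0 < s0 -> 0 < t ->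
  \sum_(k < N) (if t < 2 * L * dyadic s0 k then (dyadic s0 k ^+ n.-1)^-1 else 0) <=
  2 * ((2 * L) / t) ^+ n.-1.
Proof.
move=> s00 t0; have L0 := Lam_gt0 R n0.
pose u k := (dyadic s0 k ^+ n.-1)^-1.
have u0 k : 0 < u k by rewrite invr_gt0 exprn_gt0// dyadic_gt0.
have uS k : 2 * u k <= u k.+1.
  have -> : u k.+1 = 2 ^+ n.-1 * u k by rewrite /u dyadicS expr_div_n invf_div.
  rewrite ler_pM2r//.
  by rewrite -[leLHS]expr1 ler_weXn2l ?ler1n// -ltnS prednK.
have su K : \sum_(k < K) u k <= u K.
  elim: K => [|K IH]; first by rewrite big_ord0 ltW.
  by rewrite big_ord_recr/=; apply: le_trans (uS K); lra.
have uM k : t < 2 * L * dyadic s0 k -> u k <= ((2 * L) / t) ^+ n.-1.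
  move=> h; rewrite /u -exprVn; apply: lerXn2r; rewrite ?nnegrE ?invr_ge0 ?divr_ge0 ?mulr_ge0 ?(ltW L0) ?(ltW t0) ?(ltW (dyadic_gt0 _ s00))//.
    exact: ltW.
  by rewrite -[leLHS]mul1r ler_pdivrMr ?dyadic_gt0// mulrAC ler_pdivlMr// mul1r ltW.
elim: N => [|N IH].
  by rewrite big_ord0 mulr_ge0 ?exprn_ge0 ?divr_ge0 ?mulr_ge0// ltW.
rewrite big_ord_recr/=; case: ifPn => h; last by rewrite addr0.
have : \sum_(k < N) (if t < 2 * L * dyadic s0 k then u k else 0) <= \sum_(k < N) u k.
  by apply: ler_sum => k _; case: ifP => // _; exact: ltW.
have := su N; have := uM N h; rewrite -/(u N); lra.
Qed.

Lemma avg_ge0 s m : 0 < s -> 0 <= avg s m.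
Proof.
move=> s0; rewrite mulr_ge0 ?invr_ge0 ?exprn_ge0 ?(ltW s0)//.
by apply: Rintegral_ge0.
Qed.

Lemma avg_sum_le_riesz (s0 : R) (x : Rn) N : 0 < s0 ->
  ((\sum_(k < N) avg (dyadic s0 k) (cell_index (dyadic s0 k) x))%:E <=
   (2 * (2 * L * n%:R) ^+ n.-1)%:E * riesz_potential1 g x)%E.
Proof.
move=> s00; have L0 := Lam_gt0 R n0; have L8 := Lam_ge8 R n0.
have nn : 0 < n%:R :> R by rewrite ltr0n.
have mg : measurable_fun setT g by case: ng.
pose c k := (dyadic s0 k ^+ n.-1)^-1.
have c0 k : 0 <= c k by rewrite invr_ge0 exprn_ge0// ltW// dyadic_gt0.
pose B k : set Rn := ball (corner (dyadic s0 k) (cell_index (dyadic s0 k) x) : Rn) (L * dyadic s0 k).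
have mB k : measurable (B k) by exact: measurable_ball_rV.
have ek k : (avg (dyadic s0 k) (cell_index (dyadic s0 k) x))%:E =
    (\int[mu]_y (c k * (\1_(B k) y * g y))%:E)%E.
  rewrite /avg EFinM /Rintegral fineK; last first.
    apply: integrable_fin_num => //; first exact: mB.
    by apply: integrableS (nice_integrable ng) => //; exact: mB.
  under [RHS]eq_integral do rewrite EFinM.
  rewrite ge0_integralZl//; last 3 first.
  - apply/measurable_EFinP; apply: measurable_funM => //; exact: measurable_indic.
  - by move=> y _; rewrite lee_fin mulr_ge0.
  - by rewrite lee_fin.
  congr (_ * _)%E; rewrite integral_mkcond; apply: eq_integral => y _.
  by rewrite patchE indicE /B; case: (y \in _); rewrite ?mul1r ?mul0r.
have -> : (\sum_(k < N) avg (dyadic s0 k) (cell_index (dyadic s0 k) x))%:E =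
    (\sum_(k < N) \int[mu]_y (c k * (\1_(B k) y * g y))%:E)%E.
  by rewrite -sumEFin; apply: eq_bigr => k _; exact: ek.
rewrite -ge0_integral_sum//; last 2 first.
- by move=> k; apply/measurable_EFinP; apply: measurable_funM => //; apply: measurable_funM.
- by move=> k y _; rewrite lee_fin !mulr_ge0.
have C70 : 0 <= 2 * (2 * L * n%:R) ^+ n.-1 by rewrite mulr_ge0 ?exprn_ge0 ?mulr_ge0// ltW.
have minv : measurable_fun setT (fun y : Rn => g y / enorm (x - y) ^+ n.-1).
  by apply: measurable_funM => //; exact: measurable_riesz_kernel.
rewrite /riesz_potential1 -ge0_integralZl//; last 2 first.
- exact/measurable_EFinP.
- by move=> y _; rewrite lee_fin divr_ge0// exprn_ge0// enorm_ge0.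
apply: ae_ge0_le_integral => //.
- by move=> y _; apply: sume_ge0 => k _; rewrite lee_fin !mulr_ge0.
- apply: emeasurable_sum => k; apply/measurable_EFinP; apply: measurable_funM => //.
  by apply: measurable_funM => //; exact: measurable_indic.
- by move=> y _; rewrite -EFinM lee_fin mulr_ge0// divr_ge0// exprn_ge0// enorm_ge0.
- by apply: measurable_funeM; exact/measurable_EFinP.
(* At y = x the quotient in the potential has the default value 0 and the comparison may fail, but a
   point is null. *)
have [N0 [mN0 N00 sN0]] := point_null x n0.
exists N0; split => // y /= hy; apply: sN0 => /=; apply/eqP/negPn/negP => xy; apply: hy => _.
pose t := `|x - y|.
have t0 : 0 < t by rewrite /t normr_gt0 subr_eq0 eq_sym.
rewrite sumEFin -EFinM lee_fin.
apply: (@le_trans _ _ ((\sum_(k < N) (if t < 2 * L * dyadic s0 k then c k else 0)) * g y)).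
  rewrite mulr_suml; apply: ler_sum => k _; rewrite mulrA ler_wpM2r//.
  rewrite indicE; case: (boolP (y \in B k)) => [|_]; last by rewrite mulr0; case: ifP.
  rewrite inE /B ball_rVE/= mulr1 => h; rewrite ifT//.
  have sk := dyadic_gt0 k s00.
  have := dist_corner x sk; rewrite distrC => h2.
  have : t <= `|x - corner (dyadic s0 k) (cell_index (dyadic s0 k) x)| +
    `|corner (dyadic s0 k) (cell_index (dyadic s0 k) x) - y| by exact: ler_distD.
  have : 8 * dyadic s0 k <= L * dyadic s0 k by rewrite ler_pM2r.
  lra.
apply: (@le_trans _ _ (2 * (2 * L / t) ^+ n.-1 * g y)).
  by rewrite ler_wpM2r//; exact: geometric_shells.
have e0 : 0 < enorm (x - y) by exact: lt_le_trans t0 (le_norm_enorm _).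
have key : (2 * L / t) ^+ n.-1 <= (2 * L * n%:R) ^+ n.-1 / enorm (x - y) ^+ n.-1.
  rewrite -expr_div_n; apply: lerXn2r; rewrite ?nnegrE ?divr_ge0 ?mulr_ge0 ?(ltW L0) ?(ltW t0) ?(ltW e0)//.
  have L20 : 0 <= 2 * L by rewrite mulr_ge0// ltW.
  rewrite ler_pdivrMr// mulrAC ler_pdivlMr//.
  rewrite -[leRHS]mulrA; exact: ler_wpM2l L20 _ _ (enorm_le_norm (x - y)).
have -> : 2 * (2 * L * n%:R) ^+ n.-1 * (g y / enorm (x - y) ^+ n.-1) =
    2 * ((2 * L * n%:R) ^+ n.-1 / enorm (x - y) ^+ n.-1 * g y) by ring.
rewrite -mulrA ler_pM2l//; exact: ler_wpM2r (g0 y) _ _ key.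
Qed.

End riesz_sum.

Section poincare_cell.
Variables (R : realType) (n : nat).
Local Notation Rn := 'rV[R]_n.
Local Notation mu := (lebesgue_rV R n).
Local Notation L := (Lam R n).
Hypothesis n0 : (0 < n)%N.
Variable f : Rn -> R.
Hypotheses (hf : is_Ck 1 f) (kf : compactly_supported f).
Local Notation g := (fun x => enorm (gradient f x)).

(** The points are chosen once for all cells, so that a cell carries the same constant as a child
    and as a parent. *)
Lemma poincare_cells : exists y : R -> 'rV[int]_n -> Rn, forall s m, 0 < s ->
  ball (corner s m : Rn) (L * s) (y s m) /\
  (\int[mu]_(x in ball (corner s m : Rn) (L * s)) `|f x - f (y s m)|%:E <=
   (2 * n%:R * L * s ^+ n * avg g s m)%:E)%E.
Proof.
have L0 := Lam_gt0 R n0.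
have ex (p : R * 'rV[int]_n) : exists y : Rn, 0 < p.1 ->
   ball (corner p.1 p.2 : Rn) (L * p.1) y /\
   (\int[mu]_(x in ball (corner p.1 p.2 : Rn) (L * p.1)) `|f x - f y|%:E <=
   (2 * n%:R * L * p.1 ^+ n * avg g p.1 p.2)%:E)%E.
  case: p => s m /=; have [s0|] := ltP 0 s; last by exists 0.
  have Ls : 0 < L * s by rewrite mulr_gt0.
  set B := ball _ _; have mB : measurable B by exact: measurable_ball_rV.
  have [y By hy] := poincare (corner s m) Ls hf.
  exists y => _; split => //; apply: le_trans hy _.
  have ng := grad_nice hf kf.
  have ig : mu.-integrable B (EFin \o g) by apply: integrableS (nice_integrable ng).
  have [M eM] : exists M : R, (\int[mu]_(x in B) (g x)%:E = M%:E)%E.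
    by exists (fine (\int[mu]_(x in B) (g x)%:E)%E); rewrite fineK//; exact: integrable_fin_num.
  have eavg : avg g s m = (s ^+ n.-1)^-1 * M by rewrite /avg /Rintegral eM.
  apply: (@le_trans _ _ ((2 * (L * s))%:E * \sum_(i < n) M%:E)%E).
    apply: lee_wpmul2l; first by rewrite lee_fin mulr_ge0// ltW.
    apply: lee_sum => i _; rewrite -eM; apply: ge0_le_integral => //.
    - apply/measurable_EFinP; apply: measurable_funTS; apply: measurableT_comp => //.
      by case: (partial_nice i hf kf).
    - by apply/measurable_EFinP; apply: measurable_funTS; case: ng.
    - by move=> x _; rewrite lee_fin partial_le_grad.
  rewrite sumEFin sumr_const card_ord -EFinM lee_fin eavg -mulr_natl.
  have -> : s ^+ n = s * s ^+ n.-1 by rewrite -exprS prednK.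
  have : s ^+ n.-1 != 0 by rewrite gt_eqF// exprn_gt0.
  by move: (s ^+ n.-1) => u u0; rewrite le_eqVlt; apply/orP; left; apply/eqP; field.
have [y hy] := choice ex.
by exists (fun s m => y (s, m)) => s m s0; exact: (hy (s, m) s0).
Qed.

End poincare_cell.

Lemma const_le_integral (R : realType) n (a : 'rV[R]_n) (r c I1 I2 : R) (h1 h2 : 'rV[R]_n -> R) :
  0 < r -> measurable_fun setT h1 -> measurable_fun setT h2 ->
  (forall x, `|c| <= `|h1 x| + `|h2 x|) ->
  (\int[lebesgue_rV R n]_(x in ball a r) `|h1 x|%:E <= I1%:E)%E ->
  (\int[lebesgue_rV R n]_(x in ball a r) `|h2 x|%:E <= I2%:E)%E ->
  `|c| * (2 * r) ^+ n <= I1 + I2.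
Proof.
move=> r0 m1 m2 hc i1 i2; have mB := measurable_ball_rV a r.
rewrite -lee_fin EFinM -(lebesgue_ball a r0).
have -> : (`|c|%:E * lebesgue_rV R n (ball a r) = \int[lebesgue_rV R n]_(x in ball a r) `|c|%:E)%E.
  by rewrite integral_cst.
rewrite EFinD; apply: le_trans (leeD i1 i2).
have mm (h : 'rV[R]_n -> R) : measurable_fun setT h -> measurable_fun (ball a r) (fun x => `|h x|%:E).
  by move=> mh; apply/measurable_EFinP; apply: measurable_funTS; exact: measurableT_comp.
rewrite -ge0_integralD//; [|exact: mm|exact: mm].
apply: ge0_le_integral => //.
- by apply: emeasurable_funD; exact: mm.
- by move=> x _; rewrite -EFinD lee_fin.
Qed.

Lemma telescope_step (R : realType) (p q r t v : R) :
  p <= q + t -> p + (r + v) <= q + (r + t + v).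
Proof. lra. Qed.

Lemma lt_of_excess (R : realType) (q : \bar R) (E e t u : R) : (0 <= q)%E ->
  (q + (E + e)%:E < t%:E)%E -> (t%:E <= u%:E + (q + E%:E))%E -> e < u.
Proof. by case: q => // q _; rewrite -!EFinD lte_fin lee_fin; lra. Qed.

Lemma norm_le_sub (R : realType) (x c b : R) : `|c| <= b -> `|x| <= `|x - c| + b.
Proof. by move=> h; rewrite -{1}(subrK c x) (le_trans (ler_normD _ _))// lerD2l. Qed.

Lemma norm_sub_le_sub (R : realType) (x c c' b : R) : `|c' - c| <= b -> `|x - c| <= `|x - c'| + b.
Proof. by move=> h; rewrite (le_trans (ler_distD c' _ _))// lerD2l. Qed.

Lemma series_le_step (R : realType) (S : \bar R) (p q r t b : R) : 0 <= p -> 0 <= q ->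
  (t%:E <= S)%E -> (b%:E <= S)%E -> (0 <= S)%E ->
  ((p * t + (q * b + r))%:E <= (p + q)%:E * S + r%:E)%E.
Proof.
move=> p0 q0 tS bS S0; rewrite !EFinD addeA leeD2r// ge0_muleDl ?lee_fin//.
by apply: leeD; rewrite EFinM; apply: lee_wpmul2l.
Qed.

Lemma dist_lt_scale (R : realType) (L s0 s u p q r d : R) : s = s0 * u ->
  p < L * s -> q < s -> r <= q + p -> u * ((L + 1) * s0) < d -> r < d.
Proof. by move=> e; rewrite (_ : u * _ = L * s + s); [lra|rewrite e; ring]. Qed.

Lemma ge0_affine_comb (R : realType) (I : \bar R) (p q r s b : R) : (0 <= I)%E ->
  0 <= p -> 0 <= r -> 0 <= b ->
  ((p%:E * I + q%:E) + b%:E * (r%:E * I + s%:E) = (p + b * r)%:E * I + (q + b * s)%:E)%E.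
Proof.
move=> I0 p0 r0 b0; rewrite muleDr// ?fin_num_adde_defl// addeACA muleA -!EFinM -EFinD.
by rewrite (EFinD p) ge0_muleDl ?lee_fin// mulr_ge0.
Qed.

(** * The chain of cubes shrinking to a point *)

Section chain.
Variables (R : realType) (n : nat) (T : ('rV[R]_n -> R) -> 'rV[R]_n -> R).
Variables (K : 'rV[R]_n -> 'rV[R]_n -> R) (w : R -> R) (A W : R).
Local Notation Rn := 'rV[R]_n.
Local Notation mu := (lebesgue_rV R n).
Local Notation L := (Lam R n).
Hypotheses (hn : (2 <= n)%N) (H : CZ_data T K w A W).
Hypothesis P0 : forall phi eta, D0 phi -> nice phi -> cutoff phi eta -> nice eta ->
  mu.-integrable setT (EFin \o (fun x => T eta x * phi x)) -> T1_pairing T K eta phi = 0.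

Let n0 : (0 < n)%N. Proof. exact: leq_trans hn. Qed.
Let A0 : 0 <= A. Proof. by case: H => _ _ _ _ []. Qed.
Let L0 : 0 < L. Proof. exact: Lam_gt0. Qed.
Let L8 : 8 <= L. Proof. exact: Lam_ge8. Qed.
Let nn : 0 < n%:R :> R. Proof. by rewrite ltr0n. Qed.

Variable f : Rn -> R.
Hypotheses (hf : is_Ck 1 f) (kf : compactly_supported f).
Local Notation g := (fun x => enorm (gradient f x)).
Let nf : nice f. Proof. exact: C1c_nice. Qed.
Let mf : measurable_fun setT f. Proof. by case: nf. Qed.
Let ng : nice g. Proof. exact: grad_nice. Qed.
Let g0 x : 0 <= g x. Proof. exact: enorm_ge0. Qed.

Let B (s : R) (m : 'rV[int]_n) : set Rn := ball (corner s m : Rn) (L * s).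
Let D1 : R := 2 * n%:R * L.
Let D10 : 0 <= D1. Proof. by rewrite !mulr_ge0// ltW. Qed.
Local Notation a := (avg g).

Variable y : R -> 'rV[int]_n -> Rn.
Hypothesis yB : forall s m, 0 < s -> B s m (y s m).
Hypothesis hy : forall s m, 0 < s ->
  (\int[mu]_(x in B s m) `|f x - f (y s m)|%:E <= (D1 * s ^+ n * a s m)%:E)%E.

Let c s m := f (y s m).
Let gg s m (x : Rn) : R := \1_(B s m) x * (f x - c s m).

Let a0 s m : 0 < s -> 0 <= a s m. Proof. exact: avg_ge0. Qed.

Let mB s m : measurable (B s m). Proof. exact: measurable_ball_rV. Qed.

Let mfc (k : R) : measurable_fun setT (fun x => f x - k). Proof. exact: measurable_funB. Qed.

Let Ls s : 0 < s -> 0 < L * s. Proof. by move=> s0; rewrite mulr_gt0. Qed.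

Lemma ball_child s m : 0 < s -> B (s / 2) m `<=` B s (parent_cell m).
Proof.
move=> s0 x; rewrite /B !ball_rVE/= => hx.
have s20 : 0 < s / 2 by rewrite divr_gt0.
pose p : Rn := corner (s / 2) m.
have pm : cell_index (s / 2) p = m.
  apply/rowP => i; rewrite !mxE mulrC mulKf ?gt_eqF//; exact: intrKfloor.
have := dist_corner p s0; rewrite (cell_index_half p s0) pm => h.
have : `|corner s (parent_cell m) - x| <= `|corner s (parent_cell m) - p| + `|p - x| by exact: ler_distD.
have : 8 * s <= L * s by rewrite ler_pM2r.
by move: hx; rewrite -/p mulrA => hx; lra.
Qed.

Lemma avg_child s m : 0 < s -> (s / 2) ^+ n * a (s / 2) m <= s ^+ n * a s (parent_cell m).
Proof.
move=> s0; have s20 : 0 < s / 2 by rewrite divr_gt0.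
have e (t : R) (I : R) : 0 < t -> t ^+ n * ((t ^+ n.-1)^-1 * I) = t * I.
  move=> t0; have -> : t ^+ n = t * t ^+ n.-1 by rewrite -exprS prednK.
  have : t ^+ n.-1 != 0 by rewrite gt_eqF// exprn_gt0.
  by move: (t ^+ n.-1) => u u0; field.
rewrite /avg (e _ _ s20) (e _ _ s0); apply: ler_pM.
- exact: ltW.
- by apply: Rintegral_ge0 => x _; exact: g0.
- by rewrite ler_pdivrMr// ler_peMr ?(ltW s0)// ler1n.
have ig D : measurable D -> mu.-integrable D (EFin \o g).
  by move=> mD; apply: integrableS (nice_integrable ng).
apply: fine_le.
- exact: (integrable_fin_num (mB _ _) (ig _ (mB (s / 2) m))).
- exact: (integrable_fin_num (mB _ _) (ig _ (mB s (parent_cell m)))).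
apply: ge0_subset_integral; [exact: mB|exact: mB| | |exact: ball_child].
- by apply/measurable_EFinP; apply: measurable_funTS; case: ng.
- by move=> x _; rewrite lee_fin.
Qed.

Lemma c_child s m : 0 < s -> `|c (s / 2) m - c s (parent_cell m)| <= 2 * D1 * a s (parent_cell m).
Proof.
move=> s0; have s20 : 0 < s / 2 by rewrite divr_gt0.
have as0 := a0 (parent_cell m) s0.
have := @const_le_integral R n (corner (s / 2) m) (L * (s / 2)) (c (s / 2) m - c s (parent_cell m))
  (D1 * s ^+ n * a s (parent_cell m)) (D1 * (s / 2) ^+ n * a (s / 2) m)
  (fun x => f x - c s (parent_cell m)) (fun x => f x - c (s / 2) m) (Ls s20) (mfc _) (mfc _).
have tri x : `|c (s / 2) m - c s (parent_cell m)| <= `|f x - c s (parent_cell m)| + `|f x - c (s / 2) m|.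
  by rewrite [leRHS]addrC (distrC (f x) (c (s / 2) m)); exact: ler_distD.
move=> /(_ tri) h.
have h1 : (\int[mu]_(x in B (s / 2) m) `|f x - c s (parent_cell m)|%:E <= (D1 * s ^+ n * a s (parent_cell m))%:E)%E.
  apply: le_trans (hy (parent_cell m) s0).
  apply: ge0_subset_integral; [exact: mB|exact: mB| | |exact: ball_child].
  - by apply/measurable_EFinP; apply: measurable_funTS; exact: measurableT_comp.
  - by move=> x _; rewrite lee_fin.
have {h} := h h1 (hy m s20).
have := avg_child m s0.
have -> : 2 * (L * (s / 2)) = L * s by field.
rewrite (exprMn _ L s).
have sn0 : 0 < s ^+ n by rewrite exprn_gt0.
have L1 : 1 <= L ^+ n by rewrite exprn_ege1//; apply: le_trans L8; rewrite ler1n.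
set X := `|_|; have X0 : 0 <= X by exact: normr_ge0.
move: (s ^+ n) sn0 ((s / 2) ^+ n) (a (s / 2) m) (a s (parent_cell m)) as0 => u u0 v a' a1 a10 h1' h2.
have h3 : X * u <= X * (L ^+ n * u).
  by rewrite ler_wpM2l// ler_peMl// ltW.
have h4 : D1 * v * a' <= D1 * (u * a1) by rewrite -mulrA ler_wpM2l.
have : X * u <= (2 * D1 * a1) * u by lra.
by rewrite ler_pM2r.
Qed.

Let ck s m k (x : Rn) : R := \1_(B s m) x * (f x - k).

Let nB s m : nice (\1_(B s m) : Rn -> R). Proof. exact: nice_ball. Qed.

Let nck s m k : nice (ck s m k).
Proof.
rewrite (_ : ck s m k = fun x => 1 * (\1_(B s m) x * f x) + - k * \1_(B s m) x).
  by apply: nice_lin => //; apply: niceM => //; exact: ex_bound_indic.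
by apply/funext => x; rewrite /ck; ring.
Qed.

Let inB s m x : `|(corner s m : Rn) - x| < L * s -> (\1_(B s m) x : R) = 1.
Proof. by move=> h; rewrite indicE mem_set// /B ball_rVE. Qed.

Let int_ck s m k (I : R) (u : Rn -> R) : measurable_fun setT u ->
  (forall x, `|u x| <= \1_(B s m) x * `|f x - k|) ->
  (\int[mu]_(x in B s m) `|f x - k|%:E <= I%:E)%E -> (\int[mu]_x `|u x|%:E <= I%:E)%E.
Proof.
move=> mu' hu; apply: le_trans.
have -> : (\int[mu]_x `|u x|%:E = \int[mu]_(x in B s m) `|u x|%:E)%E.
  rewrite [RHS]integral_mkcond; apply: eq_integral => x _; rewrite patchE.
  by case: ifPn => // hx; have := hu x; rewrite indicE (negbTE hx) mul0r normr_le0 => /eqP ->; rewrite normr0.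
apply: ge0_le_integral => //.
- by apply/measurable_EFinP; apply: measurable_funTS; exact: measurableT_comp.
- by apply/measurable_EFinP; apply: measurable_funTS; exact: measurableT_comp.
- by move=> x Bx; have := hu x; rewrite indicE mem_set// mul1r lee_fin.
Qed.

Let Can : R := annulus_cst n w A.
Let C3n : R := indicator_cst n w A W.
Let Can0 : 0 <= Can. Proof. exact: annulus_cst_ge0 n0 H. Qed.
Let C3n0 : 0 <= C3n. Proof. exact: indicator_cst_ge0 n0 H. Qed.

Definition child_cst : R := Can * 2 ^+ n * D1 + C3n * (2 * D1).

(** The two functions differ by u, which vanishes on the dilated child, so that [CZ_annulus] bounds
    T u on the child, and by a multiple of the indicator of the dilated child, whose coefficient is
    bounded by [c_child]. T(1) = 0 acts through the bound for T of that indicator. *)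
Lemma T_child s m : 0 < s -> {ae mu, forall x, cell (s / 2) m x ->
  `|T (gg s (parent_cell m)) x - T (gg (s / 2) m) x| <= child_cst * a s (parent_cell m)}.
Proof.
move=> s0; have s20 : 0 < s / 2 by rewrite divr_gt0.
set M := parent_cell m; pose k := c s M; pose k' := c (s / 2) m.
pose u x := ck s M k x - ck (s / 2) m k x.
have nu : nice u by exact: (niceB (nck s M k) (nck (s / 2) m k)).
have mu' : measurable_fun setT u by case: nu.
pose v x := (k' - k) * \1_(B (s / 2) m) x.
have nv : nice v.
  rewrite (_ : v = fun x => (k' - k) * \1_(B (s / 2) m) x + 0 * \1_(B (s / 2) m) x).
    exact: nice_lin.
  by apply/funext => x; rewrite mul0r addr0.
have sum1 : gg s M = fun x => gg (s / 2) m x + (u x + v x).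
  by apply/funext => x; rewrite /gg /u /v /ck -/k -/k'; ring.
have h1 := CZ_add H (nck (s / 2) m k') (niceD nu nv).
have h2 := CZ_add H nu nv.
have h3 := CZ_scale H (k' - k) (nB (s / 2) m).
have h4 := CZ_indicator_bound n0 H P0 m s20.
rewrite -[fun z => ck _ _ _ z + (u z + v z)]sum1 in h1.
have u0 x : `|(corner (s / 2) m : Rn) - x| < L * (s / 2) -> u x = 0.
  move=> hx; rewrite /u /ck (inB hx) indicE mem_set ?subrr//.
  by apply: ball_child => //; rewrite /B ball_rVE.
have Iu : (\int[mu]_x `|u x|%:E <= (D1 * s ^+ n * a s M)%:E)%E.
  apply: int_ck (hy M s0) => // x; rewrite /u /ck -mulrBl normrM ler_wpM2r//.
  rewrite !indicE; case: (boolP (x \in B (s / 2) m)) => [|_].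
    by rewrite inE => /(ball_child s0) hx; rewrite mem_set// subrr normr0.
  by rewrite subr0; case: (x \in _); rewrite ?normr1 ?normr0.
have Tu x : cell (s / 2) m x -> `|T u x| <= Can * 2 ^+ n * D1 * a s M.
  move=> cx; have ax := cell_sub_ball s20 cx.
  have := CZ_annulus n0 H s20 (nice_Lfun nu) (nice_supp nu) u0 ax.
  have cc0 : (0 <= (Can / (s / 2) ^+ n)%:E)%E.
    by rewrite lee_fin divr_ge0// exprn_ge0// ltW.
  move=> /le_trans /(_ (lee_wpmul2l cc0 Iu)); rewrite -EFinM lee_fin; congr (_ <= _).
  rewrite expr_div_n; have : s ^+ n != 0 by rewrite gt_eqF// exprn_gt0.
  have : 2 ^+ n != 0 :> R by rewrite gt_eqF// exprn_gt0.
  by move: (s ^+ n) (2 ^+ n) => p q h h'; field; rewrite h h'.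
apply: filterS2 (filterI h1 h2) (filterI h3 h4) => x [e1 e2] [e3 e4] cx.
rewrite e1 e2 (_ : T v x = (k' - k) * T \1_(B (s / 2) m) x); last exact: e3.
rewrite [_ + (_ + _)]addrC addrK; apply: le_trans (ler_normD _ _) _.
rewrite /child_cst [leRHS]mulrDl; apply: lerD; first exact: Tu.
have := e4 cx; rewrite -/(B (s / 2) m) -/C3n normrM => h5.
rewrite (_ : C3n * (2 * D1) * a s M = (2 * D1 * a s M) * C3n); last by ring.
apply: ler_pM => //; exact: c_child.
Qed.

Let F1 : R := fine (\int[mu]_x `|f x|%:E)%E.
Let hF1 : (\int[mu]_x `|f x|%:E = F1%:E)%E.
Proof. by rewrite /F1 fineK//; exact: nice_int_fin. Qed.
Let F10 : 0 <= F1.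
Proof. by apply: fine_ge0; apply: integral_ge0 => x _; rewrite lee_fin. Qed.

Lemma c_top s m : 0 < s -> `|c s m| <= D1 * a s m + F1 / s ^+ n.
Proof.
move=> s0; have as0 := a0 m s0.
have := @const_le_integral R n (corner s m) (L * s) (c s m)
  (D1 * s ^+ n * a s m) F1 (fun x => f x - c s m) f (Ls s0) (mfc _) mf.
have tri x : `|c s m| <= `|f x - c s m| + `|f x|.
  by rewrite addrC distrC -{1}(subrK (f x) (c s m)) addrC ler_normD.
move=> /(_ tri (hy m s0)) h.
have : (\int[mu]_(x in ball (corner s m : Rn) (L * s)) `|f x|%:E <= F1%:E)%E.
  rewrite -hF1; apply: ge0_subset_integral => //; first exact: mB.
  by apply/measurable_EFinP; exact: measurableT_comp.
move=> {}/h; rewrite (_ : 2 * (L * s) = (2 * L) * s); last by ring.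
rewrite (exprMn _ (2 * L) s).
have sn0 : 0 < s ^+ n by rewrite exprn_gt0.
have L1 : 1 <= (2 * L) ^+ n.
  by rewrite exprn_ege1//; apply: le_trans (_ : 1 <= L) _; [apply: le_trans L8; rewrite ler1n|rewrite ler_peMl ?ltW// ltr1n].
set X := `|_|; have X0 : 0 <= X by exact: normr_ge0.
have -> : D1 * a s m + F1 / s ^+ n = (D1 * s ^+ n * a s m + F1) / s ^+ n.
  by field; rewrite gt_eqF.
rewrite ler_pdivlMr//; apply: le_trans.
by rewrite ler_wpM2l// ler_peMl// ltW.
Qed.

(** The same splitting with f in place of the parent. The part off the dilated cell is controlled by
    its L^1 norm only; this gives the term in [F1 / s ^+ n], which disappears as the top scale
    grows. *)
Lemma T_top s m : 0 < s -> {ae mu, forall x, cell s m x ->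
  `|T f x - T (gg s m) x| <= C3n * D1 * a s m + (Can + C3n) * F1 / s ^+ n}.
Proof.
move=> s0; pose k := c s m.
pose u x := f x - \1_(B s m) x * f x.
have nu : nice u.
  by apply: niceB => //; apply: niceM => //; exact: ex_bound_indic.
have mu' : measurable_fun setT u by case: nu.
pose v x := k * \1_(B s m) x.
have nv : nice v.
  rewrite (_ : v = fun x => k * \1_(B s m) x + 0 * \1_(B s m) x).
    exact: nice_lin.
  by apply/funext => x; rewrite mul0r addr0.
have sum1 : f = fun x => gg s m x + (u x + v x).
  by apply/funext => x; rewrite /gg /u /v -/k; ring.
have h1 := CZ_add H (nck s m k) (niceD nu nv).
have h2 := CZ_add H nu nv.
have h3 := CZ_scale H k (nB s m).
have h4 := CZ_indicator_bound n0 H P0 m s0.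
rewrite -[fun z => ck _ _ _ z + (u z + v z)]sum1 in h1.
have u0 x : `|(corner s m : Rn) - x| < L * s -> u x = 0.
  by move=> hx; rewrite /u (inB hx) mul1r subrr.
have Iu : (\int[mu]_x `|u x|%:E <= F1%:E)%E.
  rewrite -hF1; apply: ge0_le_integral => //.
  - by apply/measurable_EFinP; exact: measurableT_comp.
  - by apply/measurable_EFinP; exact: measurableT_comp.
  - move=> x _; rewrite lee_fin /u indicE; case: (_ \in _).
      by rewrite mul1r subrr normr0.
    by rewrite mul0r subr0.
have Tu x : cell s m x -> `|T u x| <= Can * F1 / s ^+ n.
  move=> cx; have ax := cell_sub_ball s0 cx.
  have := CZ_annulus n0 H s0 (nice_Lfun nu) (nice_supp nu) u0 ax.
  have cc0 : (0 <= (Can / s ^+ n)%:E)%E.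
    by rewrite lee_fin divr_ge0// exprn_ge0// ltW.
  move=> /le_trans /(_ (lee_wpmul2l cc0 Iu)); rewrite -EFinM lee_fin; congr (_ <= _).
  by rewrite mulrAC.
apply: filterS2 (filterI h1 h2) (filterI h3 h4) => x [e1 e2] [e3 e4] cx.
rewrite e1 e2 (_ : T v x = k * T \1_(B s m) x); last exact: e3.
rewrite [_ + (_ + _)]addrC addrK; apply: le_trans (ler_normD _ _) _.
have h5 := e4 cx; have h6 := Tu x cx; have h7 := c_top m s0.
rewrite -/k in h7; rewrite -/(B s m) -/C3n in h5.
have : `|k * T \1_(B s m) x| <= (D1 * a s m + F1 / s ^+ n) * C3n.
  by rewrite normrM; apply: ler_pM.
move: h6; rewrite (_ : C3n * D1 * a s m + (Can + C3n) * F1 / s ^+ n =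
  Can * F1 / s ^+ n + (D1 * a s m + F1 / s ^+ n) * C3n); last by ring.
move=> h6 h8; exact: lerD.
Qed.

Lemma T_bottom s m (e : R) : 0 < s -> 0 < e ->
  (e%:E * mu [set x | (e < `|T (gg s m) x|)%R] <= (A * (D1 * s ^+ n * a s m))%:E)%E.
Proof.
move=> s0 e0; apply: le_trans (CZ_weak H (nck s m (c s m)) e0) _.
rewrite EFinM; apply: lee_wpmul2l; first by rewrite lee_fin.
apply: int_ck (hy m s0); first by case: (nck s m (c s m)).
by move=> x; rewrite /ck normrM ler_wpM2r// indicE; case: (_ \in _); rewrite ?normr1 ?normr0.
Qed.

Lemma avg_le s m (M : R) : 0 < s -> (forall x, g x <= M) -> a s m <= M * (2 * L) ^+ n * s.
Proof.
move=> s0 hM; have M0 : 0 <= M by exact: le_trans (g0 0) (hM 0).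
have h : (\int[mu]_(x in B s m) (g x)%:E <= (M * (2 * (L * s)) ^+ n)%:E)%E.
  rewrite EFinM -(lebesgue_ball (corner s m) (Ls s0)).
  apply: (@le_trans _ _ (\int[mu]_(x in B s m) M%:E)%E); last by rewrite integral_cst.
  apply: ge0_le_integral => //.
  - by move=> x _; rewrite lee_fin.
  - by apply/measurable_EFinP; apply: measurable_funTS; case: ng.
  - by move=> x _; rewrite lee_fin.
have : \int[mu]_(x in B s m) g x <= M * (2 * (L * s)) ^+ n.
  rewrite -lee_fin /Rintegral fineK//; apply: integrable_fin_num => //.
  by apply: integrableS (nice_integrable ng).
have sp : 0 < s ^+ n.-1 by rewrite exprn_gt0.
rewrite /avg -ler_pdivlMl ?invr_gt0// invrK => h1.
apply: le_trans h1 _; rewrite (_ : 2 * (L * s) = (2 * L) * s); last by ring.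
rewrite (exprMn _ (2 * L) s); have -> : s ^+ n = s * s ^+ n.-1 by rewrite -exprS prednK.
by rewrite le_eqVlt; apply/orP; left; apply/eqP; ring.
Qed.

Section scales.
Variables (s0 : R) (s00 : 0 < s0).

Let sk k : 0 < dyadic s0 k. Proof. exact: dyadic_gt0. Qed.
Let idx k (x : Rn) := cell_index (dyadic s0 k) x.
Let ak k x : R := a (dyadic s0 k) (idx k x).
Let ak0 k x : 0 <= ak k x. Proof. exact: a0. Qed.
Let idxS k x : idx k x = parent_cell (idx k.+1 x).
Proof. by rewrite /idx dyadicS; apply: cell_index_half. Qed.

Lemma T_chain : {ae mu, forall x, forall N,
  `|T f x| <= `|T (gg (dyadic s0 N) (idx N x)) x| + (child_cst * \sum_(k < N) ak k x +
    (C3n * D1 * ak 0 x + (Can + C3n) * F1 / s0 ^+ n))}.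
Proof.
have h1 : {ae mu, forall x, forall m, cell (dyadic s0 0) m x ->
    `|T f x - T (gg (dyadic s0 0) m) x| <= C3n * D1 * a (dyadic s0 0) m + (Can + C3n) * F1 / (dyadic s0 0) ^+ n}.
  by apply: (@ae_countable R) => m; exact: T_top (sk 0).
have h2 : {ae mu, forall x, forall p : nat * 'rV[int]_n, cell (dyadic s0 p.1 / 2) p.2 x ->
    `|T (gg (dyadic s0 p.1) (parent_cell p.2)) x - T (gg (dyadic s0 p.1 / 2) p.2) x| <=
    child_cst * a (dyadic s0 p.1) (parent_cell p.2)}.
  by apply: (@ae_countable R) => -[k m]; exact: T_child (sk k).
apply: filterS2 h1 h2 => x h1 h2.
elim=> [|N IH].
  rewrite big_ord0 mulr0 add0r; have := h1 (idx 0 x) erefl; rewrite [in _ / _]dyadic0 => h.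
  by rewrite -lerBlDl; apply: le_trans h; exact: lerB_dist.
have := h2 (N, idx N.+1 x); rewrite /= -dyadicS -idxS => /(_ erefl) h.
apply: le_trans IH _; rewrite big_ord_recr/= mulrDr.
have : `|T (gg (dyadic s0 N) (idx N x)) x| <= `|T (gg (dyadic s0 N.+1) (idx N.+1 x)) x| + child_cst * ak N x.
  by rewrite -lerBlDl; apply: le_trans h; exact: lerB_dist.
exact: telescope_step.
Qed.

Let S (x : Rn) : \bar R := (\sum_(k <oo) (ak k x)%:E)%E.

Let S_ge x N : ((\sum_(k < N) ak k x)%:E <= S x)%E.
Proof.
rewrite -sumEFin -(big_mkord xpredT (fun k => (ak k x)%:E)).
by apply: nneseries_lim_ge => k _ _; rewrite lee_fin.
Qed.

Let mS : measurable_fun setT S.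
Proof.
apply: ge0_emeasurable_sum => [k x _ _|k _]; first by rewrite lee_fin.
apply/measurable_EFinP.
exact: (measurable_cell_index_comp (a (dyadic s0 k)) (sk k)).
Qed.

Let C5 : R := child_cst + C3n * D1.
Let E0 : R := (Can + C3n) * F1 / s0 ^+ n.

Let child_cst_ge0 : 0 <= child_cst.
Proof. by rewrite /child_cst addr_ge0// mulr_ge0// ?mulr_ge0// exprn_ge0. Qed.

Let T_chain_S : {ae mu, forall x, forall N,
  (`|T f x|%:E <= `|T (gg (dyadic s0 N) (idx N x)) x|%:E + (C5%:E * S x + E0%:E))%E}.
Proof.
apply: filterS T_chain => x h N.
have := h N; rewrite -lee_fin EFinD => /le_trans; apply; rewrite leeD2l//.
apply: (series_le_step _ child_cst_ge0 (mulr_ge0 C3n0 D10) (S_ge x N)).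
  by have := S_ge x 1; rewrite big_ord1.
by have := S_ge x 0; rewrite big_ord0.
Qed.

Let Z (e : R) m0 : set Rn := cell s0 m0 `&` [set x | (C5%:E * S x + (E0 + e)%:E < `|T f x|%:E)%E].

Let mZ e m0 : measurable (Z e m0).
Proof.
apply: measurableI; first exact: measurable_cell.
rewrite -[X in measurable X]setTI; apply: measurable_lte => //.
- by apply: emeasurable_funD => //; exact: measurable_funeM.
- apply/measurable_EFinP; have := CZ_measurable H nf; exact: measurableT_comp.
Qed.

(** On a cell of scale N meeting Z, [T_chain_S] forces |T gg| > e at almost every point of Z. The
    weak type and the bounded gradient limit this to a multiple of [dyadic s0 N] times the volume of
    the cell; the cells meeting Z all lie in the top cell, and their bounds are added. *)
Let Z_small (e : R) m0 : 0 < e -> exists2 D : R, 0 <= D & forall N, (mu (Z e m0) <= (D * dyadic s0 N)%:E)%E.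
Proof.
move=> e0; have [_ [M hM] _] := ng.
have gM x : g x <= M by apply: le_trans (ler_norm _) (hM x).
have M0 : 0 <= M by exact: le_trans (g0 0) (gM 0).
pose D := A * D1 * M * (2 * L) ^+ n / e.
have D0 : 0 <= D by rewrite divr_ge0 ?(ltW e0)// !mulr_ge0// exprn_ge0// mulr_ge0// ltW.
exists (D * s0 ^+ n); first by rewrite mulr_ge0// exprn_ge0// ltW.
move=> N; have sN := sk N; pose d := D * dyadic s0 N.
have d0 : 0 <= d by rewrite mulr_ge0// ltW.
have mC : measurable (cell s0 m0) by exact: measurable_cell.
have main : (\int[mu]_x (\1_(Z e m0) x)%:E <= \int[mu]_x (d * \1_(cell s0 m0) x)%:E)%E.
  apply: (integral_cells_le sN).
  - by apply/measurable_EFinP; exact: measurable_indic.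
  - by move=> x; rewrite lee_fin.
  - by apply/measurable_EFinP; apply: measurable_funM => //; exact: measurable_indic.
  - by move=> x; rewrite lee_fin mulr_ge0.
  move=> m; have mc := measurable_cell m sN.
  rewrite integral_indic//.
  have [|ne] := pselect (Z e m0 `&` cell (dyadic s0 N) m = set0).
    move=> ->; rewrite measure0; apply: integral_ge0 => x _.
    by rewrite lee_fin mulr_ge0.
  have [z [[z1 _] z2]] : exists z, (Z e m0 `&` cell (dyadic s0 N) m) z.
    by apply: contrapT => /forallNP h; apply: ne; rewrite -subset0 => x /h.
  have -> : (\int[mu]_(x in cell (dyadic s0 N) m) (d * \1_(cell s0 m0) x)%:E =
      (d * dyadic s0 N ^+ n)%:E)%E.
    transitivity (\int[mu]_(x in cell (dyadic s0 N) m) d%:E)%E.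
      apply: eq_integral => x; rewrite inE => cx; rewrite indicE mem_set ?mulr1//.
      exact: cells_nested z1 z2 cx.
    have cm := lebesgue_cell (R := R) m sN.
    transitivity (d%:E * (dyadic s0 N ^+ n)%:E)%E; last by rewrite -EFinM.
    by rewrite -cm; exact: integral_cst.
  apply: (@le_trans _ _ (mu [set x | (e < `|T (gg (dyadic s0 N) m) x|)%R])).
    apply: le_mu_ae; first exact: measurableI.
      rewrite (_ : [set x | _] = [set x | e < `|T (gg (dyadic s0 N) m) x - 0|]).
        by apply: (measurable_bad H); exact: nck.
      by under [RHS]eq_set do rewrite subr0.
    apply: filterS T_chain_S => x h [[_ /= zx] cx].
    have := h N; rewrite (_ : idx N x = m); last exact: cx.
    apply: lt_of_excess zx; apply: mule_ge0; first by rewrite lee_fin addr_ge0// mulr_ge0.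
    by have := S_ge x 0; rewrite big_ord0.
  rewrite -(@lee_pmul2l _ e%:E) ?lte_fin//; apply: le_trans (T_bottom _ _ _) _ => //.
  rewrite -EFinM lee_fin.
  have -> : e * (d * dyadic s0 N ^+ n) = A * (D1 * dyadic s0 N ^+ n * (M * (2 * L) ^+ n * dyadic s0 N)).
    by rewrite /d /D; field; rewrite gt_eqF.
  rewrite ler_wpM2l// ler_wpM2l ?mulr_ge0 ?exprn_ge0 ?(ltW sN)//.
  exact: avg_le.
move: main; rewrite integral_indic// setIT => /le_trans; apply.
under eq_integral do rewrite EFinM.
rewrite ge0_integralZl//; last first.
  by apply/measurable_EFinP; exact: measurable_indic.
have cm := lebesgue_cell (R := R) m0 s00.
rewrite integral_indic// setIT [X in (_ * X)%E]cm -EFinM lee_fin /d.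
by rewrite le_eqVlt; apply/orP; left; apply/eqP; ring.
Qed.

Let Z_null (e : R) m0 : 0 < e -> mu (Z e m0) = 0%E.
Proof.
move=> /(@Z_small e m0)[D D0 h]; apply/eqP; rewrite eq_le measure_ge0 andbT.
apply/lee_addgt0Pr => d d0; rewrite add0e.
have q0 : 0 < d / (D * s0 + 1) by rewrite divr_gt0// ltr_wpDl// mulr_ge0// ltW.
have [N /(_ N (leqnn N)) hN] := cvg_half q0.
apply: le_trans (h N) _; rewrite lee_fin.
move: hN; rewrite ltr_pdivlMr; last by rewrite ltr_wpDl// mulr_ge0// ltW.
have h2 : 0 < (2^-1 : R) ^+ N by rewrite exprn_gt0.
rewrite /dyadic -exprVn; move: (2^-1 ^+ N) h2 => u u0; rewrite mulrDr mulr1 => hu.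
by apply: ltW; apply: le_lt_trans hu; rewrite mulrA mulrC lerDl ltW.
Qed.

Lemma T_bound : {ae mu, forall x, (`|T f x|%:E <= C5%:E * S x + E0%:E)%E}.
Proof.
(* Margins 1/(j+1) and top cells are countably many, so one null set suffices. *)
have h : {ae mu, forall x, forall p : nat * 'rV[int]_n, ~ Z (p.1.+1%:R^-1) p.2 x}.
  apply: (@ae_countable R) => -[j m]; exists (Z j.+1%:R^-1 m); split => //.
    by apply: Z_null; rewrite invr_gt0.
  by move=> x /= /contrapT.
apply: filterS h => x h; apply/lee_addgt0Pr => e e0.
have [j hj] : exists j, j.+1%:R^-1 < e.
  exists (Num.truncn e^-1); rewrite invf_plt ?posrE//; exact: truncnS_gt.
have := h (j, cell_index s0 x); rewrite /Z/= => h1.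
rewrite leNgt; apply/negP => h2; apply: h1; split => //=.
apply: le_lt_trans h2; rewrite -addeA -EFinD leeD2l// lee_fin lerD2l; exact: ltW.
Qed.

Let cN_cvg x (e : R) : 0 < e -> exists N, `|f x - c (dyadic s0 N) (idx N x)| < e.
Proof.
move=> e0; have [cf _] := hf; have [d d0 hd] := continuous_eps (cf x) e0.
have q0 : 0 < d / ((L + 1) * s0) by rewrite divr_gt0// mulr_gt0// ltr_wpDl// ltW.
have [N /(_ N (leqnn N)) hN] := cvg_half q0; exists N; apply: hd.
move: hN; rewrite ltr_pdivlMr; last by rewrite mulr_gt0// ltr_wpDl// ltW.
have := yB (idx N x) (sk N); rewrite /B ball_rVE/= => h1.
have := dist_corner x (sk N) => h2.
have h3 : `|x - y (dyadic s0 N) (idx N x)| <= `|corner (dyadic s0 N) (idx N x) - x| +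
   `|(corner (dyadic s0 N) (idx N x) : Rn) - y (dyadic s0 N) (idx N x)|.
  by rewrite (distrC _ x); exact: ler_distD.
apply: dist_lt_scale h1 h2 h3; by rewrite /dyadic -exprVn.
Qed.

(** The same telescoping for f itself, at every point; it controls the multiplication by b left over
    from the reduction to T(1) = 0. *)
Lemma f_chain x N : `|f x| <= `|f x - c (dyadic s0 N) (idx N x)| +
  (2 * D1 * \sum_(k < N) ak k x + (D1 * ak 0 x + F1 / s0 ^+ n)).
Proof.
elim: N => [|N IH].
  rewrite big_ord0 mulr0 add0r; have := c_top (idx 0 x) (sk 0); rewrite [in _ / _]dyadic0 => h.
  exact: norm_le_sub.
apply: le_trans IH _; rewrite big_ord_recr/= mulrDr; apply: telescope_step.
have := c_child (idx N.+1 x) (sk N); rewrite -dyadicS -idxS => h.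
exact: norm_sub_le_sub.
Qed.

Let f_bound x : (`|f x|%:E <= (2 * D1 + D1)%:E * S x + (F1 / s0 ^+ n)%:E)%E.
Proof.
apply/lee_addgt0Pr => e e0; have [N hN] := cN_cvg x e0.
apply: (@le_trans _ _ ((2 * D1 * \sum_(k < N) ak k x + (D1 * ak 0 x + F1 / s0 ^+ n))%:E + e%:E)%E).
  rewrite -EFinD lee_fin; apply: le_trans (f_chain x N) _.
  by rewrite addrC lerD2l ltW.
rewrite leeD2r//; apply: (series_le_step _ (mulr_ge0 _ D10) D10 (S_ge x N)) => //.
  by have := S_ge x 1; rewrite big_ord1.
by have := S_ge x 0; rewrite big_ord0.
Qed.

Let S_riesz x : (S x <= (2 * (2 * L * n%:R) ^+ n.-1)%:E * riesz_potential1 g x)%E.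
Proof.
apply: lime_le; first by apply: is_cvg_nneseries => k _ _; rewrite lee_fin.
near=> N; rewrite big_mkord sumEFin.
exact: (avg_sum_le_riesz hn ng g0 x N s00).
Unshelve. all: by end_near. Qed.

Lemma T_riesz_scale : {ae mu, forall x,
  (`|T f x|%:E <= ((child_cst + C3n * D1) * (2 * (2 * L * n%:R) ^+ n.-1))%:E * riesz_potential1 g x
     + ((Can + C3n) * F1 / s0 ^+ n)%:E)%E}.
Proof.
apply: filterS T_bound => x /le_trans; apply; rewrite leeD2r// EFinM -muleA.
by apply: lee_wpmul2l; [rewrite lee_fin addr_ge0// mulr_ge0|exact: S_riesz].
Qed.

Lemma f_riesz_scale x :
  (`|f x|%:E <= ((2 * D1 + D1) * (2 * (2 * L * n%:R) ^+ n.-1))%:E * riesz_potential1 g x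
     + (F1 / s0 ^+ n)%:E)%E.
Proof.
apply: le_trans (f_bound x) _; rewrite leeD2r// EFinM -muleA.
by apply: lee_wpmul2l; [rewrite lee_fin addr_ge0// mulr_ge0|exact: S_riesz].
Qed.

End scales.

Definition riesz_cst (b : R) : R :=
  ((child_cst + C3n * D1) + b * (2 * D1 + D1)) * (2 * (2 * L * n%:R) ^+ n.-1).

(* Let the top scale tend to infinity. *)
Lemma chain_riesz (b : R) : 0 <= b -> {ae mu, forall x,
  ((`|T f x| + b * `|f x|)%:E <= (riesz_cst b)%:E * riesz_potential1 g x)%E}.
Proof.
move=> b0.
have h : {ae mu, forall x, forall J : nat,
  (`|T f x|%:E <= ((child_cst + C3n * D1) * (2 * (2 * L * n%:R) ^+ n.-1))%:E * riesz_potential1 g x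
     + ((Can + C3n) * F1 / (2 ^+ J) ^+ n)%:E)%E}.
  by apply: (@ae_countable R) => J; apply: T_riesz_scale; rewrite exprn_gt0.
apply: filterS h => x h; apply/lee_addgt0Pr => e e0.
pose Q := (Can + C3n + b) * F1.
have Q0 : 0 <= Q by rewrite /Q mulr_ge0// addr_ge0// addr_ge0.
have q0 : 0 < e / (Q + 1) by rewrite divr_gt0// ltr_wpDl.
have [J /(_ J (leqnn J)) hJ] := cvg_half q0.
have J0 : 0 < 2 ^+ J :> R by rewrite exprn_gt0.
have h1 := h J; have h2 := f_riesz_scale J0 x.
have I0 : (0 <= riesz_potential1 g x)%E.
  by apply: integral_ge0 => z _; rewrite lee_fin divr_ge0// exprn_ge0// enorm_ge0.
have child_cst_ge0 : 0 <= child_cst by rewrite /child_cst addr_ge0// mulr_ge0// ?mulr_ge0// exprn_ge0.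
have X0 : 0 <= 2 * (2 * L * n%:R) ^+ n.-1 by rewrite mulr_ge0// exprn_ge0// !mulr_ge0// ltW.
have bE : (0 <= b%:E)%E by rewrite lee_fin.
have h3 := leeD h1 (lee_wpmul2l bE h2).
rewrite EFinD EFinM; apply: le_trans h3 _.
have hQ : Q / (2 ^+ J) ^+ n <= e.
  move: hJ; rewrite ltr_pdivlMr ?ltr_wpDl// exprVn => hJ.
  rewrite ler_pdivrMr ?exprn_gt0//.
  have : Q + 1 < e * 2 ^+ J by rewrite -ltr_pdivrMr// mulrC.
  have : e * 2 ^+ J <= e * (2 ^+ J) ^+ n.
    by rewrite ler_pM2l// ler_eXnr// exprn_ege1// ler1n.
  move=> h4 h5; apply: ltW; apply: lt_le_trans h4; apply: le_lt_trans h5.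
  by rewrite lerDl.
have p0 : 0 <= (child_cst + C3n * D1) * (2 * (2 * L * n%:R) ^+ n.-1).
  by apply: mulr_ge0 X0; rewrite addr_ge0// mulr_ge0.
have r0 : 0 <= (2 * D1 + D1) * (2 * (2 * L * n%:R) ^+ n.-1).
  by apply: mulr_ge0 X0; rewrite addr_ge0// mulr_ge0.
rewrite (ge0_affine_comb _ _ I0 p0 r0 b0).
have -> : (child_cst + C3n * D1) * (2 * (2 * L * n%:R) ^+ n.-1) +
  b * ((2 * D1 + D1) * (2 * (2 * L * n%:R) ^+ n.-1)) = riesz_cst b by rewrite /riesz_cst; ring.
by rewrite leeD2l// lee_fin mulrA -mulrDl -mulrDl.
Qed.

End chain.

(** * Reduction to T(1) = 0 *)

Section Linfty.
Variables (R : realType) (n : nat).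
Local Notation Rn := 'rV[R]_n.
Local Notation mu := (lebesgue_rV R n).

Lemma lebesgue_rV_setT_gt0 : (0 < mu setT)%E.
Proof.
apply: (@lt_le_trans _ _ (mu (ball (0 : Rn) 1))).
  by rewrite lebesgue_ball// lte_fin exprn_gt0// mulr_gt0.
by apply: le_mu => //; exact: measurable_ball_rV.
Qed.

Lemma Linfty_bounded_rep (b : Rn -> R) : b \in Lfun mu +oo%E ->
  exists (b' : Rn -> R) (M : R), [/\ 0 <= M, measurable_fun setT b', forall x, `|b' x| <= M &
    {ae mu, forall x, b' x = b x}].
Proof.
move=> /andP[]; rewrite !inE/= => mb; rewrite /finite_norm unlock lebesgue_rV_setT_gt0.
rewrite (_ : abse \o (EFin \o b) = EFin \o (fun x => `|b x|)); last by apply/funext.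
move=> /ess_supr_bounded[M hM].
pose M' := `|M|; have M0 : 0 <= M' by exact: normr_ge0.
exists (fun x => Num.max (- M') (Num.min (b x) M')), M'; split => //.
- by apply: measurable_maxr => //; apply: measurable_minr.
- move=> x; rewrite ler_norml; apply/andP; split; first by rewrite le_max lexx.
  by rewrite ge_max ge_min lexx orbT andbT; lra.
- apply: filterS hM => x hx; have : `|b x| <= M' by apply: le_trans hx (ler_norm _).
  by rewrite ler_norml => /andP[h1 h2]; rewrite min_l// max_r.
Qed.

Lemma bounded_Linfty (b : Rn -> R) M : measurable_fun setT b -> (forall x, `|b x| <= M) ->
  b \in Lfun mu +oo%E.
Proof.
move=> mb hM; apply/andP; rewrite !inE/=; split => //.
rewrite /finite_norm unlock lebesgue_rV_setT_gt0.
apply: (@le_lt_trans _ _ M%:E); last exact: ltry.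
by apply/ess_supP; apply: aeW => x; rewrite /= lee_fin.
Qed.

End Linfty.

Section subtract.
Variables (R : realType) (n : nat) (T : ('rV[R]_n -> R) -> 'rV[R]_n -> R).
Variables (K : 'rV[R]_n -> 'rV[R]_n -> R) (w : R -> R) (A W : R).
Local Notation Rn := 'rV[R]_n.
Local Notation mu := (lebesgue_rV R n).
Hypotheses (H : CZ_data T K w A W).
Variables (b : Rn -> R) (M : R).
Hypotheses (M0 : 0 <= M) (mb : measurable_fun setT b) (bM : forall x, `|b x| <= M).

Let T0 f x := T f x - b x * f x.

(** Multiplication by b is local, so the kernel off the support is unchanged. Splitting the level l
    into two halves, one for each term, gives the new weak type constant. *)
Lemma CZ_subtract_mult : CZ_data T0 K w (2 * A + 2 * M) W.
Proof.
have [lT rT mw kw [A0 wT W0 hW]] := H; split => //.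
- move=> p q f g fL gL; apply: filterS (lT p q f g fL gL) => x e.
  by rewrite /T0 e; ring.
- move=> f fL fc x hx; have [i e] := rT f fL fc x hx; split => //.
  by rewrite /T0 e; have -> : f x = 0; [apply/eqP/negPn/negP => /supp_neq0|rewrite mulr0 subr0].
split => //; first by rewrite addr_ge0// mulr_ge0.
move=> f fL; have [mT hT] := wT f fL.
have mf : measurable_fun setT f by move/Lfun1_integrable: fL => /integrableP[/measurable_EFinP].
have mT0 : measurable_fun setT (T0 f) by apply: measurable_funB => //; exact: measurable_funM.
split => // l l0.
have l20 : 0 < l / 2 by rewrite divr_gt0.
have mset (h : Rn -> R) t : measurable_fun setT h -> measurable [set x | t < `|h x|].
  move=> mh; rewrite -[X in measurable X]setTI; apply: measurable_fun_ltr => //.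
  exact: measurableT_comp.
pose S1 := [set x | l / 2 < `|T f x|]; pose S2 := [set x | l / 2 < `|b x * f x|].
have mS1 : measurable S1 by exact: mset.
have mbf : measurable_fun setT (fun x => b x * f x) by exact: measurable_funM.
have mS2 : measurable S2 by exact: (mset (fun x => b x * f x)).
have sub : [set x | l < `|T0 f x|] `<=` S1 `|` S2.
  move=> x /= h; have [h1|h1] := ltP (l / 2) `|T f x|; [by left|right].
  have := ler_normB (T f x) (b x * f x); rewrite /S2/= -/(T0 f x); lra.
have I0 : (0 <= \int[mu]_x `|f x|%:E)%E by apply: integral_ge0 => x _; rewrite lee_fin.
have b2 : ((l / 2)%:E * mu S2 <= M%:E * \int[mu]_x `|f x|%:E)%E.
  rewrite -ge0_integralZl//; last by apply/measurable_EFinP; exact: measurableT_comp.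
  have -> : ((l / 2)%:E * mu S2 = \int[mu]_x ((l / 2) * \1_S2 x)%:E)%E.
    under eq_integral do rewrite EFinM.
    rewrite ge0_integralZl//; last 2 first.
    - by apply/measurable_EFinP; exact: measurable_indic.
    - by rewrite lee_fin ltW.
    by rewrite integral_indic// setIT.
  apply: ge0_le_integral => //.
  - by move=> x _; rewrite lee_fin mulr_ge0// ltW.
  - by apply/measurable_EFinP; apply: measurable_funM => //; exact: measurable_indic.
  - by apply: measurable_funeM; apply/measurable_EFinP; exact: measurableT_comp.
  - move=> x _; rewrite -EFinM lee_fin indicE; case: (boolP (x \in S2)).
      rewrite inE /S2/= mulr1 => /ltW /le_trans; apply.
      by rewrite normrM ler_wpM2r.
    by rewrite mulr0 mulr_ge0.
have b1 := hT _ l20; rewrite -/S1 in b1.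
have e2 (X : \bar R) : (l%:E * X = 2%:E * ((l / 2)%:E * X))%E.
  by rewrite muleA -EFinM; congr (_%:E * _)%E; field.
apply: (@le_trans _ _ (l%:E * (mu S1 + mu S2))%E).
  apply: lee_wpmul2l; first by rewrite lee_fin ltW.
  apply: le_trans (measureU2 _ mS1 mS2); apply: le_mu => //; [exact: mset|exact: measurableU].
rewrite muleDr// ?ge0_adde_def ?inE// !e2 (EFinD (2 * A)) (@ge0_muleDl _ _ (2 * A)%:E) ?lee_fin ?mulr_ge0//.
rewrite (EFinM 2 A) (EFinM 2 M) -!muleA.
by apply: leeD; apply: lee_wpmul2l.
Qed.

(** [eta] is 1 on the support of [phi], so the product subtracted from the local term is [b * phi];
    the kernel term is common to both pairings. *)
Lemma pairing_subtract_mult phi eta : nice phi -> cutoff phi eta ->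
  mu.-integrable setT (EFin \o (fun x => T0 eta x * phi x)) ->
  T1_pairing T0 K eta phi = T1_pairing T K eta phi - \int[mu]_x (b x * phi x).
Proof.
move=> np [_ _ cut] i0.
have ib : mu.-integrable setT (EFin \o (fun x => b x * phi x)).
  by apply: nice_integrable; apply: niceM => //; exists M.
have e x : T eta x * phi x = T0 eta x * phi x + b x * phi x.
  rewrite /T0; have [->|px] := eqVneq (phi x) 0; first by rewrite !mulr0 addr0.
  have -> : eta x = 1.
    have := cut x (supp_neq0 px); exact: nbhs_singleton.
  by ring.
rewrite /T1_pairing (_ : \int[mu]_x (T eta x * phi x) =
   \int[mu]_x (T0 eta x * phi x) + \int[mu]_x (b x * phi x)).
  by ring.
by rewrite -RintegralD//; apply: eq_Rintegral => x _; exact: e.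
Qed.

End subtract.

Lemma ae_eq_Rintegral d (T : measurableType d) (R : realType) (nu : {measure set T -> \bar R})
  (f g : T -> R) : measurable_fun setT f -> measurable_fun setT g ->
  {ae nu, forall x, f x = g x} -> \int[nu]_x f x = \int[nu]_x g x.
Proof.
move=> mf mg fg; rewrite /Rintegral; congr fine; apply: ae_eq_integral => //.
- exact/measurable_EFinP.
- exact/measurable_EFinP.
- by apply: filterS fg => x -> _.
Qed.

Theorem Linfty_riesz_domination (R : realType) (n : nat) (T : ('rV[R]_n -> R) -> 'rV[R]_n -> R)
  (K : 'rV[R]_n -> 'rV[R]_n -> R) : (2 <= n)%N -> CZ_operator T K ->
  T1_in_Linfty T K -> riesz_domination T.
Proof.
move=> hn hT [b bL hb].
have [w [A [W H]]] := CZ_operator_data hT.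
have [b' [M [M0 mb' bM eb]]] := Linfty_bounded_rep bL.
have mb : measurable_fun setT b by case/andP: bL; rewrite inE.
have H0 := CZ_subtract_mult H M0 mb' bM.
have P0 phi eta : D0 phi -> nice phi -> cutoff phi eta -> nice eta ->
    (lebesgue_rV R n).-integrable setT (EFin \o (fun x => (T eta x - b' x * eta x) * phi x)) ->
    T1_pairing (fun f x => T f x - b' x * f x) K eta phi = 0.
  move=> dphi np cut _ i0.
  rewrite (pairing_subtract_mult K mb' bM np cut i0) (hb _ dphi _ cut).
  have mp : measurable_fun setT phi by case: np.
  apply/eqP; rewrite subr_eq0; apply/eqP/ae_eq_Rintegral; [exact: measurable_funM|exact: measurable_funM|].
  by apply: filterS eb => x ->.
set C := riesz_cst n w (2 * A + 2 * M) W M.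
exists (`|C| + 1); first by rewrite ltr_wpDl.
move=> f hf kf.
have [y hy] := poincare_cells (leq_trans (isT : (0 < 2)%N) hn) hf kf.
have := chain_riesz hn H0 P0 hf kf (fun s m s0 => (hy s m s0).1) (fun s m s0 => (hy s m s0).2) M0.
apply: filterS => x h.
have I0 : (0 <= riesz_potential1 (fun y => enorm (gradient f y)) x)%E.
  by apply: integral_ge0 => z _; rewrite lee_fin divr_ge0 ?enorm_ge0// exprn_ge0// enorm_ge0.
apply: (@le_trans _ _ (C%:E * riesz_potential1 (fun y => enorm (gradient f y)) x)%E); last first.
  by apply: lee_wpmul2r => //; rewrite lee_fin; apply: le_trans (ler_norm _) _; rewrite lerDl.
apply: le_trans h; rewrite lee_fin.
rewrite -{1}(subrK (b' x * f x) (T f x)); apply: le_trans (ler_normD _ _) _.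
by rewrite lerD2l normrM ler_wpM2r.
Qed.

(** * From the pointwise bound to T(1) *)

Section cutoff_gradient.
Variables (R : realType) (n : nat).
Local Notation Rn := 'rV[R]_n.
Local Notation mu := (lebesgue_rV R n).

Lemma set_coord_scale (c : R) (x : Rn) i s : c *: set_coord x i s = set_coord (c *: x) i (c * s).
Proof.
apply/rowP => j; rewrite mxE !set_coordE mxE.
by case: (j == i).
Qed.

Lemma partial_scale (f : Rn -> R) (c : R) i x : is_Ck 1 f ->
  partial i (fun x => f (c *: x)) x = c * partial i f (c *: x).
Proof.
move=> [_ /(_ i)[df _]].
have [] // := @derivable_slice R n (fun x => f (c *: x)) x i (c * partial i f (c *: x)).
have h := slice_is_derive (df (set_coord (c *: x) i (c * x ord0 i))).
have e : set_coord (c *: x) i (c * x ord0 i) = c *: x.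
  by rewrite -set_coord_scale set_coord_id.
rewrite e in h.
rewrite (_ : (fun s => _) = (fun t => f (set_coord (c *: x) i t)) \o (fun s => c * s)); last first.
  by apply/funext => s /=; rewrite set_coord_scale.
rewrite mulrC; apply: is_derive1_comp.
by apply: is_derive_eq; rewrite /= [_%:A]mulr1.
Qed.

Lemma cutoff_at_scale (rho : R) : cutoff_at (0 : Rn) rho = fun x => cutoff_at (0 : Rn) 1 (rho^-1 *: x).
Proof.
apply/funext => x; rewrite !cutoff_atE; apply: eq_bigr => i _.
by rewrite !mxE !subr0 invr1 mul1r.
Qed.

Lemma enormZ (c : R) (x : Rn) : enorm (c *: x) = `|c| * enorm x.
Proof.
rewrite /enorm -(sqrtr_sqr c) -sqrtrM ?sqr_ge0// mulr_sumr; congr Num.sqrt.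
by apply: eq_bigr => i _; rewrite mxE exprMn.
Qed.

Lemma gradient_near_cst (f : Rn -> R) (x : Rn) (c : R) : (\near x, f x = c) -> gradient f x = 0.
Proof.
move=> h; apply/rowP => i; rewrite !mxE /partial (@near_eq_derive _ _ _ f (cst c))//.
exact: derive_cst.
Qed.

(** The cutoff of size rho is the unit one rescaled, which gives the decay in rho. *)
Lemma cutoff_gradient : exists2 G : R, 0 <= G & forall (rho : R) (x : Rn), 0 < rho ->
  enorm (gradient (cutoff_at (0 : Rn) rho) x) <= G / rho /\
  (`|x| < rho \/ 2 * rho < `|x| -> gradient (cutoff_at (0 : Rn) rho) x = 0).
Proof.
have s1 : is_Ck 1 (cutoff_at (0 : Rn) 1) by exact: cutoff_at_smooth.
have k1 : compactly_supported (cutoff_at (0 : Rn) 1) by apply: nice_supp; exact: cutoff_at_nice.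
have [_ [G hG] _] := grad_nice s1 k1.
exists G; first exact: le_trans (hG 0).
move=> rho x r0; split.
  rewrite (_ : gradient _ x = rho^-1 *: gradient (cutoff_at (0 : Rn) 1) (rho^-1 *: x)); last first.
    by rewrite cutoff_at_scale; apply/rowP => i; rewrite !mxE partial_scale.
  rewrite enormZ gtr0_norm ?invr_gt0// mulrC ler_wpM2r ?invr_ge0 ?(ltW r0)//.
  exact: le_trans (ler_norm _) (hG _).
move=> [h|h].
  apply: (@gradient_near_cst _ _ 1); apply/nbhs_ballP; exists (rho - `|x|); first by rewrite /= subr_gt0.
  move=> y; rewrite ball_rVE/= => xy; apply: cutoff_at1 => //.
  rewrite sub0r normrN -(subKr x y) (le_trans (ler_normB _ _))//; lra.
apply: (@gradient_near_cst _ _ 0); apply/nbhs_ballP; exists (`|x| - 2 * rho); first by rewrite /= subr_gt0.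
move=> y; rewrite ball_rVE/= => xy; apply: cutoff_at0 => //.
have : `|x| <= `|x - y| + `|y| by rewrite -{1}(subrK y x) ler_normD.
rewrite sub0r normrN; lra.
Qed.

Lemma enorm0 : enorm (0 : Rn) = 0.
Proof. by rewrite -(scale0r 0) enormZ normr0 mul0r. Qed.

(** The gradient lives in 2 rho <= |y| <= 4 rho, at distance at least rho from x. The potential is
    at most G / (2 rho) times rho^(1-n) times the volume (10 rho)^n of a ball, and the powers of rho
    cancel. *)
Lemma riesz_cutoff : (2 <= n)%N -> exists2 D : R, 0 <= D & forall (rho : R) (x : Rn), 0 < rho -> `|x| < rho ->
  (riesz_potential1 (fun y => enorm (gradient (cutoff_at (0%R : Rn) (2 * rho)%R) y)) x <= D%:E)%E.
Proof.
move=> hn; have [G G0 hG] := cutoff_gradient.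
exists (G / 2 * 10 ^+ n); first by rewrite mulr_ge0 ?divr_ge0// exprn_ge0.
move=> rho x r0 xr.
have r20 : 0 < 2 * rho by rewrite mulr_gt0.
have n1 : n = n.-1.+1 by rewrite prednK// (leq_trans _ hn).
pose M := G / (2 * rho) / rho ^+ n.-1.
have M0 : 0 <= M by rewrite !divr_ge0 ?exprn_ge0// ltW.
have r50 : 0 < 5 * rho by rewrite mulr_gt0.
have mB := measurable_ball_rV (0 : Rn) (5 * rho).
have s1 : is_Ck 1 (cutoff_at (0 : Rn) (2 * rho)) by exact: cutoff_at_smooth.
have k1 : compactly_supported (cutoff_at (0 : Rn) (2 * rho)) by apply: nice_supp; exact: cutoff_at_nice.
have [mg _ _] := grad_nice s1 k1.
have mi := measurable_riesz_kernel x n.-1.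
apply: (@le_trans _ _ (\int[mu]_y (M * \1_(ball (0%R : Rn) (5 * rho)%R) y)%:E)%E).
  rewrite /riesz_potential1; apply: ge0_le_integral => //.
  - by move=> y _; rewrite lee_fin divr_ge0 ?exprn_ge0 ?enorm_ge0.
  - apply/measurable_EFinP; exact: measurable_funM.
  - by apply/measurable_EFinP; apply: measurable_funM => //; exact: measurable_indic.
  - move=> y _; rewrite lee_fin.
    have [h1 h2] := hG (2 * rho) y r20.
    have [hy|hy] := ltP `|y| (2 * rho).
      by rewrite (h2 (or_introl hy)) enorm0 mul0r mulr_ge0.
    have [hy'|hy'] := ltP (2 * (2 * rho)) `|y|.
      by rewrite (h2 (or_intror hy')) enorm0 mul0r mulr_ge0.
    rewrite indicE mem_set ?mulr1; last by rewrite ball_rVE/= sub0r normrN; lra.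
    apply: ler_pM => //; rewrite ?enorm_ge0 ?invr_ge0 ?exprn_ge0 ?enorm_ge0//.
    have xy : rho <= enorm (x - y).
      apply: le_trans (le_norm_enorm _).
      have : `|y| <= `|x - y| + `|x| by rewrite distrC -{1}(subrK x y) ler_normD.
      lra.
    have e0 : 0 < enorm (x - y) by exact: lt_le_trans xy.
    by rewrite lef_pV2 ?posrE ?exprn_gt0// lerXn2r// nnegrE ltW.
under eq_integral do rewrite EFinM.
rewrite ge0_integralZl//; last first.
  by apply/measurable_EFinP; exact: measurable_indic.
have cm := lebesgue_ball (0 : Rn) r50.
rewrite integral_indic// setIT [X in (_ * X)%E]cm -EFinM lee_fin /M.
have -> : 2 * (5 * rho) = 10 * rho by ring.
rewrite (exprMn _ 10 rho).
have -> : rho ^+ n = rho * rho ^+ n.-1 by rewrite -exprS prednK// (leq_trans _ hn).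
have : rho ^+ n.-1 != 0 by rewrite gt_eqF// exprn_gt0.
have : rho != 0 by rewrite gt_eqF.
move: (rho ^+ n.-1) (10 ^+ _) => u v h1 h2.
by rewrite le_eqVlt; apply/orP; left; apply/eqP; field; rewrite h1 h2.
Qed.

End cutoff_gradient.

Lemma le_pow2 (R : realType) (x : R) : exists k : nat, x <= 2 ^+ k.
Proof.
exists (Num.truncn `|x|).+1; apply: le_trans (ler_norm x) _; apply: ltW.
apply: lt_le_trans (truncnS_gt _) _; rewrite -natrX ler_nat ltnW//; exact: ltn_expl.
Qed.

Lemma summable_increments_cvg (R : realType) (u e : nat -> R) W :
  (forall N, \sum_(i < N) e i <= W) -> (forall i, `|u i.+1 - u i| <= e i) ->
  cvgn u /\ forall N, `|u N - u 0%N| <= W.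
Proof.
move=> eW ue.
have sW N : \sum_(0 <= i < N) `|u i.+1 - u i| <= W.
  by rewrite big_mkord; apply: le_trans (eW N); apply: ler_sum => i _.
split; last first.
  move=> N; rewrite -(telescope_sumr u (leq0n N)); apply: le_trans (sW N).
  exact: ler_norm_sum.
have c : cvgn [normed series (telescope u)].
  have E N : [normed series (telescope u)] N = \sum_(0 <= i < N) `|u i.+1 - u i|.
    by rewrite /normed_series_of seriesEnat.
  apply: nondecreasing_is_cvgn.
    by apply/nondecreasing_seqP => k; rewrite !E big_nat_recr//= lerDl.
  by exists W => _ [N _ <-]; rewrite E; exact: sW.
have := normed_cvg c; rewrite telescopeK => h.
rewrite (_ : u = (fun N => (u N - u 0%N) + u 0%N)); last by apply/funext => N; rewrite subrK.
by apply: is_cvgD => //; exact: is_cvg_cst.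
Qed.

Lemma dominated_cvg_Rintegral d (T : measurableType d) (R : realType)
    (nu : {measure set T -> \bar R}) (f_ : nat -> T -> R) (f g : T -> R) :
  (forall k, measurable_fun setT (f_ k)) -> measurable_fun setT f ->
  {ae nu, forall x, f_ ^~ x @ \oo --> f x} -> nu.-integrable setT (EFin \o g) ->
  (forall k, {ae nu, forall x, `|f_ k x| <= g x}) ->
  (fun k => \int[nu]_x f_ k x) @ \oo --> \int[nu]_x f x.
Proof.
move=> mf_ mf cf ig fg.
have h1 k : measurable_fun setT (EFin \o f_ k) by exact/measurable_EFinP.
have h2 : measurable_fun setT (EFin \o f) by exact/measurable_EFinP.
have h3 : {ae nu, forall x, setT x -> (fun k => (EFin \o f_ k) x) @ \oo --> (EFin \o f) x}.
  by apply: filterS cf => x h _; apply: cvg_EFin => //; exact: nearW.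
have h5 : {ae nu, forall x k, setT x -> (`|(EFin \o f_ k) x| <= (EFin \o g) x)%E}.
  by apply: filterS (ae_foralln fg) => x h k _; rewrite /= lee_fin; exact: h.
have [i1 _ i2] := dominated_convergence measurableT h1 h2 h3 ig h5.
apply: fine_cvg; rewrite /Rintegral fineK//; exact: integrable_fin_num.
Qed.

(** * The limit of the renormalised T of large cutoffs *)

Section bmo_limit.
Variables (R : realType) (n : nat) (T : ('rV[R]_n -> R) -> 'rV[R]_n -> R).
Variables (K : 'rV[R]_n -> 'rV[R]_n -> R) (w : R -> R) (A W : R).
Local Notation Rn := 'rV[R]_n.
Local Notation mu := (lebesgue_rV R n).
Local Notation L := (Lam R n).
Hypotheses (n0 : (0 < n)%N) (H : CZ_data T K w A W).

Let W0 : 0 <= W. Proof. by case: H => _ _ _ _ []. Qed.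
Let hW N : \sum_(j < N) w (half_pow R j.+1) <= W. Proof. by case: H => _ _ _ _ []. Qed.
Let mw : modulus_of_continuity w. Proof. by case: H. Qed.
Let L0 : 0 < L. Proof. exact: Lam_gt0. Qed.
Let L8 : 8 <= L. Proof. exact: Lam_ge8. Qed.
Let p2 k : 0 < 2 ^+ k :> R. Proof. by rewrite exprn_gt0. Qed.

(** The plateau has twice the radius 2^k, which keeps the ball of radius 2^k at distance from the
    gradient, as [riesz_cutoff] asks. *)
Definition cutoff_pow2 (k : nat) : Rn -> R := cutoff_at (0 : Rn) (2 * 2 ^+ k).

Lemma cutoff_pow2_eq1 k x : `|x| <= 2 * 2 ^+ k -> cutoff_pow2 k x = 1.
Proof. by move=> h; apply: cutoff_at1; rewrite ?mulr_gt0// sub0r normrN. Qed.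

Lemma cutoff_pow2_eq0 k x : 2 * (2 * 2 ^+ k) <= `|x| -> cutoff_pow2 k x = 0.
Proof. by move=> h; apply: cutoff_at0; rewrite ?mulr_gt0// sub0r normrN. Qed.

Lemma cutoff_pow2_nice k : nice (cutoff_pow2 k).
Proof. by apply: cutoff_at_nice; rewrite mulr_gt0. Qed.

Definition shell_pow2 k (x : Rn) : R := cutoff_pow2 k.+1 x - cutoff_pow2 k x.

Lemma shell_pow2_nice k : nice (shell_pow2 k).
Proof. by apply: niceB; exact: cutoff_pow2_nice. Qed.

Lemma shell_pow2_norm k x : `|shell_pow2 k x| <= 1.
Proof.
have := (cutoff_at_ge0 (0 : Rn) (2 * 2 ^+ k) x, cutoff_at_le1 (0 : Rn) (2 * 2 ^+ k) x).
have := (cutoff_at_ge0 (0 : Rn) (2 * 2 ^+ k.+1) x, cutoff_at_le1 (0 : Rn) (2 * 2 ^+ k.+1) x).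
by rewrite /shell_pow2 /cutoff_pow2 ler_norml => -[? ?] [? ?]; apply/andP; split; lra.
Qed.

Lemma shell_pow2_near k x : `|x| <= 2 * 2 ^+ k -> shell_pow2 k x = 0.
Proof.
move=> h; rewrite /shell_pow2 !cutoff_pow2_eq1 ?subrr//; apply: le_trans h _.
by rewrite exprS; have := p2 k; lra.
Qed.

Lemma shell_pow2_far k x : 8 * 2 ^+ k <= `|x| -> shell_pow2 k x = 0.
Proof.
move=> h; rewrite /shell_pow2 !cutoff_pow2_eq0 ?subrr//; apply: le_trans h; rewrite ?exprS; have := p2 k; lra.
Qed.

(** The shift [n + 2] absorbs the factor 4 n into a power of 2, through n <= 2^n; w is then
    evaluated at no more than 2^-(i+1), and the increments sum to a Dini sum uniformly in j. *)
Lemma T_shell_pow2_osc j i (x : Rn) : `|x| < 2 ^+ j ->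
  `|T (shell_pow2 (j + n + 2 + i)) x - T (shell_pow2 (j + n + 2 + i)) 0| <= 32 ^+ n * w (half_pow R i.+1).
Proof.
move=> xj; set k := (j + n + 2 + i)%N; pose s : R := 2 ^+ j.
have s0 : 0 < s by exact: p2.
have nn : n%:R <= 2 ^+ n :> R by rewrite -natrX ler_nat ltnW// ltn_expl.
have nR : 0 < n%:R :> R by rewrite ltr0n.
have ek : 2 ^+ k = s * 2 ^+ n * 4 * 2 ^+ i :> R.
  by rewrite /k !exprD /s (_ : (2 : R) ^+ 2 = 4) ?expr2//; ring.
have Ls : L * s <= 2 * 2 ^+ k.
  rewrite ek /Lam.
  have : n%:R * s <= 2 ^+ n * s * 2 ^+ i.
    by rewrite -mulrA; apply: ler_pM => //; rewrite ?ler_peMr ?exprn_ege1 ?ler1n// ltW.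
  lra.
have z0 y : `|(0 : Rn) - y| < L * s -> shell_pow2 k y = 0.
  rewrite sub0r normrN => h; apply: shell_pow2_near; exact: le_trans (ltW h) Ls.
have zL := nice_Lfun (shell_pow2_nice k).
have bx : ball (0 : Rn) s x by rewrite ball_rVE/= sub0r normrN.
have b0 : ball (0 : Rn) s 0 by exact: ballxx.
have := CZ_osc_int n0 H s0 zL (nice_supp (shell_pow2_nice k)) z0 bx b0.
move=> h; rewrite -lee_fin; apply: le_trans h _.
have k0 : 0 < 2 * 2 ^+ k :> R by rewrite mulr_gt0.
have c0 : 0 <= osc_kernel n w s (2 * 2 ^+ k) by rewrite (osc_kernel_ge0 H) ?ltW.
have r0 : 0 < 8 * 2 ^+ k :> R by rewrite mulr_gt0.
have mz : measurable_fun setT (shell_pow2 k) by case: (shell_pow2_nice k).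
have zfar y : 8 * 2 ^+ k <= `|(0 : Rn) - y| -> shell_pow2 k y = 0.
  by rewrite sub0r normrN => /shell_pow2_far.
apply: (@le_trans _ _ ((osc_kernel n w s (2 * 2 ^+ k))%:E * ((2 * (8 * 2 ^+ k)) ^+ n)%:E)%E).
  apply: (@le_trans _ _ (\int[mu]_(y in far (0 : Rn) s) ((osc_kernel n w s (2 * 2 ^+ k))%:E * `|shell_pow2 k y|%:E))%E).
    apply: ge0_le_integral => //.
    - exact: measurable_far.
    - by move=> y _; rewrite lee_fin mulr_ge0// (osc_kernel_ge0 H)// ltW.
    - apply/measurable_EFinP; apply: measurable_funM; first exact: (measurable_osc_kernel n0 H).
      by apply: measurable_funTS; exact: measurableT_comp.
    - apply: measurable_funeM; apply/measurable_EFinP.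
      by apply: measurable_funTS; exact: measurableT_comp.
    - move=> y _; rewrite -EFinM lee_fin.
      have [hy|hy] := leP `|y| (2 * 2 ^+ k); first by rewrite shell_pow2_near// normr0 !mulr0.
      by rewrite ler_wpM2r// (osc_kernel_anti n0 H) ?(ltW s0)// sub0r normrN ltW.
  rewrite ge0_integralZl//; last 2 first.
  - exact: measurable_far.
  - by apply/measurable_EFinP; apply: measurable_funTS; exact: measurableT_comp.
  apply: lee_wpmul2l; first by rewrite lee_fin.
  apply: le_trans (int_le_ball r0 mz (shell_pow2_norm k) zfar).
  apply: ge0_subset_integral => //; first exact: measurable_far.
  by apply/measurable_EFinP; exact: measurableT_comp.
rewrite -EFinM lee_fin /osc_kernel.
have arg : 4 * n%:R * s / (2 * 2 ^+ k) <= half_pow R i.+1.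
  rewrite ek /half_pow exprVn exprS ler_pdivrMr ?mulr_gt0//.
  have -> : (2 * 2 ^+ i)^-1 * (2 * (s * 2 ^+ n * 4 * 2 ^+ i)) = 4 * 2 ^+ n * s.
    by field; rewrite gt_eqF.
  by rewrite ler_pM2r// ler_pM2l.
have [_ wm _] := mw.
have wle : w (4 * n%:R * s / (2 * 2 ^+ k)) <= w (half_pow R i.+1).
  by apply: wm => //; rewrite divr_ge0 ?mulr_ge0 ?ltW.
have -> : 2 * (8 * 2 ^+ k) = 8 * (2 * 2 ^+ k) :> R by ring.
rewrite (exprMn _ 8 (2 * 2 ^+ k)).
have -> : 32 ^+ n = 2 ^+ n * 8 ^+ n * 2 ^+ n :> R by rewrite -!exprMn; congr (_ ^+ _); ring.
have : (2 * 2 ^+ k : R) ^+ n != 0 by rewrite gt_eqF// exprn_gt0.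
have : 0 <= w (4 * n%:R * s / (2 * 2 ^+ k)).
  by apply: (modulus_ge0 mw); rewrite divr_ge0 ?mulr_ge0 ?ltW.
have : 1 <= 2 ^+ n :> R by rewrite exprn_ege1// ler1n.
have : 0 <= 8 ^+ n :> R by rewrite exprn_ge0.
move: wle; move: (w (4 * _ * _ / _)) (w (half_pow R i.+1)) ((2 * 2 ^+ k) ^+ n) (8 ^+ n) (2 ^+ n) => p q u v t pq v0 t1 p0 u0.
have -> : t * p / u * (v * u) = t * v * p by field.
have tv : 0 <= t * v by rewrite mulr_ge0//; lra.
have q0 : 0 <= q by exact: le_trans pq.
have h1 : t * v * p <= t * v * q by exact: ler_wpM2l.
have : t * v * q <= t * v * q * t by rewrite ler_peMr// mulr_ge0.
lra.
Qed.

Definition osc_sum k : R := \sum_(j < k) T (shell_pow2 j) 0.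

(* The subtracted constants are invisible to functions of integral zero. *)
Definition T_renorm k (x : Rn) : R := T (cutoff_pow2 k) x - osc_sum k.

Lemma T_renorm_increment : {ae mu, forall x, forall k,
  T_renorm k.+1 x - T_renorm k x = T (shell_pow2 k) x - T (shell_pow2 k) 0}.
Proof.
apply: ae_foralln => k; apply: filterS (CZ_add H (cutoff_pow2_nice k) (shell_pow2_nice k)) => x.
rewrite (_ : (fun z => _) = cutoff_pow2 k.+1); last by apply/funext => z; rewrite /shell_pow2 addrC subrK.
by rewrite /T_renorm /osc_sum big_ord_recr/= => ->; ring.
Qed.

Lemma T_renorm_cvg : {ae mu, forall x, forall j, `|x| < 2 ^+ j -> cvgn (T_renorm ^~ x) /\
  forall k, (j + n + 2 <= k)%N -> `|T_renorm k x - T_renorm (j + n + 2) x| <= 32 ^+ n * W}.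
Proof.
apply: filterS T_renorm_increment => x hx j xj.
have [] := @summable_increments_cvg R (fun i => T_renorm (i + (j + n + 2)) x)
  (fun i => 32 ^+ n * w (half_pow R i.+1)) (32 ^+ n * W).
- by move=> N; rewrite -mulr_sumr ler_wpM2l ?exprn_ge0.
- move=> i; rewrite addSn hx (addnC i); exact: T_shell_pow2_osc.
move=> /cvg_ex[l hl] h; split.
  apply/cvg_ex; exists l; by rewrite -(cvg_shiftn (j + n + 2)).
by move=> k hk; have := h (k - (j + n + 2))%N; rewrite add0n subnK.
Qed.

Lemma ball_ae_witness (P : Rn -> Prop) : {ae mu, forall x, P x} -> exists2 x, `|x| < 1 & P x.
Proof.
move=> aeP; apply: contrapT => no.
have mB := measurable_ball_rV (0 : Rn) 1.
have : (mu (ball (0%R : Rn) 1%R) <= mu set0)%E.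
  apply: le_mu_ae => //; apply: filterS aeP => x Px; rewrite ball_rVE/= sub0r normrN => x1.
  by apply: no; exists x.
by rewrite lebesgue_ball// measure0 lee_fin leNgt exprn_gt0// mulr_gt0.
Qed.

(** The constants [osc_sum] are bounded by looking at a single good point of the unit ball, where
    [T (cutoff_pow2 k)] is bounded by C and [T_renorm k] stays within a bounded distance of
    [T_renorm (n + 2)]. *)
Lemma bmo_bounded_limit (C : R) :
  (forall k, {ae mu, forall x, `|x| < 2 ^+ k -> `|T (cutoff_pow2 k) x| <= C}) ->
  exists (b : Rn -> R) (M : R), [/\ measurable_fun setT b, forall x, `|b x| <= M,
    {ae mu, forall x, T_renorm ^~ x @ \oo --> b x} &
    {ae mu, forall x, forall k, (n + 2 <= k)%N -> `|x| < 2 ^+ k -> `|T_renorm k x| <= M}].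
Proof.
move=> /ae_foralln hC.
have [x0 x1 [hC0 hu0]] := ball_ae_witness (filterI hC T_renorm_cvg).
have [_ h0] := hu0 0%N x1.
pose M := C + (C + `|T_renorm (n + 2) x0| + 32 ^+ n * W).
have one k : 1 <= 2 ^+ k :> R by rewrite exprn_ege1// ler1n.
have hS k : (n + 2 <= k)%N -> `|osc_sum k| <= C + `|T_renorm (n + 2) x0| + 32 ^+ n * W.
  move=> hk; have := h0 k hk; have := hC0 k (lt_le_trans x1 (one k)).
  rewrite add0n {2}/T_renorm => a1 a2.
  have := ler_normB (T (cutoff_pow2 k) x0) (T_renorm k x0); rewrite /T_renorm subKr -/(T_renorm k x0).
  have := ler_normD (T_renorm k x0 - T_renorm (n + 2) x0) (T_renorm (n + 2) x0); rewrite subrK.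
  by move=> a3 a4; lra.
have huM : {ae mu, forall x, forall k, (n + 2 <= k)%N -> `|x| < 2 ^+ k -> `|T_renorm k x| <= M}.
  apply: filterS hC => x h k hk xk.
  have := ler_normB (T (cutoff_pow2 k) x) (osc_sum k); have := hS k hk; have := h k xk.
  by rewrite /M -/(T_renorm k x); lra.
have M0 : 0 <= M.
  have := h0 (n + 2)%N (leqnn _); have := hC0 0%N x1; have := normr_ge0 (T (cutoff_pow2 0) x0).
  have := normr_ge0 (T_renorm (n + 2) x0); have : 0 <= 32 ^+ n * W by rewrite mulr_ge0// exprn_ge0.
  by rewrite /M; lra.
pose cl (t : R) := Num.max (- M) (Num.min t M).
have cl_le t : `|cl t| <= M.
  rewrite ler_norml; apply/andP; split; first by rewrite le_max lexx.
  by rewrite ge_max ge_min lexx orbT andbT; lra.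
have cl_id t : `|t| <= M -> cl t = t.
  by rewrite ler_norml => /andP[h1 h2]; rewrite /cl min_l// max_r.
have mcl (f : Rn -> R) : measurable_fun setT f -> measurable_fun setT (cl \o f).
  by move=> mf; apply: measurable_maxr => //; apply: measurable_minr.
have mu_ k : measurable_fun setT (T_renorm k).
  by apply: measurable_funB => //; exact: CZ_measurable H _ (cutoff_pow2_nice k).
(* The upper limit of the clamped functions, clamped once more, is measurable and bounded
   everywhere; almost everywhere it is the limit of [T_renorm]. *)
exists (cl \o (fun x => limn_sup (fun k => cl (T_renorm k x)))), M; split => //.
- apply: (mcl); apply: measurable_fun_limn_sup.
  + by move=> x _; exists M => _ [k _ <-]; apply: le_trans (ler_norm _) (cl_le _).
  + by move=> x _; exists (- M) => _ [k _ <-]; have := cl_le (T_renorm k x); rewrite ler_norml => /andP[].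
  + by move=> k; exact: mcl (mu_ k).
- by move=> x; exact: cl_le.
- apply: filterS2 T_renorm_cvg huM => x h1 h2.
  have [j hj] := le_pow2 (`|x| + 1).
  have xj : `|x| < 2 ^+ j by apply: lt_le_trans hj; rewrite ltrDl.
  have [/cvg_ex[l hl] _] := h1 j xj.
  have ev : \forall k \near \oo, `|T_renorm k x| <= M.
    exists (j + n + 2)%N => // k /= hk; apply: h2; first by lia.
    by apply: lt_le_trans xj _; rewrite ler_weXn2l ?ler1n//; lia.
  have lM : `|l| <= M.
    have hl' : (fun k => `|T_renorm k x|) @ \oo --> `|l| by exact: cvg_norm hl.
    rewrite -(cvg_lim (@Rhausdorff R) hl'); apply: limr_le => //; first by apply/cvg_ex; exists `|l|.
  have hcl : (fun k => cl (T_renorm k x)) @ \oo --> l.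
    apply: cvg_trans hl; apply: near_eq_cvg; apply: filterS ev => k /cl_id ->//.
  by rewrite /= (cvg_limn_inf_sup hcl).2 cl_id.
Qed.

(** The near-covering form of compactness turns the local radii on which [eta] is 1 into one radius
    valid on the whole support of [phi]. *)
Lemma cutoff_separation (phi eta : Rn -> R) : compactly_supported phi -> cutoff phi eta ->
  exists2 r : R, 0 < r & forall x y, phi x != 0 -> eta y != 1 -> r < `|x - y|.
Proof.
move=> /compact_near_coveringP kp [_ _ cut].
have h : \forall r \near (0 : R)^'+, supp phi `<=` (fun x => forall y, `|x - y| <= r -> eta y = 1).
  apply: (kp R (0^'+) (fun r x => forall y, `|x - y| <= r -> eta y = 1)) => x hx.
  have /nbhs_ballP[e /= e0 he] := cut x hx.
  have e20 : 0 < e / 2 by rewrite divr_gt0.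
  exists (ball x (e / 2), [set r | r < e / 2]) => /=.
    by split; [exact: nbhsx_ballx|exact: nbhs_right_lt].
  move=> [z r] /= [xz re] y zy; apply: he; rewrite ball_rVE/=.
  move: xz; rewrite ball_rVE/= => xz.
  by apply: le_lt_trans (ler_distD z _ _) _; lra.
have [r [/= hr r0]] := filter_ex (filterI h (nbhs_right_gt (0 : R))).
exists r => // x y px ey; rewrite ltNge; apply: contra ey => xy.
by apply/eqP; apply: (hr x) => //; exact: supp_neq0.
Qed.

(** For large k, [eta] may be replaced by [cutoff_pow2 k]: their difference stays away from the
    support of [phi], and [CZ_pairing_away] cancels its two contributions. The constants in
    [T_renorm] integrate to zero against [phi], and the far term tends to 0 by dominated
    convergence. *)
Lemma T1_pairing_limit (b : Rn -> R) (M : R) : measurable_fun setT b -> (forall x, `|b x| <= M) ->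
  {ae mu, forall x, T_renorm ^~ x @ \oo --> b x} ->
  {ae mu, forall x, forall k, (n + 2 <= k)%N -> `|x| < 2 ^+ k -> `|T_renorm k x| <= M} ->
  forall phi eta, D0 phi -> cutoff phi eta -> T1_pairing T K eta phi = \int[mu]_x (b x * phi x).
Proof.
move=> mb bM cu hu phi eta [sp kp ip] cut; have [se ke _] := cut.
have np := continuous_compact_nice (is_smooth_continuous sp) kp.
have ne := continuous_compact_nice (is_smooth_continuous se) ke.
have [mp [Mp hMp] [s s0 ps]] := np.
have [r r0 sep] := cutoff_separation kp cut.
(* [r] serves the separation in [CZ_pairing_away], [L * s] the distance required by
   [CZ_pairing_far]. *)
have [k1 hk1] := le_pow2 (r + L * s).
pose k0 := (n + 2 + k1)%N.
pose Phi y := \int[mu]_x (K x y * phi x).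
have mT k : measurable_fun setT (T (cutoff_pow2 k)) by exact: CZ_measurable H _ (cutoff_pow2_nice k).
have mu_ k : measurable_fun setT (T_renorm k) by exact: measurable_funB.
have big k : (k0 <= k)%N -> r + L * s <= 2 ^+ k.
  by move=> hk; apply: le_trans hk1 _; rewrite ler_weXn2l ?ler1n//; rewrite /k0 in hk; lia.
have Lss : s <= L * s by rewrite ler_peMl// ?(le_trans _ L8) ?ler1n// ltW.
have px x : phi x != 0 -> `|x| < s by rewrite ltNge; apply: contraNN => /ps ->.
have aeb k : (k0 <= k)%N -> {ae mu, forall x, `|T_renorm k x * phi x| <= M * `|phi x|}.
  move=> hk; apply: filterS hu => x hx; rewrite normrM.
  have [->|/px xs] := eqVneq (phi x) 0; first by rewrite normr0 !mulr0.
  rewrite ler_wpM2r//; apply: hx; first by rewrite /k0 in hk; lia.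
  by have := big k hk; lra.
have iMp : mu.-integrable setT (EFin \o (fun x => M * `|phi x|)).
  apply: integrable_EFinZ => //; exact: (integrable_abse (nice_integrable np)).
have iu k : (k0 <= k)%N -> mu.-integrable setT (EFin \o (fun x => T_renorm k x * phi x)).
  move=> hk; have mup : measurable_fun setT (fun x => T_renorm k x * phi x) by exact: measurable_funM.
  apply/integrableP; split; first exact/measurable_EFinP.
  have /integrableP[mM iM] := iMp; apply: le_lt_trans iM.
  apply: ae_ge0_le_integral => //.
  - by apply: measurableT_comp => //; exact/measurable_EFinP.
  - exact: measurableT_comp.
  - by apply: filterS (aeb k hk) => x h _; rewrite /= lee_fin (le_trans h)// ler_norm.
have iS k : mu.-integrable setT (EFin \o (fun x => osc_sum k * phi x)).
  by apply: integrable_EFinZ => //; exact: nice_integrable.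
have eT k x : T (cutoff_pow2 k) x * phi x = T_renorm k x * phi x + osc_sum k * phi x by rewrite /T_renorm; ring.
have iT k : (k0 <= k)%N -> mu.-integrable setT (EFin \o (fun x => T (cutoff_pow2 k) x * phi x)).
  move=> hk; have := integrableD measurableT (iu k hk) (iS k).
  by congr (integrable _ _ _); apply/funext => x /=; rewrite eT EFinD.
have IT k : (k0 <= k)%N -> \int[mu]_x (T (cutoff_pow2 k) x * phi x) = \int[mu]_x (T_renorm k x * phi x).
  move=> hk; under eq_Rintegral do rewrite eT.
  rewrite RintegralD//; last exact: iu.
  by rewrite (RintegralZl _ _ (nice_integrable np))// ip mulr0 addr0.
have far k : (k0 <= k)%N -> mu.-integrable setT (EFin \o (fun y => Phi y * (1 - cutoff_pow2 k y))).
  move=> hk; have bk := big k hk.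
  have m1 : measurable_fun setT (fun y : Rn => 1 - cutoff_pow2 k y).
    by apply: measurable_funB => //; case: (cutoff_pow2_nice k).
  have b1 (y : Rn) : `|1 - cutoff_pow2 k y| <= 1.
    rewrite ger0_norm ?subr_ge0 ?cutoff_at_le1// lerBlDr lerDl; exact: cutoff_at_ge0.
  have v1 (y : Rn) : `|(0 : Rn) - y| < L * s -> 1 - cutoff_pow2 k y = 0.
    rewrite sub0r normrN => h; rewrite cutoff_pow2_eq1 ?subrr//; have := p2 k; lra.
  have v2 (x : Rn) : s <= `|(0 : Rn) - x| -> phi x = 0 by rewrite sub0r normrN => /ps.
  by have [] := CZ_pairing_far n0 H s0 np v2 ip m1 b1 v1.
(* With the shift [k0.+1] rather than [k0], the cutoff of index k0 vanishes wherever 1 minus a later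
   cutoff does not, so the far integrand at k0 dominates the whole sequence. *)
have late k : (k0 <= k + k0.+1)%N by rewrite addnS ltnW// ltnS leq_addl.
have main k : (k0 <= k)%N -> T1_pairing T K eta phi =
    \int[mu]_x (T_renorm k x * phi x) + \int[mu]_y (Phi y * (1 - cutoff_pow2 k y)).
  move=> hk; have nchi : nice (fun z => cutoff_pow2 k z - eta z) by apply: niceB => //; exact: cutoff_pow2_nice.
  have bk := big k hk.
  have away x y : phi x != 0 -> cutoff_pow2 k y - eta y != 0 -> r < `|x - y|.
    move=> p0 chi0; have [y1|y1] := leP `|y| (2 * 2 ^+ k).
      by apply: sep => //; move: chi0; rewrite cutoff_pow2_eq1// subr_eq0 eq_sym.
    have := px _ p0; have : `|y| <= `|x - y| + `|x| by rewrite distrC -{1}(subrK x y) ler_normD.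
    have := p2 k; lra.
  have [i1 i2 e] := CZ_pairing_away n0 H r0 np nchi away.
  have aeT : {ae mu, forall x, T (cutoff_pow2 k) x * phi x - T (fun z => cutoff_pow2 k z - eta z) x * phi x = T eta x * phi x}.
    apply: filterS (CZ_add H ne nchi) => x.
    rewrite (_ : (fun z => eta z + _) = cutoff_pow2 k); last by apply/funext => z; rewrite addrC subrK.
    by move=> ->; ring.
  have m1 : measurable_fun setT (fun x => T (cutoff_pow2 k) x * phi x) by exact: measurable_funM.
  have m2 : measurable_fun setT (fun x => T (fun z => cutoff_pow2 k z - eta z) x * phi x).
    by apply: measurable_funM => //; exact: CZ_measurable H _ nchi.
  have m3 : measurable_fun setT (fun x => T eta x * phi x).
    by apply: measurable_funM => //; exact: CZ_measurable H _ ne.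
  rewrite /T1_pairing -(ae_eq_Rintegral (measurable_funB m1 m2) m3 aeT).
  rewrite RintegralB//; last exact: iT.
  rewrite (IT k hk) -e -/Phi.
  have -> : \int[mu]_y ((\int[mu]_x (K x y * phi x)) * (1 - eta y)) =
      \int[mu]_y (Phi y * (1 - cutoff_pow2 k y)) + \int[mu]_y (Phi y * (cutoff_pow2 k y - eta y)).
    rewrite -RintegralD//; last exact: far.
    by apply: eq_Rintegral => y _; rewrite /Phi; ring.
  by rewrite /Phi; ring.
have lim1 : (fun k => \int[mu]_x (T_renorm (k + k0.+1)%N x * phi x)) @ \oo --> \int[mu]_x (b x * phi x).
  apply: dominated_cvg_Rintegral iMp _.
  - by move=> k; exact: measurable_funM.
  - exact: measurable_funM.
  - apply: filterS cu => x hx; apply: cvgM; last exact: cvg_cst.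
    by rewrite (cvg_shiftn k0.+1 (T_renorm ^~ x)).
  - by move=> k; apply: aeb; exact: late.
have mPhi k : (k0 <= k)%N -> measurable_fun setT (fun y => Phi y * (1 - cutoff_pow2 k y)).
  by move=> /far /integrableP[/measurable_EFinP].
have lim2 : (fun k => \int[mu]_y (Phi y * (1 - cutoff_pow2 (k + k0.+1)%N y))) @ \oo --> (0 : R).
  have -> : (0 : R) = \int[mu]_y (0 : R) by rewrite /Rintegral integral0.
  apply: dominated_cvg_Rintegral (integrable_abse (far k0 (leqnn _))) _ => //.
  - by move=> k; apply: mPhi; exact: late.
  - apply: aeW => y; apply: cvg_near_cst; have [j hj] := le_pow2 `|y|.
    exists j => // k /= hk; rewrite cutoff_pow2_eq1 ?subrr ?mulr0//.
    have jk : (j <= k + k0.+1)%N by exact: leq_trans hk (leq_addr _ _).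
    have : 2 ^+ j <= 2 ^+ (k + k0.+1) :> R by rewrite ler_weXn2l ?ler1n.
    by have := p2 (k + k0.+1); lra.
  - move=> k; apply: aeW => y; rewrite /= !normrM.
    have [y1|y1] := leP `|y| (2 * 2 ^+ (k + k0.+1)).
      by rewrite cutoff_pow2_eq1// subrr normr0 mulr0 mulr_ge0.
    have kk : (k0.+1 <= k + k0.+1)%N by exact: leq_addl.
    rewrite (@cutoff_pow2_eq0 k0) ?subr0 ?normr1; last first.
      apply: ltW; apply: le_lt_trans y1; by rewrite -exprS ler_pM2l// ler_weXn2l ?ler1n.
    rewrite ler_wpM2l// ger0_norm ?subr_ge0 ?cutoff_at_le1// lerBlDr lerDl; exact: cutoff_at_ge0.
have := cvgD lim1 lim2; rewrite addr0.
rewrite (_ : (fun k => _) + (fun k => _) = cst (T1_pairing T K eta phi)); last first.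
  by apply/funext => k; rewrite (main (k + k0.+1)%N (late k)).
by move=> /(_ _) h; rewrite -(cvg_lim (@Rhausdorff R) h) lim_cst.
Qed.

End bmo_limit.

Theorem riesz_domination_Linfty (R : realType) (n : nat) (T : ('rV[R]_n -> R) -> 'rV[R]_n -> R)
  (K : 'rV[R]_n -> 'rV[R]_n -> R) : (2 <= n)%N -> CZ_operator T K ->
  riesz_domination T -> T1_in_Linfty T K.
Proof.
move=> hn hT [C C0 hC]; have n0 : (0 < n)%N by exact: leq_trans hn.
have [w [A [W H]]] := CZ_operator_data hT.
have [D D0 hD] := riesz_cutoff R hn.
have hb k : {ae lebesgue_rV R n, forall x : 'rV[R]_n, `|x| < 2 ^+ k -> `|T (cutoff_pow2 k) x| <= C * D}.
  have s1 : is_Ck 1 (cutoff_pow2 k : 'rV[R]_n -> R) by exact: cutoff_at_smooth.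
  have k1 : compactly_supported (cutoff_pow2 k : 'rV[R]_n -> R) by apply: nice_supp; exact: cutoff_pow2_nice.
  apply: filterS (hC _ s1 k1) => x hx xk; rewrite -lee_fin; apply: le_trans hx _.
  rewrite EFinM; apply: lee_wpmul2l; first by rewrite lee_fin ltW.
  by apply: hD => //; rewrite exprn_gt0.
have [b [M [mb bM cu hu]]] := bmo_bounded_limit n0 H hb.
exists b; first exact: bounded_Linfty mb bM.
by move=> phi dphi eta cut; exact: (T1_pairing_limit n0 H mb bM cu hu).
Qed.

Theorem theorem1p2 (R : realType) (n : nat) (hn : (2 <= n)%N)
  (T : ('rV[R]_n -> R) -> ('rV[R]_n -> R)) (K : 'rV[R]_n -> 'rV[R]_n -> R)
  (hT : CZ_operator T K) :
  riesz_domination T <-> T1_in_Linfty T K.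
Proof.
by split; [exact: riesz_domination_Linfty|exact: Linfty_riesz_domination].
Qed.
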